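(* Let $T\subset\mathbb{R}^3$ be a regular tetrahedron, and let $S\subset\mathbb{R}^3$ be a uniform polyhedron, considered up to similarity of $\mathbb{R}^3$. Then $S$ admits a $4$-face embedding in $T$, written $S\subset_4 T$ (that is, some polyhedron $S'$ similar to $S$ and distinct from $T$ is a proper subset of $T$ such that $\partial S'\cap\partial T$ consists of precisely four faces of $S'$), if and only if $S$ is a regular icosahedron, a regular octahedron, or an Archimedean solid.
   Context: A polyhedron is the convex hull of a finite set of points in $\mathbb{R}^3$, assumed here to have nonempty interior; in particular all polyhedra are convex. A polygon is regular if all its side lengths are equal and all its internal angles are equal. A polyhedron is vertex-transitive if every vertex can be mapped to any other vertex by an isometry of $\mathbb{R}^3$ that maps the polyhedron to itself. A polyhedron is uniform if all its (2-dimensional) faces are regular polygons and it is vertex-transitive. For a polyhedron $S$, $\partial S$ denotes its boundary, i.e. the union of its faces. $k$-face embedding: let $S_1$ and $S_2$ be two distinct uniform polyhedra. Then $S_1\subset_k S_2$ means that $S_1$ is a proper subset of $S_2$ and $\partial S_1\cap\partial S_2$ consists of precisely $k$ faces of $S_1$ (i.e. it is the union of exactly $k$ distinct faces of $S_1$). Uniform polyhedra are considered up to similarity (isometries of $\mathbb{R}^3$, including reflections, and scalings), so that $S_1$ may be placed and scaled freely. The Platonic solids are the five regular polyhedra: tetrahedron, cube, octahedron, dodecahedron, icosahedron. The uniform $n$-prism ($n\ge 3$) has two parallel congruent regular $n$-gonal faces and $n$ square faces; the uniform $n$-antiprism ($n\ge 3$) has two parallel congruent regular $n$-gonal faces and $2n$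 equilateral triangular faces (the $3$-antiprism is the regular octahedron, and the $4$-prism is the cube). An Archimedean solid is a uniform polyhedron that is not a Platonic solid, not a prism and not an antiprism. By the classical classification of uniform polyhedra, up to similarity these are the thirteen solids: truncated tetrahedron, truncated octahedron, truncated cube, truncated icosahedron, truncated dodecahedron, cuboctahedron, icosidodecahedron, rhombicuboctahedron, rhombicosidodecahedron, truncated cuboctahedron, truncated icosidodecahedron, snub cube, snub dodecahedron. *)

(* Defs.v *)
From HB Require Import structures.
From mathcomp Require Import all_boot all_order all_algebra.
From mathcomp Require Import all_classical all_reals all_analysis.

Set Implicit Arguments.
Unset Strict Implicit.
Unset Printing Implicit Defensive.

Import Order.TTheory GRing.Theory Num.Theory.
Import numFieldNormedType.Exports.

Local Open Scope classical_set_scope.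
Local Open Scope ring_scope.

Section Polyhedra.
Variable R : realType.

Local Notation point := 'rV[R]_3.

(* The norm that the library puts on row vectors is the sup norm, hence the
   explicit Euclidean structure; the topology is the same for both norms. *)
Definition dot (u v : point) : R := \sum_(i < 3) u 0 i * v 0 i.

Definition edist (u v : point) : R := Num.sqrt (dot (u - v) (u - v)).

(* The angle at q between the segments [q, p] and [q, r]. *)
Definition angle (p q r : point) : R :=
  acos (dot (p - q) (r - q) / (edist p q * edist r q)).

(* Distance-preserving (resp. distance-scaling) self-maps of a Euclidean space
   are automatically bijective and affine. *)
Definition euclidean_isometry (f : point -> point) : Prop :=
  forall x y, edist (f x) (f y) = edist x y.

Definition similarity (f : point -> point) : Prop :=
  exists2 c : R, 0 < c & forall x y, edist (f x) (f y) = c * edist x y.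

Definition similar (A B : set point) : Prop :=
  exists2 f, similarity f & f @` A = B.

Definition conv_hull (A : set point) : set point :=
  smallest (@convex_set R point) A.

Definition polytope (P : set point) : Prop :=
  exists2 A : set point, finite_set A & P = conv_hull A.

Definition polyhedron (P : set point) : Prop :=
  polytope P /\ interior P !=set0.

(* The affine span of A has dimension k: it is x0 + (row space of M), where
   x0 and the k points x0 + row i M can be taken in A. *)
Definition affine_dim (k : nat) (A : set point) : Prop :=
  exists (x0 : point) (M : 'M[R]_(k, 3)),
    [/\ \rank M = k, A x0, forall i, A (x0 + row i M)
      & forall x, A x -> (x - x0 <= M)%MS].

(* The k-dimensional faces of P: intersections with supporting planes. It also
   applies to a polygon P lying in a plane of R^3; the degenerate case a = 0
   only yields P itself (or the empty set), which has another dimension for the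
   values of k used below. *)
Definition face (k : nat) (P F : set point) : Prop :=
  (exists (a : point) (b : R),
     (forall x, P x -> dot a x <= b) /\ F = P `&` [set x | dot a x = b])
  /\ affine_dim k F.

Definition vertex (P : set point) (v : point) : Prop := face 0 P [set v].

Definition side (P : set point) (p q : point) : Prop :=
  face 1 P (conv_hull [set p; q]).

Definition boundary (P : set point) : set point :=
  [set x | exists2 F, face 2 P F & F x].

Definition polygon (F : set point) : Prop := polytope F /\ affine_dim 2 F.

Definition regular_polygon (F : set point) : Prop :=
  [/\ polygon F,
      forall p q p' q', side F p q -> side F p' q' -> edist p q = edist p' q'
    & forall p q r p' q' r',
        side F p q -> side F q r -> p != r ->
        side F p' q' -> side F q' r' -> p' != r' ->
        angle p q r = angle p' q' r'].

Definition vertex_transitive (P : set point) : Prop :=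
  forall v w, vertex P v -> vertex P w ->
  exists f, [/\ euclidean_isometry f, f @` P = P & f v = w].

Definition uniform (P : set point) : Prop :=
  [/\ polyhedron P, forall F, face 2 P F -> regular_polygon F
    & vertex_transitive P].

(* The relation "S1 subset_k S2", where S1 and S2 are taken as placed in
   space. *)
Definition face_embedded (k : nat) (S1 S2 : set point) : Prop :=
  S1 `<` S2 /\
  exists F : 'I_k -> set point,
    [/\ injective F, forall i, face 2 S1 (F i)
      & boundary S1 `&` boundary S2 = \bigcup_i F i].

Definition admits_face_embedding (k : nat) (S1 S2 : set point) : Prop :=
  exists2 S1', similar S1 S1' & face_embedded k S1' S2.

(* Named solids, up to similarity, are given by the standard coordinates of
   their vertices. The coordinate indices i, i + 1, i + 2 are taken cyclically
   in 'I_3. *)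

Definition golden : R := (1 + Num.sqrt 5) / 2.

Definition tetrahedron_vertices : set point :=
  [set v | (forall i, `|v 0 i| = 1) /\ \prod_i v 0 i = 1].

Definition cube_vertices : set point := [set v | forall i, `|v 0 i| = 1].

Definition octahedron_vertices : set point :=
  [set v | exists i : 'I_3,
     [/\ `|v 0 i| = 1, v 0 (i + 1) = 0 & v 0 (i + 2) = 0]].

Definition dodecahedron_vertices : set point :=
  cube_vertices `|`
  [set v | exists i : 'I_3,
     [/\ v 0 i = 0, `|v 0 (i + 1)| = golden^-1 & `|v 0 (i + 2)| = golden]].

Definition icosahedron_vertices : set point :=
  [set v | exists i : 'I_3,
     [/\ v 0 i = 0, `|v 0 (i + 1)| = 1 & `|v 0 (i + 2)| = golden]].

(* The bases are regular n-gons of circumradius 1, hence of side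
   2 * sin (pi / n), which is also the distance between them, so that the
   lateral faces are squares. *)
Definition prism_vertices (n : nat) : set point :=
  [set v | exists k : 'I_n,
     [/\ v 0 0 = cos (k%:R * (2 * pi / n%:R)),
         v 0 1 = sin (k%:R * (2 * pi / n%:R))
       & `|v 0 2| = sin (pi / n%:R)]].

(* Half the distance between the bases: the lateral edges, of squared length
   (2 * sin (pi / n / 2)) ^+ 2 + (2 * height) ^+ 2, must have the same length
   2 * sin (pi / n) as the sides of the bases. *)
Definition antiprism_height (n : nat) : R :=
  Num.sqrt (sin (pi / n%:R) ^+ 2 - sin (pi / n%:R / 2) ^+ 2).

(* The vertices alternate between the two bases: the even k give one regular
   n-gon, the odd k the other one, turned by pi / n. *)
Definition antiprism_vertices (n : nat) : set point :=
  [set v | exists k : 'I_(n.*2),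
     [/\ v 0 0 = cos (k%:R * (pi / n%:R)),
         v 0 1 = sin (k%:R * (pi / n%:R))
       & v 0 2 = (-1) ^+ k * antiprism_height n]].

Definition regular_tetrahedron (P : set point) : Prop :=
  similar (conv_hull tetrahedron_vertices) P.

Definition regular_cube (P : set point) : Prop :=
  similar (conv_hull cube_vertices) P.

Definition regular_octahedron (P : set point) : Prop :=
  similar (conv_hull octahedron_vertices) P.

Definition regular_dodecahedron (P : set point) : Prop :=
  similar (conv_hull dodecahedron_vertices) P.

Definition regular_icosahedron (P : set point) : Prop :=
  similar (conv_hull icosahedron_vertices) P.

Definition platonic (P : set point) : Prop :=
  [\/ regular_tetrahedron P, regular_cube P, regular_octahedron P
    | regular_dodecahedron P \/ regular_icosahedron P].

Definition uniform_prism (P : set point) : Prop :=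
  exists2 n : nat, (3 <= n)%N & similar (conv_hull (prism_vertices n)) P.

Definition uniform_antiprism (P : set point) : Prop :=
  exists2 n : nat, (3 <= n)%N & similar (conv_hull (antiprism_vertices n)) P.

Definition archimedean (P : set point) : Prop :=
  [/\ uniform P, ~ platonic P, ~ uniform_prism P & ~ uniform_antiprism P].

End Polyhedra.

(* Main.v *)
Require Import Defs.
From mathcomp Require Import all_boot all_order all_algebra.
From mathcomp Require Import all_classical all_reals all_analysis.
From mathcomp Require Import ring lra.

Set Implicit Arguments.
Unset Strict Implicit.
Unset Printing Implicit Defensive.

Import Order.TTheory GRing.Theory Num.Theory.
Import numFieldNormedType.Exports.

Local Open Scope classical_set_scope.
Local Open Scope ring_scope.

(** A full convex body S embeds in a regular tetrahedron along four faces exactly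
    when S is not itself a regular tetrahedron and four of its facets have the
    outer normals of a regular tetrahedron: the four facet planes then bound the
    circumscribed tetrahedron. Hence the question is which uniform polyhedra have
    four such facet directions.

    The vertex set W of S lies on a sphere about the origin and its symmetry
    group G is transitive on W. If the rotations Q such that Q or -Q is in G
    preserve no line, take one of least angle: two of its axes that are nearest
    to each other give a linear recurrence for the points of a skew polygon of
    axes, and minimality of their distance forces a rotation of order 3 whose
    axes contain a tetrahedral frame u_1, ..., u_4. Such third turns belong to G,
    being their own fourth powers, and a functional u_i is maximal on W either on
    a facet or at a single vertex, proportional to u_i. In the first case (for
    all u_i or all -u_i) the directions are found; in the second W is a cube or
    a dodecahedron. If a line is preserved, W consists of two parallel regular
    polygons, so that S is a regular tetrahedron, a prism or an antiprism.

    Conversely, the facet normals v of the cube, the dodecahedron, the prisms and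
    the n-antiprisms with n >= 4 have, for a suitable unit vector e, only values
    of (v . e) ^ 2 that violate the identity sum_i (u_i . e) ^ 2 = 4 / 3 of a
    tetrahedral frame. *)

(** The Archimedean solids are defined by exclusion, so directions must come from symmetry alone and
    cannot be read off coordinates. For third turns the recurrence leaves three possible cosines of
    nearest axes, -1/3, 1/3 and sqrt 5 / 3: those of neighbouring vertices of the tetrahedron, the
    cube and the dodecahedron. In each case at most one more turn and a change of sign yield two
    axes at cosine -1/3, from which the frame grows. The argument is stated for a set of unit
    vectors closed under turns about its members, and it runs twice: on the axes, and on the
    vertices themselves when these are closed under third turns about one another. The test that
    rejects antiprisms must let the octahedron pass, which is the 3-antiprism: lateral normals of
    the n-antiprism have squared vertical part at most (1 - C) / (3 (1 + C)) with C = cos (pi / n),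
    which is 1/9 for n = 3 and smaller for n >= 4. *)

(** * Vector algebra, orthogonal matrices and rotations of space *)

Section Vectors.
Variable R : realType.
Local Notation point := 'rV[R]_3.
Local Notation edist := Defs.edist.
Implicit Types (u v w x y z a b c p q r : point) (k l : R).

Definition vec3 (k l m : R) : point := \row_i [:: k; l; m]`_i.

Lemma vec3E0 k l m : vec3 k l m 0 0 = k. Proof. by rewrite mxE. Qed.
Lemma vec3E1 k l m : vec3 k l m 0 1 = l. Proof. by rewrite mxE. Qed.
Lemma vec3E2 k l m : vec3 k l m 0 2 = m. Proof. by rewrite mxE. Qed.
Definition vec3E := (vec3E0, vec3E1, vec3E2).

Lemma ord3P (i : 'I_3) : [\/ i = 0, i = 1 | i = 2].
Proof.
case: i => [[|[|[|//]]] h]; [constructor 1|constructor 2|constructor 3];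
  exact: val_inj.
Qed.

Lemma vec3P u v :
  u 0 0 = v 0 0 -> u 0 1 = v 0 1 -> u 0 2 = v 0 2 -> u = v.
Proof.
by move=> h0 h1 h2; apply/rowP => i; case: (ord3P i) => ->.
Qed.

Lemma big_ord3 (V : nmodType) (F : 'I_3 -> V) :
  \sum_(i < 3) F i = F 0 + F 1 + F 2.
Proof.
rewrite !big_ord_recl big_ord0 addr0 addrA.
congr (_ + F _ + F _); exact: val_inj.
Qed.

Lemma dotE u v : dot u v = u 0 0 * v 0 0 + u 0 1 * v 0 1 + u 0 2 * v 0 2.
Proof. by rewrite /dot big_ord3. Qed.

Definition cross u v : point :=
  vec3 (u 0 1 * v 0 2 - u 0 2 * v 0 1) (u 0 2 * v 0 0 - u 0 0 * v 0 2)
       (u 0 0 * v 0 1 - u 0 1 * v 0 0).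

Lemma addE u v i : (u + v) 0 i = u 0 i + v 0 i. Proof. by rewrite mxE. Qed.
Lemma oppE u i : (- u) 0 i = - u 0 i. Proof. by rewrite mxE. Qed.
Lemma scaleE k u i : (k *: u) 0 i = k * u 0 i. Proof. by rewrite mxE. Qed.
Lemma zeroE i : (0 : point) 0 i = 0. Proof. by rewrite mxE. Qed.
Lemma crossE0 u v : cross u v 0 0 = u 0 1 * v 0 2 - u 0 2 * v 0 1.
Proof. by rewrite vec3E. Qed.
Lemma crossE1 u v : cross u v 0 1 = u 0 2 * v 0 0 - u 0 0 * v 0 2.
Proof. by rewrite vec3E. Qed.
Lemma crossE2 u v : cross u v 0 2 = u 0 0 * v 0 1 - u 0 1 * v 0 0.
Proof. by rewrite vec3E. Qed.
Lemma mulE u (Q : 'M[R]_3) j :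
  (u *m Q) 0 j = u 0 0 * Q 0 j + u 0 1 * Q 1 j + u 0 2 * Q 2 j.
Proof. by rewrite mxE big_ord3. Qed.
Definition coordE := (dotE, addE, oppE, scaleE, zeroE, crossE0, crossE1,
  crossE2, mulE, vec3E).

Lemma dotC u v : dot u v = dot v u.
Proof. by rewrite !dotE; ring. Qed.
Lemma dotDl u v w : dot (u + v) w = dot u w + dot v w.
Proof. by rewrite !coordE; ring. Qed.
Lemma dotDr u v w : dot w (u + v) = dot w u + dot w v.
Proof. by rewrite !coordE; ring. Qed.
Lemma dotNl u w : dot (- u) w = - dot u w.
Proof. by rewrite !coordE; ring. Qed.
Lemma dotNr u w : dot w (- u) = - dot w u.
Proof. by rewrite !coordE; ring. Qed.
Lemma dotZl k u w : dot (k *: u) w = k * dot u w.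
Proof. by rewrite !coordE; ring. Qed.
Lemma dotZr k u w : dot w (k *: u) = k * dot w u.
Proof. by rewrite !coordE; ring. Qed.
Lemma dot0l w : dot 0 w = 0.
Proof. by rewrite !coordE; ring. Qed.
Lemma dot0r w : dot w 0 = 0.
Proof. by rewrite !coordE; ring. Qed.
Definition dotL := (dotDl, dotDr, dotNl, dotNr, dotZl, dotZr, dot0l, dot0r).

Lemma dot_ge0 u : 0 <= dot u u.
Proof. by rewrite dotE -!expr2 !addr_ge0 ?sqr_ge0. Qed.

Lemma dot_eq0 u : (dot u u == 0) = (u == 0).
Proof.
apply/eqP/eqP => [|->]; last by rewrite dot0l.
rewrite dotE -!expr2 => h.
have := sqr_ge0 (u 0 0); have := sqr_ge0 (u 0 1); have := sqr_ge0 (u 0 2).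
move=> h2 h1 h0.
by apply: vec3P; rewrite zeroE; apply/eqP; rewrite -sqrf_eq0; apply/eqP; lra.
Qed.

Lemma dot_gt0 u : u != 0 -> 0 < dot u u.
Proof. by move=> u0; rewrite lt_neqAle dot_ge0 eq_sym dot_eq0 u0. Qed.

Lemma dot_eq0P u : dot u u = 0 -> u = 0.
Proof. by move/eqP; rewrite dot_eq0 => /eqP. Qed.

Lemma dot_inj u : (forall x, dot u x = 0) -> u = 0.
Proof. by move=> h; apply: dot_eq0P. Qed.

Lemma dot_eqP u v : (forall x, dot u x = dot v x) -> u = v.
Proof.
move=> h; apply/eqP; rewrite -subr_eq0; apply/eqP; apply: dot_inj => x.
by rewrite dotDl dotNl h subrr.
Qed.

Lemma dot_cross u v : dot (cross u v) (cross u v) =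
  dot u u * dot v v - dot u v ^+ 2.
Proof. by rewrite !coordE; ring. Qed.

Lemma cross_dotl u v : dot u (cross u v) = 0.
Proof. by rewrite !coordE; ring. Qed.
Lemma cross_dotr u v : dot v (cross u v) = 0.
Proof. by rewrite !coordE; ring. Qed.

Lemma crossN u v : cross v u = - cross u v.
Proof. by apply: vec3P; rewrite !coordE; ring. Qed.
Lemma crossvv u : cross u u = 0.
Proof. by apply: vec3P; rewrite !coordE; ring. Qed.
Lemma cross_crossl u v w :
  cross (cross u v) w = dot u w *: v - dot v w *: u.
Proof. by apply: vec3P; rewrite !coordE; ring. Qed.

Lemma cauchy_schwarz u v : dot u v ^+ 2 <= dot u u * dot v v.
Proof. by rewrite -subr_ge0 -dot_cross dot_ge0. Qed.

(* Lagrange's identity turns a vanishing cross product into collinearity. *)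
Lemma cross0P u v : u != 0 -> cross u v = 0 -> v = (dot u v / dot u u) *: u.
Proof.
move=> u0 h; have n0 : dot u u != 0 by rewrite dot_eq0.
have : cross (cross u v) u = 0.
  by rewrite h; apply: vec3P; rewrite !coordE; ring.
rewrite cross_crossl (dotC v) => /eqP; rewrite subr_eq0 => /eqP e.
by rewrite mulrC -scalerA -e scalerA mulVf // scale1r.
Qed.

Lemma edistE u v : edist u v ^+ 2 = dot (u - v) (u - v).
Proof. by rewrite /edist sqr_sqrtr // dot_ge0. Qed.

Lemma edist_eq u v u' v' :
  edist u v = edist u' v' <->
  dot (u - v) (u - v) = dot (u' - v') (u' - v').
Proof. by split=> [h|h]; [rewrite -!edistE h|rewrite /edist h]. Qed.

(** Points are row vectors, so matrices act on the right and [P *m Q] applies [P] first. *)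
Definition orthm (Q : 'M[R]_3) := Q *m Q^T = 1%:M.

Lemma dot_mx u v : dot u v = (u *m v^T) 0 0.
Proof. by rewrite mxE; apply: eq_bigr => i _; rewrite mxE. Qed.

Lemma dot_orth Q u v : orthm Q -> dot (u *m Q) (v *m Q) = dot u v.
Proof.
by move=> h; rewrite !dot_mx trmx_mul mulmxA -(mulmxA u) h mulmx1.
Qed.

Lemma orthmV Q : orthm Q -> Q^T *m Q = 1%:M.
Proof. by move=> /mulmx1C. Qed.

Lemma orthmT Q : orthm Q -> orthm Q^T.
Proof. by move=> /orthmV h; rewrite /orthm trmxK. Qed.

Lemma orthmM P Q : orthm P -> orthm Q -> orthm (P *m Q).
Proof.
move=> hP hQ; rewrite /orthm trmx_mul mulmxA -(mulmxA P) hQ mulmx1.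
exact: hP.
Qed.

Lemma orthmN Q : orthm Q -> orthm (- Q).
Proof. by rewrite /orthm linearN /= mulmxN mulNmx opprK. Qed.

Lemma orthm1 : orthm 1%:M.
Proof. by rewrite /orthm trmx1 mulmx1. Qed.

Lemma orthmK Q x : orthm Q -> x *m Q *m Q^T = x.
Proof. by move=> h; rewrite -mulmxA h mulmx1. Qed.

Lemma orthmKV Q x : orthm Q -> x *m Q^T *m Q = x.
Proof. by move=> h; rewrite -mulmxA orthmV // mulmx1. Qed.

Lemma dot_orthl Q u v : orthm Q -> dot (u *m Q) v = dot u (v *m Q^T).
Proof. by move=> h; rewrite -{1}(orthmKV v h) dot_orth. Qed.

Definition mat3 u v w : 'M[R]_3 := \matrix_(i, j) [:: u; v; w]`_i 0 j.

Lemma mat3E u v w x : x *m mat3 u v w = x 0 0 *: u + x 0 1 *: v + x 0 2 *: w.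
Proof. by apply: vec3P; rewrite !coordE !mxE. Qed.

Lemma mat3TE u v w x : x *m (mat3 u v w)^T = vec3 (dot x u) (dot x v) (dot x w).
Proof. by apply: vec3P; rewrite !coordE !mxE /=. Qed.

Lemma mx_rowP (P Q : 'M[R]_3) : (forall x : point, x *m P = x *m Q) -> P = Q.
Proof. by move=> h; apply/row_matrixP => i; rewrite !rowE h. Qed.

Definition orthonormal u v w :=
  [/\ dot u u = 1, dot v v = 1 & dot w w = 1] /\
  [/\ dot u v = 0, dot u w = 0 & dot v w = 0].

Lemma orthm_mat3 u v w : orthonormal u v w -> orthm (mat3 u v w).
Proof.
move=> [[uu vv ww] [uv uw vw]]; apply: mx_rowP => x.
rewrite mulmxA mulmx1 mat3E mat3TE !dotL (dotC v u) (dotC w u) (dotC w v).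
rewrite uu vv ww uv uw vw.
by apply: vec3P; rewrite !coordE; ring.
Qed.

Lemma orthonormal_decomp u v w x : orthonormal u v w ->
  x = dot x u *: u + dot x v *: v + dot x w *: w.
Proof.
move=> /orthm_mat3 h; rewrite -{1}(orthmKV x h) mat3TE mat3E.
by rewrite !coordE.
Qed.

Lemma orthonormal_cross u v : dot u u = 1 -> dot v v = 1 -> dot u v = 0 ->
  orthonormal u v (cross u v).
Proof.
move=> uu vv uv; split; split=> //; rewrite ?cross_dotl ?cross_dotr //.
by rewrite dot_cross uu vv uv; ring.
Qed.

Definition unit_of u : point := (Num.sqrt (dot u u))^-1 *: u.

Lemma unit_ofP u : u != 0 -> dot (unit_of u) (unit_of u) = 1.
Proof.
move=> u0; have n0 := dot_gt0 u0.
rewrite !dotL mulrA -invfM -expr2 sqr_sqrtr ?dot_ge0 // mulVf //.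
by rewrite gt_eqF.
Qed.

Lemma exists_orth u : u != 0 -> exists2 v, v != 0 & dot u v = 0.
Proof.
move=> u0.
have [h|h] := eqVneq (u 0 0) 0.
  exists (vec3 1 0 0); last by rewrite !coordE h; ring.
  by apply/eqP => /rowP/(_ 0); rewrite vec3E zeroE; apply/eqP; rewrite oner_eq0.
exists (vec3 (- u 0 1) (u 0 0) 0); last by rewrite !coordE; ring.
by apply/eqP => /rowP/(_ 1); rewrite vec3E zeroE; apply/eqP.
Qed.

Lemma exists_frame u : dot u u = 1 -> exists v w, orthonormal u v w.
Proof.
move=> uu; have u0 : u != 0 by rewrite -dot_eq0 uu oner_eq0.
have [v v0 uv] := exists_orth u0.
exists (unit_of v), (cross u (unit_of v)).
by apply: orthonormal_cross => //; rewrite ?unit_ofP // dotZr uv mulr0.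
Qed.

Lemma dot_cross_det u v w : dot (cross u v) w = \det (mat3 u v w).
Proof.
rewrite (expand_det_row _ 0) big_ord3 /cofactor.
rewrite !(expand_det_row _ 0) !big_ord_recl !big_ord0 /cofactor !det_mx11 !mxE.
rewrite !coordE /= /bump /=.
have e01 : lift 0 ord0 = 1 :> 'I_3 by exact: val_inj.
have e02 : lift 0 (lift ord0 0) = 2 :> 'I_3 by exact: val_inj.
have e02' : lift 0 (lift ord0 ord0) = 2 :> 'I_3 by exact: val_inj.
have e01' : lift 0 (lift (lift ord0 ord0) 0) = 1 :> 'I_3 by exact: val_inj.
have e10 : lift 1 ord0 = 0 :> 'I_3 by exact: val_inj.
have e12 : lift 1 (lift ord0 0) = 2 :> 'I_3 by exact: val_inj.
have e12' : lift 1 (lift ord0 ord0) = 2 :> 'I_3 by exact: val_inj.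
have e10' : lift 1 (lift (lift ord0 ord0) 0) = 0 :> 'I_3 by exact: val_inj.
have e20 : lift 2 ord0 = 0 :> 'I_3 by exact: val_inj.
have e21 : lift 2 (lift ord0 0) = 1 :> 'I_3 by exact: val_inj.
have e21' : lift 2 (lift ord0 ord0) = 1 :> 'I_3 by exact: val_inj.
have e20' : lift 2 (lift (lift ord0 ord0) 0) = 0 :> 'I_3 by exact: val_inj.
rewrite !(e01, e01', e02, e02', e10, e10', e12, e12', e20, e20', e21, e21').
by rewrite !expr0 !expr1; ring.
Qed.

Lemma mat3M u v w Q : mat3 u v w *m Q = mat3 (u *m Q) (v *m Q) (w *m Q).
Proof.
by apply: mx_rowP => x; rewrite mulmxA !mat3E !mulmxDl -!scalemxAl.
Qed.

(** Paired with an arbitrary vector, both sides become determinants, so the factor between them is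
    det Q = 1. *)
Lemma cross_orth Q u v : orthm Q -> \det Q = 1 ->
  cross (u *m Q) (v *m Q) = cross u v *m Q.
Proof.
move=> h d; apply: dot_eqP => x.
rewrite -(orthmKV x h) dot_orth // !dot_cross_det.
by rewrite -[RHS]mulr1 -d -det_mulmx mat3M.
Qed.

Lemma det_orth Q : orthm Q -> \det Q = 1 \/ \det (- Q) = 1.
Proof.
move=> h; have : \det Q ^+ 2 = 1 ^+ 2.
  by rewrite expr2 -{2}(det_tr Q) -det_mulmx h det1 expr1n.
move/eqP; rewrite eqf_sqr => /orP[/eqP->|/eqP h1]; first by left.
by right; rewrite -scaleN1r detZ h1; ring.
Qed.

(** Rodrigues' formula for the turn about the unit axis [v] with cosine [C] and sine [s]. Carrying
    this pair instead of an angle keeps the later identities polynomial. *)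
Definition rot v (C s : R) x : point :=
  C *: x + s *: cross v x + ((1 - C) * dot v x) *: v.

Lemma rot_orth Q v C s x : orthm Q -> \det Q = 1 ->
  rot (v *m Q) C s (x *m Q) = rot v C s x *m Q.
Proof.
move=> h d; rewrite /rot cross_orth // dot_orth //.
by rewrite !mulmxDl -!scalemxAl.
Qed.

Lemma rotN v C s x : rot (- v) C (- s) x = rot v C s x.
Proof. by apply: vec3P; rewrite !coordE; ring. Qed.

Lemma rot_comp v C s C' s' x : dot v v = 1 ->
  rot v C s (rot v C' s' x) = rot v (C * C' - s * s') (C * s' + s * C') x.
Proof.
move=> vv; rewrite /rot.
have -> : dot v (C' *: x + s' *: cross v x + ((1 - C') * dot v x) *: v)
    = dot v x by rewrite !dotL cross_dotl vv; ring.
have -> : cross v (C' *: x + s' *: cross v x + ((1 - C') * dot v x) *: v) =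
    C' *: cross v x + s' *: (dot v x *: v - x).
  rewrite -{6}(scale1r x) -vv.
  by apply: vec3P; rewrite !coordE; ring.
by apply: vec3P; rewrite !coordE; ring.
Qed.

Lemma rot1 v x : rot v 1 0 x = x.
Proof. by apply: vec3P; rewrite !coordE; ring. Qed.

Lemma rot_axis v C s : dot v v = 1 -> rot v C s v = v.
Proof.
move=> vv; rewrite /rot crossvv vv.
by apply: vec3P; rewrite !coordE; ring.
Qed.

Lemma rot_dot_axis v C s x : dot v v = 1 -> dot v (rot v C s x) = dot v x.
Proof. by move=> vv; rewrite /rot !dotL cross_dotl vv; ring. Qed.

Lemma rot_self v C s x : dot v v = 1 ->
  dot x (rot v C s x) = C * dot x x + (1 - C) * dot v x ^+ 2.
Proof. by move=> vv; rewrite /rot !dotL cross_dotr (dotC x v); ring. Qed.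

(** Equality case of the Cauchy-Schwarz inequality, by [rot_self]. *)
Lemma rot_fixed v C s x : dot v v = 1 -> C != 1 -> rot v C s x = x ->
  x = dot v x *: v.
Proof.
move=> vv C1 h; have := rot_self C s x vv; rewrite h => e.
have {}e : (1 - C) * (dot x x - dot v x ^+ 2) = 0 by lra.
move/eqP: e; rewrite mulf_eq0 subr_eq0 eq_sym (negPf C1) /= => /eqP e.
apply/eqP; rewrite -subr_eq0; apply/eqP; apply: dot_eq0P.
by rewrite !dotL vv (dotC x v); lra.
Qed.

(** Euler's rotation theorem; the sign of [s] depends on the orientation chosen for the axis. *)
Lemma rot_exists Q : orthm Q -> \det Q = 1 -> exists v C s,
  [/\ dot v v = 1, C ^+ 2 + s ^+ 2 = 1 & forall x, x *m Q = rot v C s x].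
Proof.
move=> h d.
(* [Q - 1 = Q (1 - Q)^T] has the determinant of [1 - Q], which is that of [Q - 1] times (-1)^3. *)
have d0 : \det (Q - 1%:M) = 0.
  have e1 : \det (Q - 1%:M) = \det (1%:M - Q).
    have -> : Q - 1%:M = Q *m (1%:M - Q)^T.
      by rewrite linearB /= mulmxBr trmx1 mulmx1 h.
    by rewrite det_mulmx d det_tr mul1r.
  have e2 : \det (1%:M - Q) = - \det (Q - 1%:M).
    have -> : 1%:M - Q = -1 *: (Q - 1%:M) by rewrite scaleN1r opprB.
    by rewrite detZ; ring.
  lra.
have /det0P [u u0 /eqP] : \det (Q - 1%:M) == 0 by rewrite d0.
rewrite mulmxBr mulmx1 subr_eq0 => /eqP uQ.
pose v := unit_of u; have vv : dot v v = 1 by exact: unit_ofP.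
have vQ : v *m Q = v by rewrite /v /unit_of -scalemxAl uQ.
clearbody v.
have [w [b F]] := exists_frame vv.
have [[_ ww _] [vw _ _]] := F.
have {b} F := orthonormal_cross vv ww vw.
set b := cross v w in F.
have [_ [_ vb wb]] := F; have [[_ _ bb] _] := F.
(* The image of [w] stays orthogonal to the axis, so its coordinates along [w] and [b] are the
   cosine and the sine. *)
pose C := dot (w *m Q) w; pose s := dot (w *m Q) b.
have wQ : w *m Q = C *: w + s *: b.
  have wv : dot (w *m Q) v = 0 by rewrite -[X in dot _ X]vQ dot_orth // dotC.
  by rewrite {1}(orthonormal_decomp (w *m Q) F) wv scale0r add0r.
have bw : cross v b = - w.
  rewrite /b crossN cross_crossl vv (dotC w) vw.
  by rewrite scale0r subr0 scale1r.
have bQ : b *m Q = C *: b - s *: w.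
  rewrite /b -cross_orth // vQ wQ.
  have -> : cross v (C *: w + s *: b) = C *: cross v w + s *: cross v b.
    by apply: vec3P; rewrite !coordE; ring.
  by rewrite bw scalerN.
exists v, C, s; split=> //.
  by have := dot_orth w w h; rewrite wQ !dotL ww bb (dotC b) wb => <-; ring.
move=> x; have ex := orthonormal_decomp x F.
transitivity (rot v C s (dot x v *: v + dot x w *: w + dot x b *: b));
  last by rewrite -ex.
rewrite [X in X *m Q = _]ex !mulmxDl -!scalemxAl vQ wQ bQ.
set k := dot x v; set l := dot x w; set m := dot x b.
rewrite /rot !dotL vv vw vb.
have -> : cross v (k *: v + l *: w + m *: b) = l *: b - m *: w.
  rewrite -[X in _ - X]opprK -scalerN -bw /b.
  by apply: vec3P; rewrite !coordE; ring.
by apply: vec3P; rewrite !coordE; ring.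
Qed.

(** Lets a least angle be found as a largest trace. *)
Lemma rot_trace Q v C s : dot v v = 1 -> (forall x, x *m Q = rot v C s x) ->
  \tr Q = 1 + 2 * C.
Proof.
move=> vv h; rewrite /mxtrace big_ord3.
have e0 := congr1 (fun x : point => x 0 0) (h (vec3 1 0 0)).
have e1 := congr1 (fun x : point => x 0 1) (h (vec3 0 1 0)).
have e2 := congr1 (fun x : point => x 0 2) (h (vec3 0 0 1)).
move: e0 e1 e2 vv; rewrite /rot !coordE => e0 e1 e2 vv.
have {}vv : (1 - C) * (v 0 0 * v 0 0 + v 0 1 * v 0 1 + v 0 2 * v 0 2) = 1 - C.
  by rewrite vv mulr1.
lra.
Qed.

(* Consecutive vertices of a skew polygon all of whose steps are congruent
   obey the linear recurrence given by the characteristic polynomial of the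
   rotation that shifts it. *)
Lemma rot_shift v0 v1 v2 v3 (C s c : R) :
  dot v1 v1 = 1 -> dot v0 v1 = c -> C ^+ 2 + s ^+ 2 = 1 ->
  v2 = rot v1 C s v0 -> v3 = rot v2 C s v1 ->
  v3 = v0 + ((1 + c) * (1 - C) - 1) *: (v2 - v1).
Proof.
move=> v11 v01 Cs e2 ->; rewrite /rot.
pose n := cross v1 v0.
have {}e2 : v2 = C *: v0 + s *: n + ((1 - C) * c) *: v1.
  by rewrite e2 /rot (dotC v1) v01.
have -> : dot v2 v1 = c.
  by rewrite e2 !dotL (dotC n) cross_dotl v11 v01; ring.
have -> : cross v2 v1 = s *: (v0 - c *: v1) - C *: n.
  have <- : cross n v1 = v0 - c *: v1.
    by rewrite cross_crossl v11 scale1r v01.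
  rewrite e2 /n.
  by apply: vec3P; rewrite !coordE; ring.
rewrite e2; clearbody n.
apply: vec3P; rewrite !coordE; apply/eqP; rewrite -subr_eq0; apply/eqP;
set x := v0 _ _; set y := v1 _ _; set z := n _ _.
all: by transitivity ((C ^+ 2 + s ^+ 2 - 1) * (x - c * y));
  [ring|rewrite Cs subrr mul0r].
Qed.

End Vectors.

(** * Similarities as affine maps, and convex hulls *)

Section AffineMaps.
Variable R : realType.
Local Notation point := 'rV[R]_3.
Local Notation edist := Defs.edist.
Local Notation similar := Defs.similar.
Implicit Types (u v w x y z a p q r t : point) (k l c : R) (A B S P : set point).

Definition aff c (Q : 'M[R]_3) t x : point := c *: (x *m Q) + t.

Lemma dot_aff c Q t x y x' y' : orthm Q ->
  dot (aff c Q t x - aff c Q t y) (aff c Q t x' - aff c Q t y') =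
  c ^+ 2 * dot (x - y) (x' - y').
Proof.
have e y1 z1 : aff c Q t y1 - aff c Q t z1 = c *: ((y1 - z1) *m Q).
  by rewrite /aff; apply: vec3P; rewrite !coordE; ring.
by move=> h; rewrite !e !dotL dot_orth // dotDl !dotL; ring.
Qed.

Lemma edist_aff c Q t x y : orthm Q -> 0 <= c ->
  edist (aff c Q t x) (aff c Q t y) = c * edist x y.
Proof.
move=> h c0; rewrite /Defs.edist dot_aff // sqrtrM ?sqr_ge0 //.
by rewrite sqrtr_sqr ger0_norm.
Qed.

Lemma affK c Q t : orthm Q -> c != 0 ->
  cancel (aff c Q t) (aff c^-1 Q^T (- c^-1 *: (t *m Q^T))).
Proof.
move=> h c0 x; rewrite /aff mulmxDl scalerDr -scalemxAl scalerA mulVf //.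
by rewrite scale1r orthmK // scaleNr addrK.
Qed.

Lemma affVK c Q t : orthm Q -> c != 0 ->
  cancel (aff c^-1 Q^T (- c^-1 *: (t *m Q^T))) (aff c Q t).
Proof.
move=> h c0 x; rewrite /aff mulmxDl -!scalemxAl !orthmKV //.
rewrite scalerDr !scalerA mulrN mulfV // scale1r scaleN1r addrNK //.
Qed.

Lemma aff_similarity c Q t : orthm Q -> 0 < c -> similarity (aff c Q t).
Proof. by move=> h c0; exists c => // x y; rewrite edist_aff // ltW. Qed.

(** By polarization the normalized map [g] preserves products, so it carries the standard basis to
    an orthonormal frame in which [g x] keeps the coordinates of [x]. *)
Lemma scaled_isometry_affine c (f : point -> point) : 0 < c ->
  (forall x y, edist (f x) (f y) = c * edist x y) ->
  exists2 Q, orthm Q & exists t, f = aff c Q t.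
Proof.
move=> c0 h; pose g x := c^-1 *: (f x - f 0).
have c1 : c != 0 by rewrite gt_eqF.
have gB x y : dot (g x - g y) (g x - g y) = dot (x - y) (x - y).
  rewrite /g -scalerBr opprB addrA addrNK dotZl dotZr -!edistE h.
  by field.
have g0 : g 0 = 0 by rewrite /g subrr scaler0.
have fE x : f x = c *: g x + f 0.
  by rewrite /g scalerA mulfV // scale1r addrNK.
clearbody g.
have gn x : dot (g x) (g x) = dot x x.
  by have := gB x 0; rewrite g0 !subr0.
have gd x y : dot (g x) (g y) = dot x y.
  have := gB x y; rewrite !dotL !gn (dotC (g y)) (dotC y); lra.
pose e0 := vec3 1 0 0 : point; pose e1 := vec3 0 1 0 : point.
pose e2 := vec3 0 0 1 : point.
have F : orthonormal (g e0) (g e1) (g e2).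
  by split; split; rewrite gd !coordE; ring.
have hQ := orthm_mat3 F.
exists (mat3 (g e0) (g e1) (g e2)) => //; exists (f 0).
apply/funext => x.
rewrite fE /aff mat3E {1}(orthonormal_decomp (g x) F) !gd.
have d0 : dot x e0 = x 0 0 by rewrite /e0 dotE !vec3E; ring.
have d1 : dot x e1 = x 0 1 by rewrite /e1 dotE !vec3E; ring.
have d2 : dot x e2 = x 0 2 by rewrite /e2 dotE !vec3E; ring.
by rewrite d0 d1 d2.
Qed.

Lemma similarity_affine (f : point -> point) : similarity f ->
  exists c Q t, [/\ 0 < c, orthm Q & f = aff c Q t].
Proof.
move=> [c c0 h]; have [Q hQ [t e]] := scaled_isometry_affine c0 h.
by exists c, Q, t.
Qed.

Lemma isometry_affine (f : point -> point) : euclidean_isometry f ->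
  exists Q t, orthm Q /\ f = aff 1 Q t.
Proof.
move=> h; have [|Q hQ [t e]] := @scaled_isometry_affine 1 f ltr01.
  by move=> x y; rewrite h mul1r.
by exists Q, t.
Qed.

Lemma similarP A B : similar A B <->
  exists c Q t, [/\ 0 < c, orthm Q & aff c Q t @` A = B].
Proof.
split=> [[f /similarity_affine[c [Q [t [c0 h ->]]]] e]|[c [Q [t [c0 h e]]]]].
  by exists c, Q, t.
by exists (aff c Q t) => //; exact: aff_similarity.
Qed.

Lemma similar_sym A B : similar A B -> similar B A.
Proof.
move=> /similarP[c [Q [t [c0 h <-]]]]; apply/similarP.
have c1 : c != 0 by rewrite gt_eqF.
exists c^-1, Q^T, (- c^-1 *: (t *m Q^T)); split; rewrite ?invr_gt0 //.
  exact: orthmT.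
apply/seteqP; split=> [x [_ [y Ay <-] <-]|x Ax]; first by rewrite affK.
by exists (aff c Q t x); [exists x|rewrite affK].
Qed.

Lemma similar_trans A B S : similar A B -> similar B S -> similar A S.
Proof.
move=> [f [c c0 hf] <-] [g [d d0 hg] <-].
exists (fun x => g (f x)).
  by exists (d * c); [rewrite mulr_gt0|move=> x y /=; rewrite hg hf mulrA].
by rewrite -image_comp.
Qed.

Definition convex A := forall x y k, A x -> A y -> 0 <= k -> k <= 1 ->
  A (k *: x + (1 - k) *: y).

Lemma convex_setP A : @convex_set R point A <-> convex A.
Proof.
split=> [h x y k Ax Ay k0 k1|h x y k].
  by have := h x y (Itv01 k0 k1) (mem_set Ax) (mem_set Ay); rewrite inE.
by rewrite !inE => Ax Ay; apply: h.
Qed.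

Lemma conv_hull_sub A : A `<=` conv_hull A.
Proof. by move=> x Ax B [_]; apply. Qed.

Lemma conv_hull_min A B : convex B -> A `<=` B -> conv_hull A `<=` B.
Proof. by move=> /convex_setP cB AB x; apply. Qed.

Lemma conv_hull_convex A : convex (conv_hull A).
Proof.
move=> x y k hx hy k0 k1 B [cB AB]; have /convex_setP := cB.
by apply => //; [apply: hx|apply: hy].
Qed.

Lemma conv_hull_mono A B : A `<=` B -> conv_hull A `<=` conv_hull B.
Proof.
by move=> AB; apply: conv_hull_min;
  [exact: conv_hull_convex|apply: subset_trans AB _; exact: conv_hull_sub].
Qed.

(** The inclusion [sub] holds for every affine map; applied to the inverse, it gives the other
    inclusion. *)
Lemma conv_hull_aff c Q t A : orthm Q -> c != 0 ->
  aff c Q t @` conv_hull A = conv_hull (aff c Q t @` A).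
Proof.
have sub c' Q' t' A' :
    aff c' Q' t' @` conv_hull A' `<=` conv_hull (aff c' Q' t' @` A').
  move=> _ [x + <-]; suff : conv_hull A' `<=`
      [set x | conv_hull (aff c' Q' t' @` A') (aff c' Q' t' x)] by apply.
  apply: conv_hull_min => [y z k hy hz k0 k1 /=|y Ay].
    have -> : aff c' Q' t' (k *: y + (1 - k) *: z) =
        k *: aff c' Q' t' y + (1 - k) *: aff c' Q' t' z.
      rewrite /aff mulmxDl -!scalemxAl.
      by apply: vec3P; rewrite !coordE; ring.
    exact: conv_hull_convex.
  by apply: conv_hull_sub; exists y.
move=> h c0; apply/seteqP; split; first exact: sub.
move=> x hx; rewrite -(affVK t h c0 x); apply: imageP.
have := sub c^-1 Q^T (- c^-1 *: (t *m Q^T)) (aff c Q t @` A).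
move=> /(_ _ (imageP _ hx)); rewrite image_comp.
set g := aff c^-1 _ _; have -> : (g \o aff c Q t) @` A = A => //.
rewrite -[RHS]image_id; apply: eq_imagel => y _ /=.
by rewrite /g affK.
Qed.

Lemma halfspace_convex a k : convex [set x | dot a x <= k].
Proof.
move=> x y l /= hx hy l0 l1; rewrite dotDr !dotZr.
have : l * dot a x <= l * k by rewrite ler_wpM2l.
have : (1 - l) * dot a y <= (1 - l) * k by rewrite ler_wpM2l // subr_ge0.
lra.
Qed.

Lemma conv_hull_le a k A : (forall x, A x -> dot a x <= k) ->
  forall x, conv_hull A x -> dot a x <= k.
Proof. by move=> h; apply: conv_hull_min => //; exact: halfspace_convex. Qed.

Lemma conv_hull_eq a k A : (forall x, A x -> dot a x = k) ->
  forall x, conv_hull A x -> dot a x = k.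
Proof.
move=> h x hx; apply/eqP; rewrite eq_le; apply/andP; split.
  by apply: conv_hull_le hx => y /h ->.
rewrite -lerN2 -dotNl; apply: conv_hull_le hx => y /h.
by rewrite dotNl => ->.
Qed.

(* The points strictly below the supporting plane, together with the hull of
   the generators lying on it, already form a convex set. *)
Lemma conv_hull_face a k A : (forall x, A x -> dot a x <= k) ->
  conv_hull A `&` [set x | dot a x = k] =
  conv_hull (A `&` [set x | dot a x = k]).
Proof.
move=> h; apply/seteqP; split=> [x [hx /= xk]|x hx]; last first.
  split; first by apply: conv_hull_mono hx => y [].
  by apply: conv_hull_eq hx => y [].
have : conv_hull A `<=` [set x | dot a x < k] `|`
    conv_hull (A `&` [set x | dot a x = k]).
  apply: conv_hull_min => [y z l hy hz l0 l1|y Ay].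
    have le_k w : ([set x | dot a x < k] `|`
        conv_hull (A `&` [set x | dot a x = k])) w -> dot a w <= k.
      case=> /= [/ltW //|hw]; rewrite (@conv_hull_eq a k _ _ _ hw) //.
      by move=> v [].
    have [->|nl0] := eqVneq l 0; first by rewrite scale0r add0r subr0 scale1r.
    have [->|nl1] := eqVneq l 1; first by rewrite subrr scale0r addr0 scale1r.
    have {nl0} nl0 : 0 < l by rewrite lt_neqAle eq_sym nl0.
    have {nl1} nl1 : 0 < 1 - l by rewrite subr_gt0 lt_neqAle nl1.
    have yk := le_k _ hy; have zk := le_k _ hz.
    case: hy => /= hy.
      left => /=; rewrite !dotL.
      have : l * dot a y < l * k by rewrite ltr_pM2l.
      have : (1 - l) * dot a z <= (1 - l) * k by rewrite ler_pM2l.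
      lra.
    case: hz => /= hz.
      left => /=; rewrite !dotL.
      have : l * dot a y <= l * k by rewrite ler_pM2l.
      have : (1 - l) * dot a z < (1 - l) * k by rewrite ltr_pM2l.
      lra.
    by right; apply: conv_hull_convex.
  have := h _ Ay; rewrite le_eqVlt => /orP[/eqP e|]; last by left.
  by right; apply: conv_hull_sub.
by move=> /(_ x hx) [/=|//]; rewrite xk ltxx.
Qed.

Lemma conv_hull0 A x : conv_hull A x -> A !=set0.
Proof.
move=> hx; apply: contrapT => /set0P/negP; rewrite negbK => /eqP A0.
suff : conv_hull A `<=` set0 by move=> /(_ x hx).
by rewrite A0; apply: conv_hull_min => // ? ? ? [].
Qed.

Lemma conv_hull1 x : conv_hull [set x] = [set x].
Proof.
apply/seteqP; split; last exact: conv_hull_sub.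
apply: conv_hull_min => // y z k -> -> _ _ /=.
by rewrite -scalerDl addrC subrK scale1r.
Qed.

End AffineMaps.

(** * Facets, and sets that span space *)

Section Faces.
Variable R : realType.
Local Notation point := 'rV[R]_3.
Local Notation edist := Defs.edist.
Local Notation similar := Defs.similar.
Implicit Types (u v w x y z a b p q r t : point) (k l c : R) (A B S P : set point).

Definition noncollinear p q r := cross (q - p) (r - p) != 0.

(** A facet is kept as a functional with its maximal level. Three noncollinear contact points
    replace the dimension of the face, so that the notion applies to a finite vertex set and to its
    hull alike, and passes between them by [facet_conv]. *)
Definition facet P a k := (forall x, P x -> dot a x <= k) /\
  exists p q r, [/\ P p /\ dot a p = k, P q /\ dot a q = k, P r /\ dot a r = k
    & noncollinear p q r].

(** The algebraic form of not lying in any plane, which a finite vertex set can satisfy and inherits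
    from its hull. *)
Definition full P := forall a k, (forall x, P x -> dot a x = k) -> a = 0.

(** Coordinates of [y] in the basis [u], [v], [cross u v], multiplied by the Gram determinant to
    avoid division. *)
Lemma cross_cramer u v y :
  dot (cross u v) (cross u v) *: y =
  dot (cross u v) (cross y v) *: u + dot (cross u v) (cross u y) *: v +
  dot (cross u v) y *: cross u v.
Proof. by apply: vec3P; rewrite !coordE; ring. Qed.

Lemma row2E (M : 'M[R]_(2, 3)) (w : 'rV[R]_2) :
  w *m M = w 0 0 *: row 0 M + w 0 1 *: row 1 M.
Proof.
apply/rowP => j; rewrite !mxE !big_ord_recl big_ord0 addr0.
by have -> : lift ord0 ord0 = 1 :> 'I_2 by exact: val_inj.
Qed.

(** Trades the rank of a 2 by 3 matrix for a non-zero cross product, the form used from here on. *)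
Lemma affine_dim2P A : affine_dim 2 A <-> exists p q r,
  [/\ A p, A q, A r, noncollinear p q r &
    forall x, A x -> dot (x - p) (cross (q - p) (r - p)) = 0].
Proof.
split=> [[p [M [rM Ap Ar hA]]]|[p [q [r [Ap Aq Ar n0 h]]]]].
  exists p, (p + row 0 M), (p + row 1 M).
  have -> : p + row 0 M - p = row 0 M by rewrite addrC addKr.
  have e1 : p + row 1 M - p = row 1 M by rewrite addrC addKr.
  rewrite /noncollinear e1.
  have -> : p + row 0 M - p = row 0 M by rewrite addrC addKr.
  split=> //; last first.
    move=> x /hA /submxP [D ->]; rewrite row2E dotDl !dotZl.
    by rewrite cross_dotl cross_dotr; ring.
  apply/eqP => c0.
  have inj (w : 'rV_2) : w *m M = 0 -> w = 0.
    by move/eqP; rewrite mulmx_free_eq0 ?/row_free ?rM // => /eqP.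
  have [u0|u0] := eqVneq (row 0 M) 0.
    have /rowP/(_ 0) : (delta_mx 0 0 : 'rV[R]_2) = 0.
      by apply: inj; rewrite -rowE.
    by rewrite !mxE /=; apply/eqP; rewrite oner_eq0.
  have := cross0P u0 c0; set k := _ / _ => e.
  have /rowP/(_ 1) : (- k *: delta_mx 0 0 + delta_mx 0 1 : 'rV[R]_2) = 0.
    apply: inj; rewrite mulmxDl -scalemxAl -!rowE e.
    by rewrite scaleNr addNr.
  by rewrite !mxE /= mulr0 add0r; apply/eqP; rewrite oner_eq0.
pose M : 'M[R]_(2, 3) := \matrix_(i, j) [:: q - p; r - p]`_i 0 j.
have M0 : row 0 M = q - p by apply/rowP => j; rewrite !mxE.
have M1 : row 1 M = r - p by apply/rowP => j; rewrite !mxE.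
exists p, M; split=> //.
- apply/eqP; apply: inj_row_free => w; rewrite row2E M0 M1 => e.
  have e0 : w 0 0 = 0.
    have : w 0 0 *: cross (q - p) (r - p) = 0.
      have <- : cross (w 0 0 *: (q - p) + w 0 1 *: (r - p)) (r - p) =
          w 0 0 *: cross (q - p) (r - p).
        by apply: vec3P; rewrite !coordE; ring.
      by rewrite e; apply: vec3P; rewrite !coordE; ring.
    by move/eqP; rewrite scaler_eq0 (negPf n0) orbF => /eqP.
  have e1 : w 0 1 = 0.
    have : w 0 1 *: cross (q - p) (r - p) = 0.
      have <- : cross (q - p) (w 0 0 *: (q - p) + w 0 1 *: (r - p)) =
          w 0 1 *: cross (q - p) (r - p).
        by apply: vec3P; rewrite !coordE; ring.
      by rewrite e; apply: vec3P; rewrite !coordE; ring.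
    by move/eqP; rewrite scaler_eq0 (negPf n0) orbF => /eqP.
  apply/rowP => i; rewrite mxE; case: i => [[|[|//]] hi].
    by rewrite -e0; congr (w _ _); apply: val_inj.
  by rewrite -e1; congr (w _ _); apply: val_inj.
- move=> i; case: i => [[|[|//]] hi].
    have -> : Ordinal hi = 0 by apply: val_inj.
    by rewrite M0 addrC subrK.
  have -> : Ordinal hi = 1 by apply: val_inj.
  by rewrite M1 addrC subrK.
- move=> x /h; set n := cross _ _ => xn.
  have nn : dot n n != 0 by rewrite dot_eq0.
  have := cross_cramer (q - p) (r - p) (x - p).
  rewrite -/n (dotC n (x - p)) xn scale0r addr0 => e.
  have -> : x - p = (dot n n)^-1 *: (dot n n *: (x - p)).
    by rewrite scalerA mulVf // scale1r.
  rewrite e; apply: scalemx_sub; rewrite -M0 -M1.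
  by apply: addmx_sub; apply: scalemx_sub; exact: row_sub.
Qed.

Lemma affine_dim1_segment p q : p != q -> affine_dim 1 (conv_hull [set p; q]).
Proof.
move=> pq; exists p, (q - p); split.
- rewrite rank_rV; case: eqP => // /eqP.
  by rewrite subr_eq0 eq_sym (negPf pq).
- by apply: conv_hull_sub; left.
- move=> i; rewrite (ord1 i).
  have -> : row 0 (q - p) = q - p by apply/rowP => j; rewrite !mxE.
  by rewrite addrC subrK; apply: conv_hull_sub; right.
- apply: conv_hull_min => [x y k hx hy _ _ /=|x [->|->]].
  + have -> : k *: x + (1 - k) *: y - p = k *: (x - p) + (1 - k) *: (y - p).
      by apply: vec3P; rewrite !coordE; ring.
    by apply: addmx_sub; exact: scalemx_sub.
  + by rewrite subrr sub0mx.
  + exact: submx_refl.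
Qed.

Lemma vertexP P v : vertex P v <-> exists a k,
  [/\ forall x, P x -> dot a x <= k, P v, dot a v = k &
    forall x, P x -> dot a x = k -> x = v].
Proof.
split=> [[[a [k [h e]]] _]|[a [k [h Pv av hv]]]].
  have [Pv /= av] : (P `&` [set x | dot a x = k]) v by rewrite -e.
  exists a, k; split=> // x Px xk.
  have : (P `&` [set x | dot a x = k]) x by split.
  by rewrite -e.
split.
  exists a, k; split=> //; apply/seteqP; split=> [x ->|x [Px xk]]; first by split.
  exact: hv.
exists v, 0; split=> //.
- by rewrite mxrank0.
- by case.
- by move=> x ->; rewrite subrr sub0mx.
Qed.

Lemma ortho2_cross a u v : a != 0 -> dot a u = 0 -> dot a v = 0 ->
  cross u v = (dot a (cross u v) / dot a a) *: a.
Proof.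
move=> a0 au av; apply: cross0P => //; rewrite crossN cross_crossl.
by rewrite (dotC u) (dotC v) au av !scale0r subrr oppr0.
Qed.

(** Both functionals annihilate [q - p] and [r - p], hence both lie on the line of their cross
    product. *)
Lemma noncollinear_normal a b p q r : a != 0 -> noncollinear p q r ->
  dot a p = dot a q -> dot a p = dot a r ->
  dot b p = dot b q -> dot b p = dot b r -> exists k, b = k *: a.
Proof.
move=> a0 n0 aq ar bq br.
have d w (h1 : dot w p = dot w q) (h2 : dot w p = dot w r) :
    dot w (q - p) = 0 /\ dot w (r - p) = 0.
  by rewrite !dotL -h1 -h2 subrr.
have [a1 a2] := d _ aq ar; have [b1 b2] := d _ bq br.
have ea := ortho2_cross a0 a1 a2.
have := cross_cramer (q - p) (r - p) b; set n := cross _ _ in ea n0 *.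
have nn : dot n n != 0 by rewrite dot_eq0.
have -> : dot n (cross b (r - p)) = 0.
  have -> : dot n (cross b (r - p)) =
    dot (q - p) b * dot (r - p) (r - p) - dot (r - p) b * dot (q - p) (r - p).
    by rewrite /n !coordE; ring.
  by rewrite (dotC _ b) b1 (dotC _ b) b2; ring.
have -> : dot n (cross (q - p) b) = 0.
  have -> : dot n (cross (q - p) b) =
    dot (q - p) (q - p) * dot (r - p) b - dot (q - p) (r - p) * dot (q - p) b.
    by rewrite /n !coordE; ring.
  by rewrite (dotC _ b) b2 (dotC _ b) b1; ring.
rewrite !scale0r !add0r => e.
exists ((dot n n)^-1 * (dot n b * (dot a n / dot a a))).
rewrite -(scalerA (dot n n)^-1) -(scalerA (dot n b)) -ea -e.
by rewrite scalerA mulVf // scale1r.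
Qed.

Lemma facet_face P a k : a != 0 -> facet P a k ->
  face 2 P (P `&` [set x | dot a x = k]).
Proof.
move=> a0 [h [p [q [r [[Pp pk] [Pq qk] [Pr rk] n0]]]]]; split.
  by exists a, k.
apply/affine_dim2P; exists p, q, r; split=> // x [Px xk].
have e : cross (q - p) (r - p) =
   (dot a (cross (q - p) (r - p)) / dot a a) *: a.
  by apply: ortho2_cross; rewrite // !dotL ?qk ?rk pk subrr.
by rewrite e dotZr !dotL !(dotC _ a) xk pk subrr mulr0.
Qed.

Lemma face_facet P F : full P -> face 2 P F -> exists a k,
  [/\ a != 0, F = P `&` [set x | dot a x = k] & facet P a k].
Proof.
move=> fP [[a [k [h eF]]] /affine_dim2P[p [q [r [Fp Fq Fr n0 hF]]]]].
exists a, k; split=> //.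
  (* With [a = 0] the face would be all of [P], which would then lie in the plane of the face. *)
  apply/eqP => a0; move: h eF; rewrite a0 => h eF.
  have k0 : k = 0 by move: Fp; rewrite eF => -[_ /=]; rewrite dot0l.
  move: n0; rewrite /noncollinear; case/eqP.
  apply: (fP _ (dot p (cross (q - p) (r - p)))) => x Px; have /hF : F x by rewrite eF; split => //=; rewrite dot0l k0.
  by rewrite dotDl dotNl dotC; lra.
split=> //; exists p, q, r.
by move: Fp Fq Fr; rewrite eF => -[? ?] [? ?] [? ?]; split.
Qed.

Lemma facet_sub A P a k : A `<=` P -> (forall x, P x -> dot a x <= k) ->
  facet A a k -> facet P a k.
Proof.
move=> AP h [_ [p [q [r [[? ?] [? ?] [? ?] n0]]]]]; split=> //.
by exists p, q, r; split=> //; split=> //; apply: AP.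
Qed.

(** By [conv_hull_face] the contact set of the hull is the hull of the generators in contact; were
    these collinear, it would lie on a line. *)
Lemma facet_conv A a k : facet (conv_hull A) a k <-> facet A a k.
Proof.
split=> [[h [p [q [r [Pp Pq Pr n0]]]]]|h]; last first.
  exact: (facet_sub (@conv_hull_sub _ A) (conv_hull_le h.1) h).
have hA x : A x -> dot a x <= k by move=> Ax; apply: h; exact: conv_hull_sub.
split=> //; apply: contrapT => hn.
have sp : (conv_hull A `&` [set x | dot a x = k]) p := Pp.
have sq : (conv_hull A `&` [set x | dot a x = k]) q := Pq.
have sr : (conv_hull A `&` [set x | dot a x = k]) r := Pr.
move: sp sq sr; rewrite conv_hull_face //; set B := A `&` _ => sp sq sr.
have col x y z : B x -> B y -> B z -> cross (y - x) (z - x) = 0.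
  move=> [Ax xk] [Ay yk] [Az zk]; apply/eqP; apply: contrapT => /negP n1.
  by apply: hn; exists x, y, z.
have [x0 Bx0] := conv_hull0 sp.
have [[y0 By0 y0x0]|hall] :=
    pselect (exists2 y, B y & y != x0); last first.
  have eB : B `<=` [set x0].
    by move=> y By; apply/eqP; apply: contrapT => /negP n1; apply: hall; exists y.
  have := conv_hull_mono eB; rewrite conv_hull1 => h1.
  move: n0; rewrite (h1 _ sp) (h1 _ sq) /noncollinear subrr.
  by case/eqP; apply: vec3P; rewrite !coordE; ring.
have line x : conv_hull B x -> exists l, x = x0 + l *: (y0 - x0).
  move: x; apply: conv_hull_min => [y z l [m ->] [m' ->] _ _ /=|y By].
    exists (l * m + (1 - l) * m').
    by apply: vec3P; rewrite !coordE; ring.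
  have d0 : y0 - x0 != 0 by rewrite subr_eq0.
  have := cross0P d0 (col _ _ _ Bx0 By0 By).
  by set l := _ / _ => e; exists l; rewrite -e addrC subrK.
have [lp ep] := line _ sp; have [lq eq] := line _ sq.
have [lr er] := line _ sr.
move: n0; rewrite ep eq er /noncollinear.
by case/eqP; apply: vec3P; rewrite !coordE; ring.
Qed.

Lemma facetZ P a k c : 0 < c -> facet P a k -> facet P (c *: a) (c * k).
Proof.
move=> c0 [h [p [q [r [[? pk] [? qk] [? rk] n0]]]]]; split=> [x Px|].
  by rewrite dotZl ler_pM2l // h.
by exists p, q, r; split=> //; rewrite dotZl ?pk ?qk ?rk.
Qed.

(** Noncollinearity is read off the Gram determinant, which a similarity multiplies by [c ^+ 4]
    whatever its orientation. *)
Lemma cross_aff_neq0 c (Q : 'M[R]_3) t p q r : orthm Q -> c != 0 ->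
  noncollinear p q r -> noncollinear (aff c Q t p) (aff c Q t q) (aff c Q t r).
Proof.
move=> h c0; rewrite /noncollinear -!dot_eq0 !dot_cross !dot_aff // => n0.
set d := (X in X != 0); have -> : d = c ^+ 4 *
  (dot (q - p) (q - p) * dot (r - p) (r - p) - dot (q - p) (r - p) ^+ 2).
  by rewrite /d; ring.
by rewrite mulf_neq0 // expf_neq0.
Qed.

Lemma facet_aff c (Q : 'M[R]_3) t P a k : orthm Q -> 0 < c -> facet P a k ->
  facet (aff c Q t @` P) (a *m Q) (c * k + dot (a *m Q) t).
Proof.
move=> h c0 [hP [p [q [r [[? pk] [? qk] [? rk] n0]]]]].
have e x : dot (a *m Q) (aff c Q t x) = c * dot a x + dot (a *m Q) t.
  by rewrite /aff dotDr dotZr dot_orth.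
split=> [_ [x Px <-]|]; first by rewrite e lerD2r ler_pM2l // hP.
exists (aff c Q t p), (aff c Q t q), (aff c Q t r).
split; [split; [by apply: imageP|by rewrite e ?pk ?qk ?rk]..|].
by apply: cross_aff_neq0 => //; rewrite gt_eqF.
Qed.

Lemma full_aff c (Q : 'M[R]_3) t P : orthm Q -> c != 0 -> full P ->
  full (aff c Q t @` P).
Proof.
move=> h c0 fP a k hk.
have e : a *m Q^T = 0.
  apply: (fP _ (c^-1 * (k - dot a t))) => x Px.
  have := hk _ (imageP _ Px); rewrite /aff dotDr dotZr => <-.
  by rewrite addrK mulKf // dot_orthl ?trmxK //; exact: orthmT.
by rewrite -(orthmKV a h) e mul0mx.
Qed.

Lemma full_sub A P : A `<=` P -> full A -> full P.
Proof. by move=> AP fA a k h; apply: (fA a k) => x /AP /h. Qed.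

Lemma full_conv A : full (conv_hull A) -> full A.
Proof. by move=> fA a k h; apply: (fA a k) => x; apply: conv_hull_eq. Qed.

(** From an interior point a short move along [a] stays in [P] and raises [dot a] unless [a = 0]. *)
Lemma interior_full P : interior P !=set0 -> full P.
Proof.
move=> [x hx] a k h.
have ax := h _ (nbhs_singleton hx).
have : \forall e \near (0 : R), P (x + e *: a).
  have : (fun e : R => x + e *: a) @ 0 --> x.
    rewrite -[X in _ --> X]addr0 -(scale0r a).
    by apply: cvgD; [exact: cvg_cst|apply: cvgZr_tmp; exact: cvg_id].
  by apply; exact: hx.
move=> /nbhs_ballP [e /= e0 he].
have := he (e / 2); rewrite /ball /= sub0r normrN ger0_norm ?divr_ge0 ?ltW //.
rewrite ltr_pdivrMr // ltr_pMr // ltr1n => /(_ isT)/h.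
rewrite dotDr dotZr ax => e1; apply: dot_eq0P.
have {}e1 : e / 2 * dot a a = 0 by lra.
by move/eqP: e1; rewrite mulf_eq0 gt_eqF ?divr_gt0 //= => /eqP.
Qed.

End Faces.

(** * Tetrahedral frames, and the criterion for an embedding in a tetrahedron *)

Section TetrahedralFrames.
Variable R : realType.
Local Notation point := 'rV[R]_3.
Local Notation edist := Defs.edist.
Local Notation similar := Defs.similar.
Local Notation boundary := Defs.boundary.
Implicit Types (u v w x y z p q r t : point) (c : R) (A B S P T : set point).
Implicit Types (a b : 'I_4 -> point) (k l : 'I_4 -> R).

(** The unit outer normals of a regular tetrahedron meet pairwise at cosine -1/3. *)
Definition tetra_frame a := (forall i, dot (a i) (a i) = 1) /\
  forall i j, i != j -> dot (a i) (a j) = - 3^-1.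

Definition tetra_dirs P := exists a k,
  tetra_frame a /\ forall i, facet P (a i) (k i).

Definition simplex a k : set point := [set x | forall i, dot (a i) x <= k i].

Definition tetra_vertex (i : 'I_4) : point :=
  [:: vec3 1 1 1; vec3 1 (-1) (-1); vec3 (-1) 1 (-1); vec3 (-1) (-1) 1]`_i.

Lemma ord4P (i : 'I_4) : [\/ i = 0, i = 1, i = 2 | i = 3].
Proof.
case: i => [[|[|[|[|//]]]] h];
  [constructor 1|constructor 2|constructor 3|constructor 4]; exact: val_inj.
Qed.

Lemma forall_ord4 (F : 'I_4 -> Prop) :
  F 0 -> F 1 -> F 2 -> F 3 -> forall i, F i.
Proof. by move=> ? ? ? ? i; case: (ord4P i) => ->. Qed.

Lemma big_ord4 (V : nmodType) (F : 'I_4 -> V) :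
  \sum_(i < 4) F i = F 0 + F 1 + F 2 + F 3.
Proof.
rewrite !big_ord_recl big_ord0 addr0 !addrA.
congr (_ + F _ + F _ + F _); exact: val_inj.
Qed.

Lemma tetra_frame_sum a : tetra_frame a -> a 0 + a 1 + a 2 + a 3 = 0.
Proof.
move=> [h1 h]; apply: dot_eq0P; rewrite !dotDl !dotDr !h1 !h //.
by field.
Qed.

(** Consequently [(3 / 4) *: \sum_j k j *: a j] lies at depth [(\sum_j k j) / 4] below each of the
    four planes: when this sum is positive, it is the incentre of [simplex a k]. *)
Lemma tetra_frame_dot a k : tetra_frame a ->
  forall i, dot (a i) (\sum_j k j *: a j) = 4 / 3 * k i - 3^-1 * \sum_j k j.
Proof.
move=> [h1 h]; rewrite !big_ord4; apply: forall_ord4;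
  rewrite !dotDr !dotZr !h1 !h //; by field.
Qed.

Lemma sqrt3_neq0 : Num.sqrt 3 != 0 :> R.
Proof. by rewrite gt_eqF // sqrtr_gt0. Qed.

Lemma sqr_sqrt3 : Num.sqrt 3 * Num.sqrt 3 = 3 :> R.
Proof. by rewrite -expr2 sqr_sqrtr. Qed.

(** The vectors [a 0 + a 1], [a 0 + a 2] and [a 0 + a 3] point to edge midpoints and are orthogonal;
    scaled by [m] they are the axes of the cube around the frame. *)
Lemma tetra_frame_std a : tetra_frame a -> exists2 Q, orthm Q &
  forall i, tetra_vertex i *m Q = Num.sqrt 3 *: a i.
Proof.
move=> fa; have [h1 h] := fa; have s0 := tetra_frame_sum fa.
pose m : R := Num.sqrt 3 / 2.
have mm : m * m = 3 / 4 by rewrite /m mulrACA sqr_sqrt3; field.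
exists (mat3 (m *: (a 0 + a 1)) (m *: (a 0 + a 2)) (m *: (a 0 + a 3))).
  apply: orthm_mat3; split; split;
  by rewrite dotZl dotZr !dotDl !dotDr !h1 !h // mulrA mm; field.
have e3 : a 3 = - (a 0 + a 1 + a 2).
  by apply/eqP; rewrite -subr_eq0 opprK addrC s0.
have em : Num.sqrt 3 = m * 2 by rewrite /m divfK // pnatr_eq0.
apply: forall_ord4; rewrite mat3E /tetra_vertex /= ?e3 em; apply: vec3P;
  rewrite !coordE; ring.
Qed.

Lemma tetra_verticesE : @tetrahedron_vertices R = range tetra_vertex.
Proof.
have abs1 (x : R) : `|x| = 1 -> x = 1 \/ x = -1.
  by move=> h; case: (ler0P x) h => _ h; [right; rewrite -h opprK|left].
apply/seteqP; split=> [v [h hp]|_ [i _ <-]]; last first.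
  split; last first.
    have -> (F : 'I_3 -> R) : \prod_i F i = F 0 * F 1 * F 2.
      rewrite !big_ord_recl big_ord0 mulr1 mulrA.
      by congr (_ * F _ * F _); exact: val_inj.
    by case: (ord4P i) => ->; rewrite /tetra_vertex /= !vec3E; ring.
  by move=> j; case: (ord3P j) => ->; case: (ord4P i) => ->;
    rewrite /tetra_vertex /= !vec3E ?normrN normr1.
move: hp; have -> : \prod_i v 0 i = v 0 0 * v 0 1 * v 0 2.
  rewrite !big_ord_recl big_ord0 mulr1 mulrA.
  by congr (_ * v 0 _ * v 0 _); exact: val_inj.
have h0 := abs1 _ (h 0); have h1 := abs1 _ (h 1).
have h2 := abs1 _ (h 2); clear h.
case: h0 => h0; case: h1 => h1; case: h2 => h2; rewrite h0 h1 h2 => hp;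
  try by exfalso; lra.
- by exists 0 => //; apply: vec3P; rewrite ?h0 ?h1 ?h2 /tetra_vertex /= !vec3E.
- by exists 1 => //; apply: vec3P; rewrite ?h0 ?h1 ?h2 /tetra_vertex /= !vec3E.
- by exists 2 => //; apply: vec3P; rewrite ?h0 ?h1 ?h2 /tetra_vertex /= !vec3E.
- by exists 3 => //; apply: vec3P; rewrite ?h0 ?h1 ?h2 /tetra_vertex /= !vec3E.
Qed.

Lemma convex_sum A n (l : 'I_n -> R) (p : 'I_n -> point) : convex A ->
  (forall i, 0 <= l i) -> (forall i, A (p i)) -> \sum_i l i = 1 ->
  A (\sum_i l i *: p i).
Proof.
move=> cA; elim: n l p => [|n IH] l p l0 Ap.
  by rewrite big_ord0 => /eqP; rewrite eq_sym oner_eq0.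
rewrite !big_ord_recr /=; set m := l ord_max; set s := \sum_(i < n) _ => sm.
have s0 : 0 <= s by apply: sumr_ge0.
have [sz|sn] := eqVneq s 0.
  have z i : l (widen_ord (leqnSn n) i) = 0.
    move: sz; rewrite /s => /eqP; rewrite psumr_eq0 => [/allP h|j _]; last exact: l0.
    by have := h i (mem_index_enum i); rewrite implyTb => /eqP.
  rewrite big1 => [|i _]; last by rewrite z scale0r.
  have m1 : m = 1 by lra.
  by rewrite add0r m1 scale1r.
have -> : m = 1 - s by lra.
have -> : \sum_(i < n) l (widen_ord (leqnSn n) i) *:
    p (widen_ord (leqnSn n) i) = s *:
    \sum_(i < n) (l (widen_ord (leqnSn n) i) / s) *:
    p (widen_ord (leqnSn n) i).
  rewrite scaler_sumr; apply: eq_bigr => i _.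
  by rewrite scalerA mulrCA mulfV // mulr1.
apply: cA => //; last by rewrite -sm lerDl l0.
apply: IH => //; first by move=> i; rewrite divr_ge0.
by rewrite -mulr_suml mulfV.
Qed.

(** The facet opposite to a vertex has its outer normal opposite to that vertex, whence the minus
    sign. *)
Definition std_normal (i : 'I_4) : point := - (Num.sqrt 3)^-1 *: tetra_vertex i.

Lemma std_normal_frame : tetra_frame std_normal.
Proof.
have e : (Num.sqrt 3)^-1 * (Num.sqrt 3)^-1 = 3^-1 :> R.
  by rewrite -invfM sqr_sqrt3.
split; [apply: forall_ord4|].
1-4: by rewrite dotZl dotZr mulrA mulrNN e /tetra_vertex /= !coordE; field.
move=> i j; rewrite dotZl dotZr mulrA mulrNN e /tetra_vertex.
by case: (ord4P i) => ->; case: (ord4P j) => -> //= _; rewrite !coordE; lra.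
Qed.

Lemma tetra_simplex :
  conv_hull (@tetrahedron_vertices R) =
  simplex std_normal (fun=> (Num.sqrt 3)^-1).
Proof.
have s0 : 0 < (Num.sqrt 3)^-1 :> R by rewrite invr_gt0 sqrtr_gt0.
have e i x : (dot (std_normal i) x <= (Num.sqrt 3)^-1) =
    (- dot (tetra_vertex i) x <= 1).
  rewrite dotZl -[X in _ <= X]mulr1 mulNr -mulrN ler_pM2l //.
apply/seteqP; split.
  move=> x hx i; apply: conv_hull_le hx => y.
  rewrite tetra_verticesE e => -[j _ <-]; rewrite /tetra_vertex.
  case: (ord4P i) => ->; case: (ord4P j) => -> /=; rewrite !coordE; lra.
move=> x hx.
(* These are the barycentric coordinates of [x] with respect to the four vertices. *)
have {}hx i : 0 <= (1 + dot (tetra_vertex i) x) / 4.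
  by have := hx i; rewrite e; lra.
have -> : x = \sum_i ((1 + dot (tetra_vertex i) x) / 4) *: tetra_vertex i.
  by rewrite big_ord4 /tetra_vertex /=; apply: vec3P; rewrite !coordE; field.
apply: convex_sum => //.
- exact: conv_hull_convex.
- by move=> i; apply: conv_hull_sub; rewrite tetra_verticesE; exists i.
- by rewrite big_ord4 /tetra_vertex /= !coordE; field.
Qed.

Lemma simplex_aff c (Q : 'M[R]_3) t a k : orthm Q -> 0 < c ->
  aff c Q t @` simplex a k =
  simplex (fun i => a i *m Q) (fun i => c * k i + dot (a i *m Q) t).
Proof.
move=> h c0; have c1 : c != 0 by rewrite gt_eqF.
have e i x : dot (a i *m Q) (aff c Q t x) = c * dot (a i) x + dot (a i *m Q) t.
  by rewrite /aff dotDr dotZr dot_orth.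
apply/seteqP; split=> [_ [x hx <-] i|x hx].
  by rewrite e lerD2r ler_pM2l.
rewrite -(affVK t h c1 x); apply: imageP => i; rewrite -(ler_pM2l c0).
by rewrite -(lerD2r (dot (a i *m Q) t)) -e affVK.
Qed.

Lemma tetra_frame_orth a (Q : 'M[R]_3) : orthm Q -> tetra_frame a ->
  tetra_frame (fun i => a i *m Q).
Proof.
by move=> h [h1 h2]; split=> [i|i j ij]; rewrite dot_orth // ?h1 ?h2.
Qed.

Lemma simplex_regular a k : tetra_frame a -> 0 < \sum_i k i ->
  regular_tetrahedron (simplex a k).
Proof.
move=> fa k0; have [Q' hQ' e] := tetra_frame_std fa.
(* The standard normals are negative multiples of the standard vertices, hence [- Q']. *)
have hQ : orthm (- Q') := orthmN hQ'.
(* The ratio of the inradius [(\sum_i k i) / 4] to the standard inradius [(Num.sqrt 3)^-1], followed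
   by the translation to the incentre. *)
apply/similarP; exists (Num.sqrt 3 * (\sum_i k i) / 4), (- Q'),
  ((3 / 4) *: \sum_i k i *: a i); split=> //.
  by rewrite divr_gt0 // mulr_gt0 // sqrtr_gt0.
rewrite tetra_simplex simplex_aff //; last first.
  by rewrite divr_gt0 // mulr_gt0 // sqrtr_gt0.
have ea i : std_normal i *m (- Q') = a i.
  rewrite /std_normal mulmxN -scalemxAl e scalerA mulNr mulVf ?sqrt3_neq0 //.
  by rewrite scaleN1r opprK.
congr simplex; apply/funext => i; first exact: ea.
rewrite ea dotZr tetra_frame_dot //.
by have := sqrt3_neq0; set s := Num.sqrt 3 => s0; field.
Qed.

(** A point below all four planes can move a little along [v] within the simplex, which raises
    [dot v] unless [v = 0]. *)
Lemma simplex_strict a k x v : tetra_frame a ->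
  (forall i, dot (a i) x < k i) ->
  (forall y, simplex a k y -> dot v y <= dot v x) -> v = 0.
Proof.
move=> [h1 _] hx hv; apply: dot_eq0P; apply/eqP; rewrite eq_le dot_ge0 andbT.
(* The reciprocal of the sum of the reciprocals is a positive lower bound of all four slacks. *)
pose m := (\sum_i (k i - dot (a i) x)^-1)^-1.
have gi i : 0 < (k i - dot (a i) x)^-1 by rewrite invr_gt0 subr_gt0.
have m0 : 0 < m.
  rewrite invr_gt0 (bigD1 0) //= ltr_wpDr ?gi //.
  by apply: sumr_ge0 => i _; apply: ltW.
have mi i : m <= k i - dot (a i) x.
  rewrite -[X in _ <= X]invrK lef_pV2 ?posrE // /m; last first.
    by rewrite -[X in 0 < X]invrK invr_gt0.
  by rewrite (bigD1 i) //= lerDl sumr_ge0 // => j _; apply: ltW.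
pose e := m / (1 + dot v v).
have v1 : 0 < 1 + dot v v by rewrite ltr_wpDr // dot_ge0.
have e0 : 0 < e by rewrite divr_gt0.
have : dot v (x + e *: v) <= dot v x.
  apply: hv => i; rewrite dotDr dotZr.
  have : e * dot (a i) v <= m.
    rewrite /e mulrAC ler_pdivrMr // ler_pM2l //.
    have := cauchy_schwarz (a i) v; rewrite h1 mul1r => cs.
    have := sqr_ge0 (dot (a i) v - 1 / 2); nra.
  by have := mi i; lra.
rewrite dotDr dotZr => h; have {}h : e * dot v v <= 0 by lra.
by rewrite -(pmulr_rle0 _ e0).
Qed.

Lemma full_simplex a k : tetra_frame a -> 0 < \sum_i k i ->
  full (simplex a k).
Proof.
move=> fa k0 v c hc; pose x : point := (3 / 4) *: \sum_j k j *: a j.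
have hx i : dot (a i) x < k i.
  by rewrite dotZr tetra_frame_dot //; lra.
have sx : simplex a k x by move=> i; apply: ltW.
by apply: (simplex_strict fa hx) => y /hc ->; rewrite (hc _ sx).
Qed.

(** The centroid of three contact points stands for an interior point of a facet: a supporting plane
    that touches it contains the whole triangle. *)
Lemma centroid_le v c p q r : dot v p <= c -> dot v q <= c -> dot v r <= c ->
  dot v (3^-1 *: (p + q + r)) = c -> [/\ dot v p = c, dot v q = c & dot v r = c].
Proof. by rewrite dotZr !dotDr => *; split; lra. Qed.

Lemma convex_centroid P p q r : convex P -> P p -> P q -> P r ->
  P (3^-1 *: (p + q + r)).
Proof.
move=> cP Pp Pq Pr.
have -> : 3^-1 *: (p + q + r) =
    (2 / 3) *: (2^-1 *: p + (1 - 2^-1) *: q) + (1 - 2 / 3) *: r.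
  by apply: vec3P; rewrite !coordE; field.
by do 2 ?[apply: (cP)] => //; lra.
Qed.

Lemma simplex_convex a k : convex (simplex a k).
Proof.
move=> x y c hx hy c0 c1 i.
exact: (@halfspace_convex R (a i) (k i) x y c (hx i) (hy i) c0 c1).
Qed.

Lemma simplex_boundary a k x : tetra_frame a -> full (simplex a k) ->
  boundary (simplex a k) x -> exists i, dot (a i) x = k i.
Proof.
move=> fa fT [F /(face_facet fT) [v [c [v0 eF hF]]] Fx].
apply: contrapT => hn; move: v0; apply/negP; rewrite negbK; apply/eqP.
move: Fx; rewrite eF => -[sx /= vx].
apply: (simplex_strict (x := x) fa) => [i|y /hF.1]; last by rewrite vx.
rewrite lt_neqAle sx andbT; apply/eqP => e; apply: hn; by exists i.
Qed.

Lemma tetra_frame_neq0 a i : tetra_frame a -> a i != 0.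
Proof. by move=> [h1 _]; rewrite -dot_eq0 h1 oner_eq0. Qed.

Lemma tetra_frame_inj a i j c : tetra_frame a -> a j = c *: a i -> i = j.
Proof.
move=> [h1 h] e; apply/eqP/negPn/negP => ij.
have := h _ _ ij; have := h1 j; rewrite e dotZl !dotZr h1 !mulr1 => c1 c2.
by move: c1; rewrite c2; lra.
Qed.

Lemma tetra_embed P a k : tetra_frame a -> full P ->
  (forall i, facet P (a i) (k i)) -> P <> simplex a k ->
  face_embedded 4 P (simplex a k).
Proof.
move=> fa fP hP neq.
have sub : P `<=` simplex a k by move=> x Px i; apply: (hP i).1.
have fT := full_sub sub fP.
split.
  split=> // le; apply: neq; exact/seteqP.
exists (fun i => P `&` [set x | dot (a i) x = k i]); split.
- move=> i j e; have [h [p [q [r [[Pp pk] [Pq qk] [Pr rk] n0]]]]] := hP i.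
  have on y : P y -> dot (a i) y = k i -> dot (a j) y = k j.
    move=> Py yk; have : (P `&` [set x | dot (a i) x = k i]) y by [].
    by rewrite e => -[].
  have [||||c] := @noncollinear_normal _ (a i) (a j) p q r
     (tetra_frame_neq0 i fa) n0; rewrite ?pk ?qk ?rk ?on //.
  exact: tetra_frame_inj.
- by move=> i; apply: facet_face (tetra_frame_neq0 i fa) (hP i).
- apply/seteqP; split=> [x [[F /(face_facet fP)[v [c [_ -> _]]] [Px _]]]|].
    by move=> /(simplex_boundary fa fT) [i xi]; exists i.
  move=> x [i _ [Px /= xi]]; split.
    by exists (P `&` [set x | dot (a i) x = k i]);
      [apply: facet_face (tetra_frame_neq0 i fa) (hP i)|].
  exists (simplex a k `&` [set x | dot (a i) x = k i]); last first.
    by split=> //; apply: sub.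
  apply: facet_face (tetra_frame_neq0 i fa) _.
  by apply: facet_sub sub _ (hP i) => y; apply.
Qed.

(** The centroid of three points of a face lies on the boundary of the simplex, hence on one of its
    planes, which then contains that face. Distinct faces give distinct planes, and an injection
    between four indices reaches every plane. *)
Lemma embed_facets P a k : tetra_frame a -> convex P -> full P ->
  face_embedded 4 P (simplex a k) -> forall i, facet P (a i) (k i).
Proof.
move=> fa cP fP [[sub _] [F [injF hF eF]]].
have fT := full_sub sub fP.
have hj i : exists j, F i = P `&` [set x | dot (a j) x = k j] /\
    facet P (a j) (k j).
  have [v [c [v0 eFi [hv [p [q [r [[Pp pc] [Pq qc] [Pr rc] n0]]]]]]]] :=
    face_facet fP (hF i).
  pose g := 3^-1 *: (p + q + r).
  have Pg : P g by apply: convex_centroid.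
  have vg : dot v g = c by rewrite dotZr !dotDr pc qc rc; field.
  have : (boundary P `&` boundary (simplex a k)) g.
    by rewrite eF; exists i => //; rewrite eFi.
  move=> [_ /(simplex_boundary fa fT) [j gj]]; exists j.
  have [pj qj rj] := centroid_le (sub _ Pp j) (sub _ Pq j) (sub _ Pr j) gj.
  have [||||m em] := @noncollinear_normal _ v (a j) p q r v0 n0;
    rewrite ?pc ?qc ?rc ?pj ?qj ?rj //.
  have m0 : m != 0.
    apply/eqP => m0; have := tetra_frame_neq0 j fa.
    by rewrite em m0 scale0r eqxx.
  have ek : k j = m * c by rewrite -pj em dotZl pc.
  split; last first.
    split; first by move=> x /sub; apply.
    by exists p, q, r.
  rewrite eFi; apply/seteqP; split=> x [Px /= xc]; split=> //=.
    by rewrite em dotZl xc ek.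
  by move: xc; rewrite em dotZl ek => /(mulfI m0).
have [f hf] := choice hj.
have injf : injective f.
  by move=> i j e; apply: injF; rewrite (hf i).1 (hf j).1 e.
by move=> i; have [g _ fK] := injF_bij injf; rewrite -(fK i); exact: (hf _).2.
Qed.

Lemma simplex_facetP a k v c : tetra_frame a -> full (simplex a k) ->
  dot v v = 1 -> facet (simplex a k) v c -> exists2 i, v = a i & c = k i.
Proof.
move=> fa fT v1 [hv [p [q [r [[Pp pc] [Pq qc] [Pr rc] n0]]]]].
have v0 : v != 0 by rewrite -dot_eq0 v1 oner_eq0.
pose g := 3^-1 *: (p + q + r).
have Pg : simplex a k g.
  exact: (convex_centroid (@simplex_convex a k) Pp Pq Pr).
have vg : dot v g = c by rewrite dotZr !dotDr pc qc rc; field.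
have [i gi] : exists i, dot (a i) g = k i.
  apply: contrapT => hn; move: v0; apply/negP; rewrite negbK; apply/eqP.
  apply: (simplex_strict (x := g) fa) => [i|y /hv]; last by rewrite vg.
  by rewrite lt_neqAle Pg andbT; apply/eqP => e; apply: hn; exists i.
have [pj qj rj] := centroid_le (Pp i) (Pq i) (Pr i) gi.
have [||||m em] := @noncollinear_normal _ (a i) v p q r
  (tetra_frame_neq0 i fa) n0; rewrite ?pc ?qc ?rc ?pj ?qj ?rj //.
have ec : c = m * k i by rewrite -pj -dotZl -em pc.
have : m ^+ 2 = 1 ^+ 2 by move: v1; rewrite em dotZl dotZr fa.1 mulr1 -expr2 expr1n.
move/eqP; rewrite eqf_sqr => /orP[]/eqP m1.
  by exists i; rewrite ?em ?ec m1 ?scale1r ?mul1r.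
(* With [m = -1] the plane would bound the simplex from both sides and make it flat. *)
exfalso; have := tetra_frame_neq0 i fa; apply/negP; rewrite negbK; apply/eqP.
apply: (fT (a i) (k i)) => x Px; apply/eqP; rewrite eq_le Px /=.
by have := hv _ Px; rewrite em ec m1 dotZl !mulN1r lerN2.
Qed.

Lemma regular_tetraP T : regular_tetrahedron T ->
  exists a k, [/\ tetra_frame a, full T & T = simplex a k].
Proof.
move=> /similarP[c [Q [t [c0 hQ <-]]]]; rewrite tetra_simplex simplex_aff //.
exists (fun i => std_normal i *m Q).
exists (fun i => c * (Num.sqrt 3)^-1 + dot (std_normal i *m Q) t); split=> //.
  exact: tetra_frame_orth std_normal_frame.
rewrite -simplex_aff //; apply: full_aff; rewrite ?gt_eqF //.
apply: full_simplex; first exact: std_normal_frame.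
by rewrite big_ord4 !addr_gt0 ?invr_gt0 ?sqrtr_gt0.
Qed.

Lemma tetra_dirs_embeds S T : regular_tetrahedron T -> full S ->
  tetra_dirs S -> ~ regular_tetrahedron S -> admits_face_embedding 4 S T.
Proof.
move=> hT fS [a [k [fa hk]]] nS.
(* The [a i] sum to zero, so [\sum_i k i <= 0] would force equality in all four bounds on the whole
   of [S], which would be flat. *)
have kpos : 0 < \sum_i k i.
  rewrite big_ord4; have s0 := tetra_frame_sum fa.
  have ge x : S x -> [/\ dot (a 0) x <= k 0, dot (a 1) x <= k 1,
      dot (a 2) x <= k 2 & dot (a 3) x <= k 3].
    by move=> Sx; split; apply: (hk _).1.
  have e0 x : dot (a 0) x + dot (a 1) x + dot (a 2) x + dot (a 3) x = 0.
    by rewrite -!dotDl s0 dot0l.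
  rewrite ltNge; apply/negP => le.
  have := tetra_frame_neq0 0 fa; apply/negP; rewrite negbK; apply/eqP.
  apply: (fS _ (k 0)) => x Sx; have [] := ge x Sx; have := e0 x; lra.
have rT0 := simplex_regular fa kpos.
have /similarP[c [Q [t [c0 hQ eT]]]] : similar (simplex a k) T.
  exact: similar_trans (similar_sym rT0) hT.
have sim : similar S (aff c Q t @` S).
  by apply/similarP; exists c, Q, t.
exists (aff c Q t @` S) => //.
rewrite -eT simplex_aff //; apply: tetra_embed.
- exact: tetra_frame_orth.
- by apply: full_aff => //; rewrite gt_eqF.
- by move=> i; apply: facet_aff.
- rewrite -simplex_aff // eT => e; apply: nS.
  by apply: similar_trans hT (similar_sym _); rewrite -e.
Qed.

Lemma tetra_dirs_similar S S' : similar S S' -> tetra_dirs S -> tetra_dirs S'.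
Proof.
move=> /similarP[c [Q [t [c0 hQ <-]]]] [a [k [fa hk]]].
exists (fun i => a i *m Q), (fun i => c * k i + dot (a i *m Q) t).
by split; [exact: tetra_frame_orth|move=> i; exact: facet_aff].
Qed.

Lemma embeds_tetra_dirs S T : regular_tetrahedron T -> full S -> convex S ->
  admits_face_embedding 4 S T -> tetra_dirs S /\ ~ regular_tetrahedron S.
Proof.
move=> hT fS cS [S' sS' em].
have [a [k [fa fT eT]]] := regular_tetraP hT.
have /similarP[c [Q [t [c0 hQ eS']]]] := sS'.
have c1 : c != 0 by rewrite gt_eqF.
have fS' : full S' by rewrite -eS'; apply: full_aff.
have cS' : convex S'.
  rewrite -eS' => _ _ m [x Sx <-] [y Sy <-] m0 m1.
  exists (m *: x + (1 - m) *: y); first exact: cS.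
  rewrite /aff mulmxDl -!scalemxAl.
  by apply: vec3P; rewrite !coordE; ring.
rewrite eT in em; have hf := embed_facets fa cS' fS' em.
split; first by apply: tetra_dirs_similar (similar_sym sS') _; exists a, k.
(* Were [S'] a tetrahedron, its facets would have the normals and the levels of those of [T], so
   that [S' = T]. *)
move=> rS; have rS' : regular_tetrahedron S' by exact: similar_trans rS sS'.
have [b [l [fb _ eS]]] := regular_tetraP rS'.
have hj i : exists j, a i = b j /\ k i = l j.
  have := hf i; rewrite eS => /(simplex_facetP fb) [||j e1 e2].
  - by rewrite -eS.
  - exact: fa.1.
  - by exists j.
have [f fE] := choice hj.
have injf : injective f.
  move=> i j e; apply: (tetra_frame_inj (c := 1) fa).
  by rewrite scale1r (fE i).1 (fE j).1 e.
case: em => -[_ n] _; apply: n; rewrite eS => x hx i.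
have [g _ fK] := injF_bij injf; rewrite -(fK i) -(fE _).1 -(fE _).2.
exact: hx.
Qed.

End TetrahedralFrames.

(** * Vertices of a polytope, and the vertex set of a uniform polyhedron *)

Section Vertices.
Variable R : realType.
Local Notation point := 'rV[R]_3.
Local Notation edist := Defs.edist.
Local Notation similar := Defs.similar.
Implicit Types (u v w x y z a b p q r t : point) (k l c : R) (A B S P W : set point).

Lemma finite_argmax (T : eqType) (D : set T) (f : T -> R) :
  finite_set D -> D !=set0 ->
  exists2 d : T, D d & forall e : T, D e -> f e <= f d.
Proof.
move=> /finite_seqP[s ->]; elim: s => [[d]|d s IH _]; first by rewrite /= in_nil.
case: s IH => [_|e s IH].
  by exists d => [|e]; rewrite /= mem_seq1 // => /eqP ->.
have [|z zs hz] := IH; first by exists e; rewrite /= mem_head.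
have [le|/ltW le] := leP (f d) (f z).
  exists z => [|w]; rewrite /= [_ \in d :: _]inE; first by rewrite zs orbT.
  by case/orP => [/eqP ->|/hz].
exists d => [|w]; rewrite /= inE ?eqxx //.
by case/orP => [/eqP -> //|/hz h]; exact: le_trans le.
Qed.

Lemma conv_hull_compact A : finite_set A -> compact (conv_hull A).
Proof.
move=> /finite_seqP[s ->]; elim: s => [|a s IH].
  rewrite (_ : conv_hull _ = set0); first exact: compact0.
  by apply/seteqP; split=> // x /conv_hull0 [y]; rewrite /= in_nil.
pose f (z : R * point) := z.1 *: a + (1 - z.1) *: z.2.
(* The point [a] is added separately because the product is empty when [s] is. *)
pose L := [set a] `|` f @` (`[0, 1] `*` conv_hull [set` s]).
rewrite (_ : conv_hull _ = L); last first.
  apply/seteqP; split; last first.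
    move=> x [->|[[k y] /= [k01 hy] <-]]; first by apply: conv_hull_sub; rewrite /= mem_head.
    move: k01; rewrite in_itv /= => /andP[k0 k1]; rewrite /f /=.
    apply: conv_hull_convex => //; first by apply: conv_hull_sub; rewrite /= mem_head.
    by apply: conv_hull_mono hy => z /= zs; rewrite inE zs orbT.
  have Lf k y : 0 <= k -> k <= 1 -> conv_hull [set` s] y -> L (k *: a + (1 - k) *: y).
    move=> k0 k1 hy; right; exists (k, y) => //; split=> //=.
    by rewrite in_itv /= k0.
  have Lmix (y z : point) k l : conv_hull [set` s] y -> conv_hull [set` s] z ->
      0 <= k -> 0 <= l -> k + l <= 1 -> L ((1 - k - l) *: a + (k *: y + l *: z)).
    move=> hy hz k0 l0 kl.
    have [e|n0] := eqVneq (k + l) 0.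
      have k00 : k = 0 by lra.
      have l00 : l = 0 by lra.
      by left; rewrite k00 l00 !scale0r !subr0 scale1r !addr0.
    have p0 : 0 < k + l by rewrite lt_neqAle eq_sym n0 addr_ge0.
    have -> : k *: y + l *: z = (1 - (1 - k - l)) *:
        ((k / (k + l)) *: y + (1 - k / (k + l)) *: z).
      by apply: vec3P; rewrite !coordE; field.
    apply: Lf; [lra|lra|]; apply: conv_hull_convex => //.
      by rewrite divr_ge0 // ltW.
    by rewrite ler_pdivrMr // mul1r lerDl.
  apply: conv_hull_min => [x y k|x /=]; last first.
    rewrite inE => /orP[/eqP ->|xs]; first by left.
    rewrite -[x]scale1r -[1]subr0 -[X in L X]add0r -(scale0r a).
    by apply: Lf => //; exact: conv_hull_sub.
  (* A common form for both parts of [L]; when [l = 1] the second point is arbitrary. *)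
  have tot : L `<=` [set x | exists l y, [/\ 0 <= l, l <= 1,
      x = l *: a + (1 - l) *: y & l < 1 -> conv_hull [set` s] y]].
    move=> z [->|[[l w] /= [l01 hw] <-]].
      by exists 1, 0; rewrite scaler0 scale1r addr0; split=> //; rewrite ltxx.
    by move: l01; rewrite in_itv /= => /andP[? ?]; exists l, w; split.
  move=> /tot[l [x' [l0 l1 -> hx]]] /tot[m [y' [m0 m1 -> hy]]] k0 k1.
  have [el|nl] := eqVneq l 1; have [em|nm] := eqVneq m 1.
  - left; rewrite el em; apply: vec3P; rewrite !coordE; ring.
  - have -> : k *: (l *: a + (1 - l) *: x') + (1 - k) *: (m *: a + (1 - m) *: y') =
      (1 - (1 - k) * (1 - m)) *: a + (1 - (1 - (1 - k) * (1 - m))) *: y'.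
      by rewrite el; apply: vec3P; rewrite !coordE; ring.
    apply: Lf; [nra|nra|]; apply: hy; by rewrite lt_neqAle nm.
  - have -> : k *: (l *: a + (1 - l) *: x') + (1 - k) *: (m *: a + (1 - m) *: y') =
      (1 - k * (1 - l)) *: a + (1 - (1 - k * (1 - l))) *: x'.
      by rewrite em; apply: vec3P; rewrite !coordE; ring.
    apply: Lf; [nra|nra|]; apply: hx; by rewrite lt_neqAle nl.
  - have -> : k *: (l *: a + (1 - l) *: x') + (1 - k) *: (m *: a + (1 - m) *: y') =
      (1 - k * (1 - l) - (1 - k) * (1 - m)) *: a +
      ((k * (1 - l)) *: x' + ((1 - k) * (1 - m)) *: y').
      by apply: vec3P; rewrite !coordE; ring.
    have h1 : 0 <= k * l by rewrite mulr_ge0.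
    have h2 : 0 <= (1 - k) * m by rewrite mulr_ge0 // subr_ge0.
    apply: Lmix; [|by apply: hy; rewrite lt_neqAle nm|..|lra].
    - by apply: hx; rewrite lt_neqAle nl.
    - by rewrite mulr_ge0 // subr_ge0.
    - by rewrite mulr_ge0 // subr_ge0.
apply: compactU; first exact: compact_set1.
apply: continuous_compact; last by apply: compact_setX => //; exact: segment_compact.
apply: continuous_subspaceT => z; rewrite /f.
apply: cvgD; apply: cvgZ; try exact: cvg_cst.
- exact: cvg_fst.
- by apply: cvgB; [exact: cvg_cst|exact: cvg_fst].
- exact: cvg_snd.
Qed.

(** The functional points from the nearest point [q] of [B] to [p]. *)
Lemma compact_separation B p : compact B -> convex B -> B !=set0 -> ~ B p ->
  exists v, forall x, B x -> dot v x < dot v p.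
Proof.
move=> kB cB B0 nBp.
pose f (x : point) := dot (x - p) (x - p).
have cf : continuous f.
  move=> x; rewrite /f.
  have -> : (fun x : point => dot (x - p) (x - p)) =
    fun x : point => (x 0 0 - p 0 0) * (x 0 0 - p 0 0) +
      (x 0 1 - p 0 1) * (x 0 1 - p 0 1) + (x 0 2 - p 0 2) * (x 0 2 - p 0 2).
    by apply/funext => y; rewrite !coordE.
  have ci i : (fun y : point => y 0 i - p 0 i) @ x --> x 0 i - p 0 i.
    apply: (@cvgB R R^o _ (nbhs x) _ (fun y : point => y 0 i) (fun=> p 0 i)).
      exact: (@coord_continuous R 1 3 0 i x).
    exact: cvg_cst.
  have ci2 i : (fun y : point => (y 0 i - p 0 i) * (y 0 i - p 0 i)) @ x -->
      (x 0 i - p 0 i) * (x 0 i - p 0 i).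
    exact: (cvgM (ci i) (ci i)).
  exact: (@cvgD R R^o _ (nbhs x) _ _ _ _ _
    (@cvgD R R^o _ (nbhs x) _ _ _ _ _ (ci2 0) (ci2 1)) (ci2 2)).
have [q qB hq] := EVT_min_rV B0 kB (continuous_subspaceT cf).
have {}qB : B q by rewrite inE in qB.
exists (p - q) => x Bx.
have pq : 0 < dot (p - q) (p - q).
  apply: dot_gt0; rewrite subr_eq0; apply/eqP => e; apply: nBp; by rewrite e.
suff le : dot (p - q) (x - q) <= 0.
  have dB y z w : dot y (z - w) = dot y z - dot y w by rewrite dotDr dotNr.
  by move: pq le; rewrite !(dB (p - q)); lra.
rewrite leNgt; apply/negP => gt.
set d := dot (p - q) (x - q) in gt.
pose D := dot (x - q) (x - q).
have D0 : 0 <= D by exact: dot_ge0.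
(* As [e D <= d], moving from [q] by the fraction [e] towards [x] lowers the squared distance to [p]
   by at least [e d], against the choice of [q]. *)
pose e := d / (d + D).
have dD : 0 < d + D by lra.
have e0 : 0 < e by rewrite divr_gt0.
have e1 : e <= 1 by rewrite ler_pdivrMr // mul1r lerDl.
have eD : e * D <= d.
  by rewrite /e mulrAC ler_pdivrMr // mulrDr lerDr -expr2 sqr_ge0.
have Bz : B (e *: x + (1 - e) *: q) by apply: cB => //; apply: ltW.
have := hq _ (mem_set Bz); rewrite /f.
have -> : e *: x + (1 - e) *: q - p = - (p - q) + e *: (x - q).
  by apply: vec3P; rewrite !coordE; ring.
have -> : q - p = - (p - q) by rewrite opprB.
rewrite !dotDl !dotDr !dotNl !dotNr !dotZl !dotZr.
rewrite !(dotDl _ (- q)) !(dotDr _ (-q)) !dotNl !dotNr.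
have ed : d = dot p x - dot p q - dot q x + dot q q.
  by rewrite /d !dotDl !dotDr !dotNl !dotNr; ring.
have eDD : D = dot x x - 2 * dot q x + dot q q.
  by rewrite /D !dotDl !dotDr !dotNl !dotNr (dotC x q); ring.
rewrite !(dotC x) !(dotC q p).
have : e * (e * D) <= e * d by rewrite ler_pM2l.
have : 0 < e * d by rewrite mulr_gt0.
rewrite ed eDD; lra.
Qed.

(** Among the generators that maximize [a], one of largest norm is exposed by a small multiple of
    itself: adding [e *: v] to [a] leaves [v] as the only maximum. *)
Lemma vertex_support A a : finite_set A -> A !=set0 ->
  exists2 v, vertex (conv_hull A) v &
    forall x, conv_hull A x -> dot a x <= dot a v.
Proof.
move=> fA A0; have [v0 Av0 hv0] := finite_argmax (dot a) fA A0.
pose M := dot a v0.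
have fB : finite_set (A `&` [set x | dot a x = M]).
  by apply: sub_finite_set fA => x [].
have [|v [Av /= av] hv] := finite_argmax (fun x => dot x x) fB.
  by exists v0.
(* [e] is so small that generators below the top level stay below [v] after the perturbation. *)
have [e e0 he] : exists2 e, 0 < e & forall w, A w -> dot a w != M ->
    e * (dot v w - dot v v) < M - dot a w.
  have [[w0 Cw0]|C0] := pselect (A `&` [set x | dot a x != M] !=set0);
    last first.
    by exists 1 => // w Aw aw; exfalso; apply: C0; exists w.
  have fC : finite_set (A `&` [set x | dot a x != M]).
    by apply: sub_finite_set fA => x [].
  have [w1 [Aw1 /= aw1] hw1] := finite_argmax (dot a) fC (ex_intro _ w0 Cw0).
  have [w2 Aw2 hw2] := finite_argmax (fun w => dot v w - dot v v) fA A0.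
  have g0 : 0 < M - dot a w1 by rewrite subr_gt0 lt_neqAle aw1 hv0.
  have d0 : 0 <= dot v w2 - dot v v by rewrite -(subrr (dot v v)) hw2.
  set g := M - dot a w1 in g0; set d := dot v w2 - dot v v in d0.
  exists (g / (1 + d)); first by rewrite divr_gt0 // ltr_wpDr.
  move=> w Aw aw; have d1 : 0 < 1 + d by rewrite ltr_wpDr.
  rewrite mulrAC ltr_pdivrMr //.
  have h1 : g <= M - dot a w by rewrite lerB // hw1.
  have h2 : dot v w - dot v v <= d := hw2 _ Aw.
  have : g * (dot v w - dot v v) <= g * d by rewrite ler_pM2l.
  have : g * (1 + d) <= (M - dot a w) * (1 + d) by rewrite ler_pM2r.
  lra.
pose b := a + e *: v.
have bA x : A x -> dot b x <= dot b v /\ (dot b x = dot b v -> x = v).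
  move=> Ax; rewrite /b !dotDl !dotZl av.
  have [ax|ax] := eqVneq (dot a x) M; last first.
    have := he _ Ax ax; rewrite mulrBr => h; split=> [|e1]; [lra|exfalso; lra].
  have xv : dot x x <= dot v v by apply: hv.
  have [->|nx] := eqVneq x v; first by rewrite av.
  have : 0 < dot (v - x) (v - x) by rewrite dot_gt0 // subr_eq0 eq_sym.
  rewrite !dotDl !dotDr !dotNl !dotNr (dotC x v) ax => h.
  have : e * dot v x < e * dot v v by rewrite ltr_pM2l //; lra.
  by split=> [|e1]; [lra|exfalso; lra].
exists v; last by apply: conv_hull_le => x Ax; rewrite av; apply: hv0.
apply/vertexP; exists b, (dot b v); split=> //.
- by apply: conv_hull_le => x /bA [].
- exact: conv_hull_sub.
- move=> x hx bx.
  have : (conv_hull A `&` [set x | dot b x = dot b v]) x by [].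
  rewrite conv_hull_face; last by move=> y /bA [].
  move=> h; have : conv_hull [set v] x.
    by apply: conv_hull_mono h => y [/bA [_ h] /= /h].
  by rewrite conv_hull1.
Qed.

Lemma vertex_generator A v : vertex (conv_hull A) v -> A v.
Proof.
move=> /vertexP[a [k [h Pv av hv]]].
have : (conv_hull A `&` [set x | dot a x = k]) v by [].
rewrite conv_hull_face; last first.
  by move=> x Ax; apply: h; exact: conv_hull_sub.
move=> /conv_hull0 [x [Ax /= ax]].
by rewrite -(hv x) //; exact: conv_hull_sub.
Qed.

(** A point outside the hull of the vertices would be separated from it by a functional, whose
    maximum over the polytope is attained at a vertex. *)
Lemma conv_hull_vertices A : finite_set A -> A !=set0 ->
  conv_hull A = conv_hull [set v | vertex (conv_hull A) v].
Proof.
move=> fA A0; set V := [set v | _].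
have VA : V `<=` A by move=> v; exact: vertex_generator.
apply/seteqP; split; last exact: conv_hull_mono.
move=> x hx; apply: contrapT => nx.
have fV : finite_set V by apply: sub_finite_set fA.
have [v0 Vv0 _] := vertex_support 0 fA A0.
have [||a ha] := @compact_separation (conv_hull V) x (conv_hull_compact fV) _ _ nx.
- exact: conv_hull_convex.
- by exists v0; exact: conv_hull_sub.
have [v Vv hv] := vertex_support a fA A0.
have := ha _ (conv_hull_sub Vv); rewrite ltNge => /negP; apply.
exact: hv.
Qed.

(** The counterpart of [side] on a finite vertex set: within the facet, some functional is maximal
    at [p] and [q] only. *)
Definition side_of W a k p q := [/\ p != q, W p /\ dot a p = k,
  W q /\ dot a q = k & exists b m, forall x, W x -> dot a x = k ->
    dot b x <= m /\ (dot b x = m <-> x = p \/ x = q)].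

(** What is retained of a uniform polyhedron: its vertices, placed so that the symmetries are
    linear, with the regularity of the faces expressed by equal sides within each facet. *)
Record vertex_set W : Prop := VertexSet {
  vs_finite : finite_set W;
  vs_full : full W;
  vs_trans : forall v w, W v -> W w -> exists Q,
    [/\ orthm Q, forall x, W x -> W (x *m Q) & v *m Q = w];
  vs_side : forall a k p q p' q', a != 0 -> facet W a k ->
    side_of W a k p q -> side_of W a k p' q' ->
    dot (p - q) (p - q) = dot (p' - q') (p' - q') }.

Lemma full_nonempty A : full A -> A !=set0.
Proof.
move=> fA; apply: contrapT => h.
suff /eqP : vec3 1 0 0 = 0 :> point.
  by move/eqP/rowP/(_ 0); rewrite vec3E zeroE; apply/eqP; rewrite oner_eq0.
by apply: (fA _ 0) => x Ax; exfalso; apply: h; exists x.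
Qed.

Lemma uniform_full S : uniform S -> full S.
Proof. by move=> [[_ i0] _ _]; exact: interior_full. Qed.

Lemma uniform_convex S : uniform S -> convex S.
Proof. by move=> [[[A _ ->] _] _ _]; exact: conv_hull_convex. Qed.

Lemma vertex_isometry S Q t v : orthm Q -> aff 1 Q t @` S = S ->
  vertex S v -> vertex S (aff 1 Q t v).
Proof.
move=> hQ eS /vertexP[a [k [h Sv av hv]]]; apply/vertexP.
have e x : dot (a *m Q) (aff 1 Q t x) = dot a x + dot (a *m Q) t.
  by rewrite /aff scale1r dotDr dot_orth.
exists (a *m Q), (k + dot (a *m Q) t); split.
- by rewrite -eS => _ [x Sx <-]; rewrite e lerD2r h.
- by rewrite -eS; apply: imageP.
- by rewrite e av.
- rewrite -eS => _ [x Sx <-]; rewrite e => /addIr /(hv _ Sx) ->.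
  by [].
Qed.

(** Symmetries permute the vertices and so fix their centroid; with the centroid as origin they
    become linear. *)
Lemma uniform_vertex_set S : uniform S ->
  exists2 W, vertex_set W & similar (conv_hull W) S.
Proof.
move=> uS; have fS := uniform_full uS.
have [[[A fA eA] _] reg trans] := uS.
have A0 : A !=set0 by apply/full_nonempty/full_conv; rewrite -eA.
pose V := [set v | vertex S v].
have eV : S = conv_hull V by rewrite {1}eA (conv_hull_vertices fA A0) -eA.
have finV : finite_set V.
  by apply: sub_finite_set fA => v; rewrite /V /= eA; exact: vertex_generator.
have fullV : full V by apply: full_conv; rewrite -eV.
have [s0 es0] := (finite_seqP _).1 finV.
pose s := undup s0.
have es : V = [set` s] by rewrite es0; apply/seteqP; split=> x /=; rewrite mem_undup.
have us : uniq s := undup_uniq s0.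
pose n : R := (size s)%:R.
have n0 : n != 0.
  rewrite pnatr_eq0 size_eq0; apply/eqP => s00.
  by have [x] := full_nonempty fullV; rewrite es s00 /= in_nil.
pose g := n^-1 *: \sum_(x <- s) x.
have fixg Q t : orthm Q -> aff 1 Q t @` S = S -> aff 1 Q t g = g.
  move=> hQ eQ; set f := aff 1 Q t.
  have fV x : x \in s -> f x \in s.
    move=> xs; have Vx : V x by rewrite es.
    have : V (f x) by apply: vertex_isometry.
    by rewrite es.
  have injf : injective f by apply: can_inj; apply: affK => //; exact: oner_neq0.
  have um : uniq (map f s) by rewrite map_inj_uniq.
  (* An injection of a finite list without repetition into itself is a permutation of it. *)
  have pm : perm_eq (map f s) s.
    apply: uniq_perm => //.
    have sub : {subset map f s <= s} by move=> _ /mapP[x xs ->]; exact: fV.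
    by have [|] := uniq_min_size um sub; rewrite ?size_map.
  have e1 : \sum_(x <- s) f x = \sum_(x <- s) x.
    by rewrite -[RHS](perm_big _ pm) big_map.
  have e2 : \sum_(x <- s) f x = (\sum_(x <- s) x) *m Q + n *: t.
    rewrite /f /aff big_split /= mulmx_suml big_const_seq count_predT iter_addr_0.
    by rewrite scaler_nat; congr (_ + _); apply: eq_bigr => x _; rewrite scale1r.
  rewrite /f /aff /g -scalemxAl scale1r.
  have -> : (\sum_(x <- s) x) *m Q = \sum_(x <- s) x - n *: t by rewrite -[in RHS]e1 e2 addrK.
  by rewrite scalerBr scalerA mulVf // scale1r subrK.
pose W := aff 1 1%:M (- g) @` V.
have affE x : aff 1 1%:M (- g) x = x - g by rewrite /aff mulmx1 scale1r.
have WE x : W x -> V (x + g) by move=> [y Vy <-]; rewrite affE subrK.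
have WV x : V (x + g) -> W x by move=> Vx; exists (x + g) => //; rewrite affE addrK.
exists W; last first.
  apply: similar_sym; apply/similarP; exists 1, 1%:M, (- g).
  split; [exact: ltr01|exact: orthm1|].
  by rewrite [in LHS]eV conv_hull_aff //; exact: orthm1.
split.
- exact: finite_image.
- by apply: full_aff; [exact: orthm1|exact: oner_neq0|].
- move=> v w /WE Vv /WE Vw.
  have [f [/isometry_affine[Q [t [hQ ->]]] eQ fv]] := trans _ _ Vv Vw.
  have fg := fixg _ _ hQ eQ.
  have e x : x *m Q = aff 1 Q t (x + g) - g.
    have -> : aff 1 Q t (x + g) = x *m Q + aff 1 Q t g.
      by rewrite /aff mulmxDl !scale1r addrA.
    by rewrite fg addrK.
  exists Q; split=> //; last by rewrite e fv addrK.
  by move=> x /WE Vx; apply: WV; rewrite e subrK; apply: vertex_isometry.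
- move=> a k p q p' q' a0 hf s1 s2.
  pose k' := k + dot a g.
  have kE x : dot a (x + g) = k' <-> dot a x = k.
    by rewrite dotDr /k'; split=> [/addIr|->].
  have fV : facet V a k'.
    have := @facet_aff _ 1 1%:M g W a k (orthm1 R) ltr01 hf.
    rewrite mulmx1 mul1r -/k'.
    rewrite (_ : _ @` W = V) // /W image_comp -[RHS]image_id.
    by apply: eq_imagel => x _ /=; rewrite affE /aff mulmx1 scale1r subrK.
  have fS' : facet S a k' by rewrite eV; apply/facet_conv.
  have := reg _ (facet_face a0 fS'); set F := S `&` _ => -[_ sides _].
  have eF : F = conv_hull (V `&` [set x | dot a x = k']).
    by rewrite /F eV conv_hull_face //; exact: fV.1.
  have side_F p1 q1 : side_of W a k p1 q1 -> side F (p1 + g) (q1 + g).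
    move=> [pq [Wp pk] [Wq qk] [b [m hb]]]; split; last first.
      by apply: affine_dim1_segment; apply/eqP => /addIr e; rewrite e eqxx in pq.
    exists b, (m + dot b g).
    have hB x : (V `&` [set x | dot a x = k']) x -> dot b x <= m + dot b g /\
        (dot b x = m + dot b g <-> x = p1 + g \/ x = q1 + g).
      move=> [Vx /= xk].
      have ex : x = (x - g) + g by rewrite subrK.
      have [||h1 h2] := hb (x - g).
      - by apply: WV; rewrite subrK.
      - by apply/kE; rewrite subrK.
      rewrite ex dotDr lerD2r; split=> //; split=> [/addIr /h2 [->|->]|].
      - by left.
      - by right.
      - by case=> /addIr /= e; congr (_ + _); apply/h2; [left|right].
    split; first by rewrite eF; apply: conv_hull_le => x /hB [].
    rewrite eF conv_hull_face; last by move=> x /hB [].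
    congr conv_hull; apply/seteqP; split=> [x|x [Bx /= bx]].
      have Bp : (V `&` [set x | dot a x = k']) (p1 + g).
        by split; [exact: WE|apply/kE].
      have Bq : (V `&` [set x | dot a x = k']) (q1 + g).
        by split; [exact: WE|apply/kE].
      by move=> [->|->]; split=> //=; [apply/(hB _ Bp).2; left|apply/(hB _ Bq).2; right].
    exact/(hB _ Bx).2.
  have /edist_eq := sides _ _ _ _ (side_F _ _ s1) (side_F _ _ s2).
  have eB y z : y + g - (z + g) = y - z by rewrite opprD addrACA subrr addr0.
  by rewrite !eB.
Qed.

End Vertices.

(** * Finite rotation groups and the distances between their axes *)

Section RotationGroups.
Variable R : realType.
Local Notation point := 'rV[R]_3.
Implicit Types (u v w x y z a b p q r t : point) (k l m c C s : R) (P : set point).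
Implicit Types (Q : 'M[R]_3) (H : set 'M[R]_3).

Definition is_rot Q v C s := forall x, x *m Q = rot v C s x.

Lemma dot_lt1 u v : dot u u = 1 -> dot v v = 1 -> u != v -> dot u v < 1.
Proof.
move=> uu vv uv; have : 0 < dot (u - v) (u - v) by rewrite dot_gt0 // subr_eq0.
rewrite !dotDl !dotDr !dotNl !dotNr uu vv (dotC v u); lra.
Qed.

Lemma dot_gtN1 u v : dot u u = 1 -> dot v v = 1 -> v != - u -> -1 < dot u v.
Proof.
move=> uu vv uv; have := @dot_lt1 (- u) v.
by rewrite !dotNl dotNr opprK uu vv eq_sym uv => /(_ erefl erefl isT); lra.
Qed.

Lemma dot_eq1 u v : dot u u = 1 -> dot v v = 1 -> dot u v = 1 -> u = v.
Proof.
move=> uu vv uv; apply/eqP/negPn/negP => /(dot_lt1 uu vv).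
by rewrite uv ltxx.
Qed.

(* The points v_k of the polygon satisfy
   1 - dot v0 v_k = (1 - c) f_k(t) for the polynomials f_k below, while the
   maximality of c forces each f_k(t) to be 0 or at least 1. *)
Lemma pole_gap P C s v0 v1 c (t := (1 + c) * (1 - C) - 1) :
  (forall v, P v -> dot v v = 1) ->
  (forall v w, P v -> P w -> P (rot v C s w)) ->
  C ^+ 2 + s ^+ 2 = 1 -> C < 1 -> P v0 -> P v1 -> dot v0 v1 = c ->
  -1 < c -> c < 1 -> (forall v w, P v -> P w -> v != w -> dot v w <= c) ->
  [/\ t = 0 \/ 1 <= t,
      (t - 1) ^+ 2 * (t + 1) = 0 \/ 1 <= (t - 1) ^+ 2 * (t + 1) &
      t ^+ 2 - t - 1 = 0 \/ 1 <= (t ^+ 2 - t - 1) ^+ 2].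
Proof.
move=> P1 Pr Cs C1 P0 P01 d01 c0 c1 cmax.
have shift x y z : P x -> P y -> dot x y = c -> z = rot y C s x ->
    [/\ P z, dot y z = c &
    forall x', x' = rot z C s y -> x' = x + t *: (z - y)].
  move=> Px Py xy ez; split; first by rewrite ez; apply: Pr.
    by rewrite ez rot_dot_axis ?P1 // dotC.
  by move=> x' ex'; apply: (rot_shift (P1 _ Py) xy Cs ez ex').
pose v2 := rot v1 C s v0; pose v3 := rot v2 C s v1.
pose v4 := rot v3 C s v2; pose v5 := rot v4 C s v3.
have [P2 d12 /(_ v3 erefl) e3] := shift v0 v1 v2 P0 P01 d01 erefl.
have [P3 d23 /(_ v4 erefl) e4] := shift v1 v2 v3 P01 P2 d12 erefl.
have [P4 d34 /(_ v5 erefl) e5] := shift v2 v3 v4 P2 P3 d23 erefl.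
have P5 : P v5 by apply: Pr.
have d2 : dot v0 v2 = C + (1 - C) * c ^+ 2.
  by rewrite /v2 rot_self ?P1 // mulr1 (dotC v1) d01.
have Et : (1 + c) * (1 - C) = 1 + t by rewrite /t; ring.
clearbody v5; clearbody v4; clearbody v3; clearbody v2; clearbody t.
have d3 : dot v0 v3 = 1 + t * (dot v0 v2 - c).
  by rewrite e3 dotDr dotZr !dotDr dotNr P1 // d01; ring.
have d4 : dot v0 v4 = c + t * (dot v0 v3 - dot v0 v2).
  by rewrite e4 dotDr dotZr !dotDr dotNr d01; ring.
have d5 : dot v0 v5 = dot v0 v2 + t * (dot v0 v4 - dot v0 v3).
  by rewrite e5 dotDr dotZr !dotDr dotNr.
have gap v f : P v -> dot v0 v = 1 - (1 - c) * f -> f = 0 \/ 1 <= f.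
  move=> Pv e; have [e0|n0] := eqVneq v0 v.
    left; move: e; rewrite -e0 P1 // => e.
    have /eqP : (1 - c) * f = 0 by lra.
    by rewrite mulf_eq0 subr_eq0 => /orP[/eqP|/eqP //]; lra.
  right; have := cmax _ _ P0 Pv n0; rewrite e => le.
  have : (1 - c) * 1 <= (1 - c) * f by lra.
  by rewrite ler_pM2l // subr_gt0.
have d2' : dot v0 v2 = 1 - (1 - c) * (1 + t) by rewrite d2 -Et; ring.
have t0 : 0 < 1 + t by rewrite -Et mulr_gt0 //; lra.
split.
- have [|le] := gap _ _ P2 d2'; first by lra.
  have t00 : 0 <= t by lra.
  have [||h] := gap _ (t ^+ 2) P3; first by rewrite d3 d2'; ring.
    by move/eqP; rewrite sqrf_eq0 => /eqP; left.
  by right; rewrite -(@ler_pXn2r _ 2) ?nnegrE // expr1n.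
- apply: (gap _ _ P4); rewrite d4 d3 d2'; ring.
- have [||] := gap _ ((t ^+ 2 - t - 1) ^+ 2) P5.
  + by rewrite d5 d4 d3 d2'; ring.
  + by move/eqP; rewrite sqrf_eq0 => /eqP; left.
  + by right.
Qed.

(** With [0 <= C] and [c < 1] the value of [t] is below 1, so only [t = 0] remains. *)
Lemma pole_gap_obtuse P C s v0 v1 c :
  (forall v, P v -> dot v v = 1) ->
  (forall v w, P v -> P w -> P (rot v C s w)) ->
  C ^+ 2 + s ^+ 2 = 1 -> C < 1 -> P v0 -> P v1 -> dot v0 v1 = c ->
  -1 < c -> c < 1 -> (forall v w, P v -> P w -> v != w -> dot v w <= c) ->
  0 <= C -> (1 + c) * (1 - C) = 1.
Proof.
move=> P1 Pr Cs C1 P0 P01 d01 c0 c1 cmax C0.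
have [[?|h] _ _] := pole_gap P1 Pr Cs C1 P0 P01 d01 c0 c1 cmax; first by lra.
by nra.
Qed.

Lemma golden_gt1 : 1 < golden R.
Proof.
rewrite /golden ltr_pdivlMr // mul1r.
have : 1 < Num.sqrt 5 :> R by rewrite -[X in X < _]sqrtr1 ltr_sqrt // ltr1n.
lra.
Qed.

Lemma sqr_sqrt5 : Num.sqrt 5 * Num.sqrt 5 = 5 :> R.
Proof. by rewrite -expr2 sqr_sqrtr. Qed.

Lemma sqr_golden : golden R * golden R = golden R + 1.
Proof. by have := sqr_sqrt5; rewrite /golden; set x := Num.sqrt 5; lra. Qed.

Lemma sqrt5_golden : Num.sqrt 5 = 2 * golden R - 1.
Proof. by rewrite /golden; set x := Num.sqrt 5; lra. Qed.

Lemma golden_inv : (golden R)^-1 = golden R - 1.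
Proof.
have g0 : golden R != 0 by rewrite gt_eqF // (lt_trans _ golden_gt1).
apply: (mulfI g0); rewrite mulfV // mulrBr sqr_golden; ring.
Qed.

(** For a third turn [t = (3 c + 1) / 2 < 2], and the gaps leave for [t] only 0, 1 and the golden
    ratio: nearest points of a tetrahedron, a cube and a dodecahedron. *)
Lemma pole_gap3 P s v0 v1 c :
  (forall v, P v -> dot v v = 1) ->
  (forall v w, P v -> P w -> P (rot v (- 2^-1) s w)) ->
  s ^+ 2 = 3 / 4 -> P v0 -> P v1 -> dot v0 v1 = c ->
  -1 < c -> c < 1 -> (forall v w, P v -> P w -> v != w -> dot v w <= c) ->
  [\/ c = - 3^-1, c = 3^-1 | 3 * c = Num.sqrt 5].
Proof.
move=> P1 Pr ss P0 P01 d01 c0 c1 cmax.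
have Cs : (- 2^-1) ^+ 2 + s ^+ 2 = 1 by rewrite ss; field.
have C1 : - 2^-1 < 1 :> R by lra.
have [] := pole_gap P1 Pr Cs C1 P0 P01 d01 c0 c1 cmax.
set t := _ - 1; have et : t = (3 * c + 1) / 2 by rewrite /t; field.
have ec : c = (2 * t - 1) / 3 by rewrite et; field.
have t2 : t < 2 by rewrite et; lra.
clearbody t; move=> [t0|t1] h4 h5; first by constructor 1; rewrite ec t0; field.
have [e1|n1] := eqVneq t 1; first by constructor 2; rewrite ec e1; field.
have h4' : 1 <= (t - 1) ^+ 2 * (t + 1).
  case: h4 => // /eqP; rewrite mulf_eq0 sqrf_eq0 subr_eq0 (negPf n1) /=.
  by move/eqP; lra.
(* [(t - 1) ^+ 2 * (t + 1) - 1] factors as [t * (t ^+ 2 - t - 1)]. *)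
have q : 0 <= t ^+ 2 - t - 1.
  have : 0 <= t * (t ^+ 2 - t - 1) by lra.
  by rewrite pmulr_rge0 //; lra.
(* For [1 <= t < 2] this nonnegative value is below 1, so its square cannot reach 1. *)
have t5 : t ^+ 2 - t - 1 = 0 by case: h5 => // h5; nra.
constructor 3; rewrite ec.
have gt1 := golden_gt1.
have : (t - golden R) * (t + golden R - 1) = 0.
  have := sqr_golden; lra.
move/eqP; rewrite mulf_eq0 => /orP[]/eqP e; last by lra.
rewrite sqrt5_golden; lra.
Qed.

(** The axial vector of the antisymmetric part: it recovers the axis from the matrix, so that
    finitely many rotations have finitely many axes. *)
Definition vee Q : point :=
  vec3 (Q 1 2 - Q 2 1) (Q 2 0 - Q 0 2) (Q 0 1 - Q 1 0).

Lemma vee_rot Q v C s : is_rot Q v C s -> vee Q = (2 * s) *: v.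
Proof.
move=> h.
have e0 := h (vec3 1 0 0); have e1 := h (vec3 0 1 0); have e2 := h (vec3 0 0 1).
have e01 := congr1 (fun x : point => x 0 1) e0.
have e02 := congr1 (fun x : point => x 0 2) e0.
have e10 := congr1 (fun x : point => x 0 0) e1.
have e12 := congr1 (fun x : point => x 0 2) e1.
have e20 := congr1 (fun x : point => x 0 0) e2.
have e21 := congr1 (fun x : point => x 0 1) e2.
move: e01 e02 e10 e12 e20 e21; rewrite /rot !coordE => *.
by apply: vec3P; rewrite !coordE; lra.
Qed.

Lemma rot_id_cos Q v C s : dot v v = 1 -> is_rot Q v C s -> Q = 1%:M -> C = 1.
Proof.
move=> vv h e; have := rot_trace vv h; rewrite e mxtrace1; lra.
Qed.

Lemma is_rotM Q Q' v C s C' s' : dot v v = 1 ->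
  is_rot Q v C s -> is_rot Q' v C' s' ->
  is_rot (Q *m Q') v (C' * C - s' * s) (C' * s + s' * C).
Proof. by move=> vv h h' x; rewrite mulmxA h h' rot_comp. Qed.

Lemma is_rot_id Q v s : is_rot Q v 1 s -> s = 0 -> Q = 1%:M.
Proof. by move=> h e; apply: mx_rowP => x; rewrite h e rot1 mulmx1. Qed.

Lemma is_rotT Q v C s : orthm Q -> dot v v = 1 -> C ^+ 2 + s ^+ 2 = 1 ->
  is_rot Q v C s -> is_rot Q^T v C (- s).
Proof.
move=> hQ vv Cs h x.
rewrite -[rot v C (- s) x](orthmK _ hQ); congr (_ *m _).
rewrite h rot_comp // -[LHS](rot1 v); congr rot; first by rewrite -Cs; ring.
by ring.
Qed.

Record rot_group H : Prop := RotGroup {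
  rg_finite : finite_set H;
  rg_orth : forall Q, H Q -> orthm Q;
  rg_det : forall Q, H Q -> \det Q = 1;
  rg_one : H 1%:M;
  rg_mul : forall Q Q', H Q -> H Q' -> H (Q *m Q');
  rg_tr : forall Q, H Q -> H Q^T }.

(** An orthogonal group that preserves a plane also preserves its normal, so in space it is enough
    to exclude invariant lines. *)
Definition irreducible_group H := forall u, u != 0 ->
  exists2 Q, H Q & forall k, u *m Q <> k *: u.

(** Oriented axes of the elements that turn by one fixed angle. The set is stable under [H], hence
    under the turns about its own points, which is what [pole_gap] asks for. *)
Definition poles H C s : set point :=
  [set v | dot v v = 1 /\ exists2 Q, H Q & is_rot Q v C s].

Lemma poles_finite H C s : rot_group H -> s != 0 -> finite_set (poles H C s).
Proof.
move=> hH s0.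
apply: (sub_finite_set _ (finite_image (fun Q => (2 * s)^-1 *: vee Q) (rg_finite hH))).
move=> v [_ [Q HQ h]]; exists Q => //.
by rewrite (vee_rot h) scalerA mulVf ?scale1r // mulf_neq0.
Qed.

Lemma poles_orth H C s v Q : rot_group H -> poles H C s v -> H Q ->
  poles H C s (v *m Q).
Proof.
move=> hH [vv [P HP h]] HQ; have hQ := rg_orth hH HQ.
split; first by rewrite dot_orth.
exists (Q^T *m P *m Q); first by do 2!apply: rg_mul => //; apply: rg_tr.
move=> x; rewrite !mulmxA h -rot_orth ?orthmKV //; exact: rg_det HQ.
Qed.

Lemma poles_rot H C s v w : rot_group H -> poles H C s v -> poles H C s w ->
  poles H C s (rot v C s w).
Proof. by move=> hH [_ [Q HQ <-]] hw; apply: poles_orth. Qed.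

Lemma poles_opp H C s v : rot_group H -> C ^+ 2 + s ^+ 2 = 1 ->
  poles H C s v -> poles H C s (- v).
Proof.
move=> hH Cs [vv [Q HQ h]]; split; first by rewrite dotNl dotNr opprK.
exists Q^T; first exact: rg_tr.
move=> x; rewrite -[s]opprK rotN.
exact: (is_rotT (rg_orth hH HQ) vv Cs h).
Qed.

Lemma unit_parallel u v k : dot u u = 1 -> dot v v = 1 -> v = k *: u ->
  v = u \/ v = - u.
Proof.
move=> uu vv e; have : k ^+ 2 = 1 ^+ 2.
  by move: vv; rewrite e dotZl dotZr uu mulr1 -expr2 expr1n.
move/eqP; rewrite eqf_sqr => /orP[]/eqP k1; rewrite e k1.
  by left; rewrite scale1r.
by right; rewrite scaleN1r.
Qed.

(** The pair [v], [w] shows that the largest product exceeds -1, because [w != - v]. *)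
Lemma closest_pair P v w : finite_set P -> (forall v, P v -> dot v v = 1) ->
  P v -> P w -> w != v -> w != - v ->
  exists v0 v1, [/\ P v0, P v1, -1 < dot v0 v1, dot v0 v1 < 1 &
    forall v w, P v -> P w -> v != w -> dot v w <= dot v0 v1].
Proof.
move=> fP P1 Pv Pw wv wNv.
pose D := (P `*` P) `&` [set z : point * point | z.1 != z.2].
have fD : finite_set D.
  apply: (@sub_finite_set _ _ (P `*` P)); first by move=> z [].
  exact: finite_setX.
have [|[v0 v1] [[/= P0 P01] n01] hm] :=
  finite_argmax (fun z : point * point => dot z.1 z.2) fD.
  by exists (v, w); split=> //=; rewrite eq_sym.
exists v0, v1; split=> //.
- apply: (lt_le_trans (dot_gtN1 (P1 _ Pv) (P1 _ Pw) wNv)).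
  by apply: (hm (v, w)); split=> //=; rewrite eq_sym.
- by apply: dot_lt1 => //; apply: P1.
- by move=> x y Px Py xy; apply: (hm (x, y)).
Qed.

Lemma pole_pair H C s v : rot_group H -> irreducible_group H -> s != 0 ->
  poles H C s v -> exists v0 v1,
  [/\ poles H C s v0, poles H C s v1, -1 < dot v0 v1, dot v0 v1 < 1 &
    forall v w, poles H C s v -> poles H C s w -> v != w ->
      dot v w <= dot v0 v1].
Proof.
move=> hH iH s0 hv; have vv := hv.1.
have v0 : v != 0 by rewrite -dot_eq0 vv oner_eq0.
have [Q HQ nQ] := iH v v0.
apply: (@closest_pair (poles H C s) v (v *m Q)) => //.
- exact: poles_finite.
- by move=> x [].
- exact: poles_orth.
- by apply/eqP => e; apply: (nQ 1); rewrite scale1r.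
- by apply/eqP => e; apply: (nQ (-1)); rewrite scaleN1r.
Qed.

(* The witness has least angle among the rotations of order other than 2; its
   powers exclude all other negative cosines. *)
Lemma least_rotation H : rot_group H -> irreducible_group H ->
  exists v C s, [/\ poles H C s v, C ^+ 2 + s ^+ 2 = 1, s != 0 &
    0 <= C \/ C = - 2^-1].
Proof.
move=> hH iH.
pose X := H `&` [set Q | Q *m Q != 1%:M].
have sq0 Q v C s : dot v v = 1 -> is_rot Q v C s -> C ^+ 2 + s ^+ 2 = 1 ->
    s = 0 -> Q *m Q = 1%:M.
  move=> vv h Cs s0; have e : C * C - s * s = 1 by rewrite -Cs s0; ring.
  have := is_rotM vv h h; rewrite e => /is_rot_id; apply.
  by rewrite s0; ring.
have [X0|nX] := pselect (X !=set0); last first.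
  (* If all elements were involutions, they would be symmetric matrices and commute, so the axis of
     one of them would be preserved by all. *)
  have inv Q : H Q -> Q *m Q = 1%:M.
    by move=> HQ; apply/eqP/negPn/negP => n; apply: nX; exists Q.
  have sym Q : H Q -> Q^T = Q.
    move=> HQ; rewrite -[LHS]mul1mx -(inv _ HQ) -mulmxA.
    by rewrite (rg_orth hH HQ) mulmx1.
  exfalso; have [[Q [HQ /= nQ]]|hall] :=
      pselect (H `&` [set Q | Q != 1%:M] !=set0); last first.
    have [|Q HQ] := iH (vec3 1 0 0).
      by rewrite -dot_eq0 !coordE !(mulr0, addr0, mulr1) oner_eq0.
    have -> : Q = 1%:M by apply/eqP/negPn/negP => n; apply: hall; exists Q.
    by move=> /(_ 1); rewrite mulmx1 scale1r.
  have [v [C [s [vv Cs h]]]] := rot_exists (rg_orth hH HQ) (rg_det hH HQ).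
  have C1 : C != 1.
    apply/eqP => C1; move: nQ; apply/negP; rewrite negbK; apply/eqP.
    rewrite C1 in h Cs; apply: (is_rot_id h); apply/eqP; rewrite -sqrf_eq0.
    by apply/eqP; move: Cs; rewrite expr1n; lra.
  have v0 : v != 0 by rewrite -dot_eq0 vv oner_eq0.
  have [Q' HQ' nQ'] := iH v v0; apply: (nQ' (dot v (v *m Q'))).
  apply: (rot_fixed (s := s) vv C1); rewrite -h -mulmxA.
  have -> : Q' *m Q = Q *m Q'.
    by rewrite -(sym _ (rg_mul hH HQ HQ')) trmx_mul !sym.
  by rewrite mulmxA h rot_axis.
have fX : finite_set X by apply: sub_finite_set (rg_finite hH) => Q [].
have [Q [HQ /= QQ] hmax] := finite_argmax (fun Q => \tr Q) fX X0.
have [v [C [s [vv Cs h]]]] := rot_exists (rg_orth hH HQ) (rg_det hH HQ).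
have s0 : s != 0 by apply/eqP => s0; move: QQ; rewrite (sq0 _ _ _ _ vv h Cs s0) eqxx.
exists v, C, s; split=> //; first by split=> //; exists Q.
have [|Cn] := leP 0 C; first by left.
(* The cube has cosine [C * (4 * C ^+ 2 - 3)], larger than [C] for [-1 < C < 0]; by the choice of
   [Q] its order is then at most 2, which means [4 * C ^+ 2 = 1]. *)
right; have h3 := is_rotM vv h (is_rotM vv h h).
set C3 := _ - _ in h3; set s3 := _ + _ in h3.
have ss2 : s ^+ 2 = 1 - C ^+ 2 by lra.
have eC : C3 = C * (4 * C ^+ 2 - 3).
  transitivity (C * (C ^+ 2 - 3 * s ^+ 2)); first by rewrite /C3; ring.
  by rewrite ss2; ring.
have es : s3 = s * (4 * C ^+ 2 - 1).
  transitivity (s * (3 * C ^+ 2 - s ^+ 2)); first by rewrite /s3; ring.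
  by rewrite ss2; ring.
have [e0|n0] := eqVneq s3 0.
  move: e0; rewrite es => /eqP; rewrite mulf_eq0 (negPf s0) /= => /eqP e.
  have : (2 * C - 1) * (2 * C + 1) = 0 by lra.
  by move/eqP; rewrite mulf_eq0 => /orP[]/eqP; lra.
have H3 : H (Q *m (Q *m Q)) by do 2!apply: rg_mul => //.
have X3 : X (Q *m (Q *m Q)).
  split=> //=; apply/eqP => e.
  have := rot_id_cos vv (is_rotM vv h3 h3) e => c1.
  have : C3 ^+ 2 + s3 ^+ 2 = 1.
    transitivity ((C ^+ 2 + s ^+ 2) ^+ 3); first by rewrite /C3 /s3; ring.
    by rewrite Cs expr1n.
  move=> c2; have /eqP : s3 ^+ 2 = 0 by lra.
  by rewrite sqrf_eq0 (negPf n0).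
have := hmax _ X3; rewrite (rot_trace vv h3) (rot_trace vv h) eC => le.
exfalso; have sp : 0 < s ^+ 2 by rewrite exprn_even_gt0.
by nra.
Qed.

Lemma cubic_third C : C * (4 * C ^+ 2 - 3) = 1 -> C = 1 \/ C = - 2^-1.
Proof.
move=> e; have /eqP : (C - 1) * (2 * C + 1) ^+ 2 = 0 by lra.
rewrite mulf_eq0 sqrf_eq0 => /orP[]/eqP; first by left; lra.
by right; lra.
Qed.

(** When [0 <= C] the recurrence has [t = 0], so the polygon of axes closes up into a triangle. The
    product of the turns about [v0] and [v1] permutes its corners cyclically and has order 3. *)
Lemma third_rotation H : rot_group H -> irreducible_group H ->
  exists v s, poles H (- 2^-1) s v /\ s ^+ 2 = 3 / 4.
Proof.
move=> hH iH; have [v [C [s [hv Cs s0 [C0|CE]]]]] := least_rotation hH iH;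
  last first.
  exists v, s; split; first by rewrite -CE.
  by move: Cs; rewrite CE; lra.
have [v0 [v1 [h0 h1 c0 c1 cmax]]] := pole_pair hH iH s0 hv.
have C1 : C < 1.
  have : 0 < s ^+ 2 by rewrite exprn_even_gt0.
  by nra.
have P1 x : poles H C s x -> dot x x = 1 by case.
have t0 := pole_gap_obtuse P1 (fun _ _ => poles_rot hH) Cs C1 h0 h1 erefl c0 c1 cmax C0.
pose v2 := rot v1 C s v0.
have e3 : rot v2 C s v1 = v0.
  rewrite (rot_shift (P1 _ h1) erefl Cs erefl erefl) t0 subrr.
  by rewrite scale0r addr0.
have d12 : dot v1 v2 = dot v0 v1 by rewrite rot_dot_axis ?P1 // dotC.
have v22 : dot v2 v2 = 1 by apply/P1/poles_rot.
have e4 : rot v0 C s v2 = v1.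
  rewrite (rot_shift v22 d12 Cs erefl (esym (congr1 (fun x => rot x C s v2) e3))).
  by rewrite t0 subrr scale0r addr0.
have [vv0 [Q0 HQ0 r0]] := h0; have [vv1 [Q1 HQ1 r1]] := h1.
pose B := Q0 *m Q1; have HB : H B by apply: rg_mul.
have B0 : v0 *m B = v2 by rewrite mulmxA r0 rot_axis // r1.
have B1 : v1 *m B = v0.
  rewrite mulmxA r0 -rot_orth; [|exact: rg_orth HQ1|exact: rg_det HQ1].
  by rewrite !r1 (rot_axis _ _ vv1) e3.
have B2 : v2 *m B = v1 by rewrite mulmxA r0 e4 r1 rot_axis.
clearbody B.
have [u [C' [s' [uu Cs' hB]]]] := rot_exists (rg_orth hH HB) (rg_det hH HB).
have h3 := is_rotM uu hB (is_rotM uu hB hB).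
set C3 := _ - _ in h3; set s3 := _ + _ in h3.
have eC : C3 = C' * (4 * C' ^+ 2 - 3).
  have ss2 : s' ^+ 2 = 1 - C' ^+ 2 by lra.
  transitivity (C' * (C' ^+ 2 - 3 * s' ^+ 2)); first by rewrite /C3; ring.
  by rewrite ss2; ring.
have f0 : rot u C3 s3 v0 = v0 by rewrite -h3 !mulmxA B0 B2 B1.
have f1 : rot u C3 s3 v1 = v1 by rewrite -h3 !mulmxA B1 B0 B2.
(* The cube of [B] fixes the independent vectors [v0] and [v1], so it is no turn with a single
   axis. *)
have C31 : C3 = 1.
  apply/eqP/negPn/negP => n1.
  have p0 := rot_fixed uu n1 f0; have p1 := rot_fixed uu n1 f1.
  have [e|e] := unit_parallel uu vv0 p0;
    have [e'|e'] := unit_parallel uu vv1 p1;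
    move: c0 c1; rewrite e e' ?dotNl ?dotNr uu; lra.
have [C'1|C'E] := cubic_third (etrans (esym eC) C31); last first.
  exists u, s'; split; first by rewrite -C'E; split=> //; exists B.
  by move: Cs'; rewrite C'E; lra.
exfalso; have s'0 : s' = 0.
  apply/eqP; rewrite -sqrf_eq0; apply/eqP.
  by move: Cs'; rewrite C'1 expr1n; lra.
rewrite C'1 in hB; have B11 := is_rot_id hB s'0.
by move: c1; rewrite -B1 B11 mulmx1 vv1 ltxx.
Qed.

(** The next point [v2] has product [- 1 / 2 + (3 / 2) c ^+ 2] with [v0], for [c] the product of
    [v0] and [v1]: this is -1/3 when [c = 1 / 3], and 1/3 when [c ^+ 2 = 5 / 9], where [- v2] is
    taken. *)
Lemma tetrahedral_pair P s v0 v1 : s ^+ 2 = 3 / 4 ->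
  (forall v, P v -> dot v v = 1) ->
  (forall v w, P v -> P w -> P (rot v (- 2^-1) s w)) ->
  (forall v, P v -> P (- v)) -> P v0 -> P v1 ->
  [\/ dot v0 v1 = - 3^-1, dot v0 v1 = 3^-1 | 3 * dot v0 v1 = Num.sqrt 5] ->
  exists u w, [/\ P u, P w & dot u w = - 3^-1].
Proof.
move=> ss P1 Pr Pn P0 P01 hc.
pose v2 := rot v1 (- 2^-1) s v0.
have d2 : dot v0 v2 = - 2^-1 + (1 + 2^-1) * dot v0 v1 ^+ 2.
  by rewrite rot_self ?P1 // (dotC v1); field.
case: hc => c; first by exists v0, v1.
  by exists v0, v2; split=> //; [exact: Pr|rewrite d2 c; field].
exists v0, (- v2); split=> //; first exact/Pn/Pr.
have c2 : 9 * dot v0 v1 ^+ 2 = 5.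
  by rewrite -sqr_sqrt5 -c; ring.
by rewrite dotNr d2; lra.
Qed.

Lemma irreducible_tetrahedral H : rot_group H -> irreducible_group H ->
  exists s u w, [/\ s ^+ 2 = 3 / 4, poles H (- 2^-1) s u,
    poles H (- 2^-1) s w & dot u w = - 3^-1].
Proof.
move=> hH iH; have [v [s [hv ss]]] := third_rotation hH iH.
have s0 : s != 0 by rewrite -sqrf_eq0 ss mulf_neq0 ?invr_neq0 // pnatr_eq0.
have [v0 [v1 [h0 h1 c0 c1 cmax]]] := pole_pair hH iH s0 hv.
have Cs : (- 2^-1) ^+ 2 + s ^+ 2 = 1 by rewrite ss; field.
have P1 x : poles H (- 2^-1) s x -> dot x x = 1 by case.
have Pr x y : poles H (- 2^-1) s x -> poles H (- 2^-1) s y ->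
    poles H (- 2^-1) s (rot x (- 2^-1) s y) by apply: poles_rot.
have hc := pole_gap3 P1 Pr ss h0 h1 erefl c0 c1 cmax.
have [|u [w [hu hw uw]]] := tetrahedral_pair ss P1 Pr _ h0 h1 hc.
  by move=> x; apply: poles_opp.
by exists s, u, w.
Qed.

End RotationGroups.

(** * Symmetries of the vertex set, and what lies at the ends of third-turn axes *)

Section SymmetryGroup.
Variable R : realType.
Local Notation point := 'rV[R]_3.
Local Notation similar := Defs.similar.
Implicit Types (u v w x y z p q r t : point) (c C s : R) (P W : set point).
Implicit Types (Q : 'M[R]_3) (a : 'I_4 -> point).

Definition symm W Q := orthm Q /\ forall x, W x -> W (x *m Q).

Lemma symmM W Q Q' : symm W Q -> symm W Q' -> symm W (Q *m Q').
Proof.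
move=> [h1 h2] [h3 h4]; split; first exact: orthmM.
by move=> x Wx; rewrite mulmxA; apply/h4/h2.
Qed.

(** An injective map of a finite set into itself is onto. *)
Lemma symmT W Q : finite_set W -> symm W Q -> symm W Q^T.
Proof.
move=> /finite_seqP[s0 es0] [hQ h]; split; first exact: orthmT.
pose s := undup s0.
have es : W = [set` s].
  by rewrite es0; apply/seteqP; split=> x /=; rewrite mem_undup.
pose f x := x *m Q.
have injf : injective f.
  by move=> x y e; rewrite -(orthmK x hQ) -(orthmK y hQ) -/(f x) e.
have um : uniq (map f s) by rewrite map_inj_uniq // undup_uniq.
have sub : {subset map f s <= s}.
  by move=> _ /mapP[x xs ->]; have := h x; rewrite es; apply.
have [|_ e] := uniq_min_size um sub; first by rewrite size_map.
move=> x; rewrite es /= -e => /mapP[y ys ->].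
by rewrite /f orthmK.
Qed.

(** In odd dimension exactly one of [Q] and [- Q] is a rotation, so every symmetry is represented,
    the improper ones up to sign. *)
Definition rotations W : set 'M[R]_3 :=
  [set Q | [/\ orthm Q, \det Q = 1 & symm W Q \/ symm W (- Q)]].

Lemma full_dot W u : full W -> u != 0 -> exists2 x, W x & dot u x != 0.
Proof.
move=> fW u0; apply: contrapT => h; move: u0; apply/negP; rewrite negbK.
apply/eqP; apply: (fW _ 0) => x Wx; apply/eqP/negPn/negP => n.
by apply: h; exists x.
Qed.

Lemma full_basis W : full W -> exists x y z, [/\ W x, W y, W z &
  dot (cross x y) z != 0].
Proof.
move=> fW.
have [|x Wx] := full_dot (u := vec3 1 0 0) fW.
  by rewrite -dot_eq0 !coordE !(mulr0, addr0, mulr1) oner_eq0.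
move=> dx; have x0 : x != 0.
  by apply: contra dx => /eqP ->; rewrite dot0r.
have [u u0 xu] := exists_orth x0.
have [y Wy uy] := full_dot fW u0.
have n0 : cross x y != 0.
  apply: contra uy => /eqP e; rewrite (cross0P x0 e) dotZr (dotC u x) xu.
  by rewrite mulr0.
have [z Wz zn] := full_dot fW n0.
by exists x, y, z.
Qed.

Lemma rotations_group W : finite_set W -> full W -> rot_group (rotations W).
Proof.
move=> finW fW; split.
(* A rotation is determined by the images of a basis taken in [W], and these lie in [W] or in its
   opposite. *)
- have [x [y [z [Wx Wy Wz d0]]]] := full_basis fW.
  have um : mat3 x y z \in unitmx.
    by rewrite unitmxE unitfE -dot_cross_det.
  pose X := W `|` (fun x => - x) @` W.
  have fX : finite_set X by rewrite finite_setU; split=> //; exact: finite_image.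
  pose f (z' : point * point * point) :=
    invmx (mat3 x y z) *m mat3 z'.1.1 z'.1.2 z'.2.
  apply: (sub_finite_set _ (finite_image f (finite_setX (finite_setX fX fX) fX))).
  move=> Q [hQ _ hs].
  have im v : W v -> X (v *m Q).
    move=> Wv; case: hs => -[_ h]; first by left; apply: h.
    by right; exists (v *m (- Q)); [exact: h|rewrite mulmxN opprK].
  exists (x *m Q, y *m Q, z *m Q); first by split; [split|]; apply: im.
  by rewrite /f /= -mat3M mulKmx.
- by move=> Q [].
- by move=> Q [].
- split; [exact: orthm1|exact: det1|left].
  by split; [exact: orthm1|move=> x; rewrite mulmx1].
- move=> P Q [hP dP sP] [hQ dQ sQ]; split; first exact: orthmM.
    by rewrite det_mulmx dP dQ mulr1.
  case: sP => sP; case: sQ => sQ.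
  + by left; exact: symmM.
  + by right; rewrite -mulmxN; exact: symmM.
  + by right; rewrite -mulNmx; exact: symmM.
  + by left; rewrite -[P *m Q]opprK -mulmxN -mulNmx; exact: symmM.
- move=> Q [hQ dQ sQ]; split; [exact: orthmT|by rewrite det_tr|].
  case: sQ => sQ; first by left; exact: symmT.
  by right; have := symmT finW sQ; rewrite linearN.
Qed.

Lemma third_turn_eq s : s ^+ 2 = 3 / 4 ->
  (- 2^-1) * (- 2^-1) - s * s = - 2^-1 /\ (- 2^-1) * s + s * (- 2^-1) = - s.
Proof. by rewrite expr2 => e; split; rewrite ?e; field. Qed.

(* A third turn is its own fourth power, so the sign disappears. *)
Lemma third_turn_symm W Q v s : s ^+ 2 = 3 / 4 -> dot v v = 1 ->
  rotations W Q -> is_rot Q v (- 2^-1) s -> symm W Q.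
Proof.
move=> ss vv [hQ dQ [//|sQ]] h.
have [e1 e2] := third_turn_eq ss.
have h2 := is_rotM vv h h; rewrite e1 e2 in h2.
have h4 := is_rotM vv h2 h2.
have e : (- Q) *m (- Q) *m ((- Q) *m (- Q)) = Q.
  apply: mx_rowP => x; rewrite !(mulNmx, mulmxN) !opprK h4 h; congr rot.
    by rewrite -[RHS]e1; ring.
  by field.
by rewrite -e; do 2!apply: symmM => //; apply: symmM.
Qed.

(** A maximum of [u] off the axis has three noncollinear images on the same level, which span a
    facet; otherwise the maximum found lies on the axis. *)
Lemma third_turn_face W Q u s : finite_set W -> W !=set0 -> dot u u = 1 ->
  symm W Q -> is_rot Q u (- 2^-1) s -> s != 0 ->
  (exists k, facet W u k) \/
  (exists2 k, W (k *: u) & forall x, W x -> dot u x <= k).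
Proof.
move=> fW W0 uu [hQ sQ] h s0.
have [v Wv hv] := finite_argmax (dot u) fW W0.
have [e|n0] := eqVneq v (dot u v *: u).
  by right; exists (dot u v); rewrite -?e.
left; exists (dot u v); split=> //.
have Q1 : W (v *m Q) by apply: sQ.
have Q2 : W (v *m Q *m Q) by apply: sQ.
have d1 : dot u (v *m Q) = dot u v by rewrite h rot_dot_axis.
have d2 : dot u (v *m Q *m Q) = dot u v by rewrite h rot_dot_axis.
exists v, (v *m Q), (v *m Q *m Q); split=> //.
(* The part of [v] orthogonal to the axis; with [n] it spans the plane of the three contact points,
   up to translation. *)
pose y := v - dot u v *: u.
have y0 : y != 0 by rewrite subr_eq0.
have uy : dot u y = 0 by rewrite /y dotDr dotNr dotZr uu; ring.
have ev : v = y + dot u v *: u by rewrite subrK.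
pose n := cross u y.
have r1 : v *m Q = (- 2^-1) *: y + s *: n + dot u v *: u.
  rewrite h /rot /n {1 2}ev.
  have -> : cross u (y + dot u v *: u) = cross u y.
    by apply: vec3P; rewrite !coordE; ring.
  by apply: vec3P; rewrite !coordE; ring.
have un : dot u n = 0 by exact: cross_dotl.
have en : cross u n = - y.
  by rewrite /n crossN cross_crossl uu (dotC y) uy scale1r scale0r subr0.
have r2 : v *m Q *m Q = (2^-2 - s ^+ 2) *: y - s *: n + dot u v *: u.
  rewrite h r1 /rot.
  have -> : cross u ((- 2^-1) *: y + s *: n + dot u v *: u) =
      (- 2^-1) *: cross u y + s *: cross u n.
    by clearbody n; apply: vec3P; rewrite !coordE; ring.
  rewrite !dotDr !dotZr uu uy un en -/n.
  by clearbody n; apply: vec3P; rewrite !coordE; field.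
apply/eqP => c0; have : dot u (cross (v *m Q - v) (v *m Q *m Q - v)) = 0.
  by rewrite c0 dot0r.
have -> : v *m Q - v = (- (3 / 2)) *: y + s *: n.
  by rewrite r1 {2}ev; clearbody n; apply: vec3P; rewrite !coordE; field.
have -> : v *m Q *m Q - v = (- (3 / 4) - s ^+ 2) *: y - s *: n.
  by rewrite r2 {2}ev; clearbody n; apply: vec3P; rewrite !coordE; field.
have -> : cross ((- (3 / 2)) *: y + s *: n) ((- (3 / 4) - s ^+ 2) *: y - s *: n)
    = (s * (9 / 4 + s ^+ 2)) *: cross y n.
  by clearbody n; apply: vec3P; rewrite !coordE; field.
have -> : cross y n = dot y y *: u.
  by rewrite crossN cross_crossl uy scale0r sub0r opprK.
rewrite !dotZr uu mulr1 => /eqP; rewrite !mulf_eq0 (negPf s0) dot_eq0.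
rewrite (negPf y0) orbF /= => /eqP.
by have := sqr_ge0 s; lra.
Qed.

(** The products of [y] with the four members have sum 0 and squares of sum 4/3; two of them being
    -1/3, the other two are 1 and -1/3. *)
Lemma frame_complete a (i j k l : 'I_4) y : tetra_frame a ->
  uniq [:: i; j; k; l] -> dot y y = 1 -> dot (a i) y = - 3^-1 ->
  dot (a j) y = - 3^-1 -> y = a k \/ y = a l.
Proof.
move=> fa un yy yi yj; have [h1 h2] := fa.
have [Q hQ e] := tetra_frame_std fa.
pose x := Num.sqrt 3 *: (y *m Q^T).
have xx : dot x x = 3.
  by rewrite dotZl dotZr dot_orth ?yy; [rewrite mulr1 sqr_sqrt3|exact: orthmT].
have xa m : dot (tetra_vertex R m) x = 3 * dot (a m) y.
  rewrite dotZr -dot_orthl // e dotZl mulrA sqr_sqrt3 //.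
have tot : \sum_m dot (tetra_vertex R m) x = 0.
  by rewrite big_ord4 /tetra_vertex /= !coordE; ring.
have tot2 : \sum_m (dot (tetra_vertex R m) x) ^+ 2 = 12.
  transitivity (4 * dot x x); last by rewrite xx; ring.
  by rewrite big_ord4 /tetra_vertex /= !coordE; ring.
have all4 (F : 'I_4 -> R) : \sum_m F m = F i + F j + F k + F l.
  have p : perm_eq (index_enum 'I_4) [:: i; j; k; l].
    apply: uniq_perm; rewrite ?index_enum_uniq //.
    have := uniq_min_size un; move=> /(_ (index_enum 'I_4)) [||_ h].
    - by move=> m _; exact: mem_index_enum.
    - by rewrite /index_enum -enumT size_enum_ord.
    - by move=> m; rewrite h.
  by rewrite (perm_big _ p) /= !big_cons big_nil addr0 !addrA.
move: tot tot2; rewrite !all4 !xa yi yj => t1 t2.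
have : (dot (a k) y - 1) * (dot (a l) y - 1) = 0 by nra.
move/eqP; rewrite mulf_eq0 !subr_eq0 => /orP[]/eqP hh; [left|right];
  by apply: esym; apply: dot_eq1.
Qed.

Lemma poles_symm W s v : s ^+ 2 = 3 / 4 -> poles (rotations W) (- 2^-1) s v ->
  exists2 Q, symm W Q & is_rot Q v (- 2^-1) s.
Proof. by move=> ss [vv [Q HQ h]]; exists Q => //; apply: third_turn_symm h. Qed.

(** The third turn about [u] carries [w] to the two remaining members of the frame. *)
Lemma tetra_frame_pair (P : set point) s u w : s ^+ 2 = 3 / 4 ->
  dot u u = 1 -> dot w w = 1 -> dot u w = - 3^-1 ->
  (forall v, P v -> dot v v = 1) ->
  (forall v w, P v -> P w -> P (rot v (- 2^-1) s w)) -> P u -> P w ->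
  exists a, [/\ tetra_frame a, forall i, P (a i), a 0 = u & a 1 = w].
Proof.
move=> ss uu ww uw P1 Pr Pu Pw.
pose w1 := rot u (- 2^-1) s w; pose w2 := rot u (- 2^-1) s w1.
have [e1 e2] := third_turn_eq ss.
have Ew2 : w2 = rot u (- 2^-1) (- s) w by rewrite /w2 /w1 rot_comp // e1 e2.
have Pw1 : P w1 by apply: Pr.
have Pw2 : P w2 by apply: Pr.
pose a (i : 'I_4) : point := [:: u; w; w1; w2]`_i.
exists a; split=> //; last by apply: forall_ord4.
have duw1 : dot u w1 = - 3^-1 by rewrite rot_dot_axis.
have duw2 : dot u w2 = - 3^-1 by rewrite rot_dot_axis.
have d1 : dot w w1 = - 3^-1 by rewrite rot_self // ww uw; field.
have d2 : dot w w2 = - 3^-1 by rewrite Ew2 rot_self // ww uw; field.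
have d3 : dot w1 w2 = - 3^-1 by rewrite rot_self // (P1 _ Pw1) duw1; field.
split; first by apply: forall_ord4; apply: P1.
move=> i j; rewrite /a; clearbody w2; clearbody w1.
by case: (ord4P i) => ->; case: (ord4P j) => -> //= _; rewrite // dotC.
Qed.

(** Conjugation by an improper [Q] reverses the sense of the turn, and passing to the inverse
    restores it. *)
Lemma rot_conj_symm W Q (P : 'M[R]_3) v s : finite_set W -> symm W Q -> symm W P ->
  s ^+ 2 = 3 / 4 -> dot v v = 1 -> is_rot P v (- 2^-1) s ->
  exists2 P', symm W P' & is_rot P' (v *m Q) (- 2^-1) s.
Proof.
move=> fW sQ sP ss vv h; have [hQ _] := sQ; have [hP _] := sP.
have sB : symm W (Q^T *m P *m Q) by do 2!apply: symmM => //; exact: symmT.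
have Cs : (- 2^-1) ^+ 2 + s ^+ 2 = 1 by rewrite ss; field.
case: (det_orth hQ) => dQ.
  exists (Q^T *m P *m Q) => // x.
  by rewrite !mulmxA h -rot_orth // orthmKV.
have hB : is_rot (Q^T *m P *m Q) (v *m Q) (- 2^-1) (- s).
  move=> x; have hN := orthmN hQ.
  have -> : Q^T *m P *m Q = (- Q)^T *m P *m (- Q).
    have -> : (- Q)^T = - Q^T by apply/matrixP => i j; rewrite !mxE.
    by rewrite !(mulmxN, mulNmx) opprK.
  rewrite !mulmxA h -rot_orth // orthmKV // mulmxN.
  by rewrite -[LHS]rotN opprK.
exists (Q^T *m P *m Q)^T; first exact: symmT.
have Cs' : (- 2^-1) ^+ 2 + (- s) ^+ 2 = 1 by rewrite (sqrrN s).
have vQ : dot (v *m Q) (v *m Q) = 1 by rewrite dot_orth.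
by have := is_rotT sB.1 vQ Cs' hB; rewrite opprK.
Qed.

(** A third turn about another member [a k] permutes the remaining three cyclically, so it or its
    inverse carries [a j] to [a i]. *)
Lemma frame_swap W a s (i j : 'I_4) : finite_set W -> s ^+ 2 = 3 / 4 ->
  tetra_frame a ->
  (forall i, exists2 Q, symm W Q & is_rot Q (a i) (- 2^-1) s) ->
  i != j -> exists2 Q, symm W Q & a j *m Q = a i.
Proof.
move=> fW ss fa hp ij; have [f1 f2] := fa.
have s0 : s != 0 by rewrite -sqrf_eq0 ss mulf_neq0 ?invr_neq0 // pnatr_eq0.
have Cs : (- 2^-1) ^+ 2 + s ^+ 2 = 1 by rewrite ss; field.
have [k [l un]] : exists k l : 'I_4, uniq [:: k; j; i; l].
  by move: ij; case: (ord4P i) => ->; case: (ord4P j) => -> // _;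
  [exists 2, 3|exists 1, 3|exists 1, 2|exists 2, 3|exists 0, 3|exists 0, 2|
   exists 1, 3|exists 0, 3|exists 0, 1|exists 1, 2|exists 0, 2|exists 0, 1].
have [/= kj kl jl] : [/\ k != j, k != l & j != l].
  by move: un; rewrite /= !inE !negb_or => /and4P[/and3P[? ? ?] /andP[? ?] _ _].
have [Q sQ h] := hp k.
have sQT : symm W Q^T by apply: symmT.
have hT : is_rot Q^T (a k) (- 2^-1) (- s) := is_rotT sQ.1 (f1 k) Cs h.
have dk C s' : dot (a k) (rot (a k) C s' (a j)) = - 3^-1.
  by rewrite rot_dot_axis // f2.
have dj s' : dot (a j) (rot (a k) (- 2^-1) s' (a j)) = - 3^-1.
  by rewrite rot_self // f1 f2 //; field.
have [|e|e1] := frame_complete fa un _ (dk (- 2^-1) s) (dj s).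
- by rewrite -h dot_orth ?f1 //; exact: sQ.1.
- by exists Q => //; rewrite h.
have [|e|e2] := frame_complete fa un _ (dk (- 2^-1) (- s)) (dj (- s)).
- by rewrite -hT dot_orth ?f1 //; exact: sQT.1.
- by exists Q^T => //; rewrite hT.
(* If both turns led to [a l], the two images of [a j] would coincide, which puts [a j] on the
   axis. *)
exfalso; have /eqP : (2 * s) *: cross (a k) (a j) = 0.
  rewrite -(subrr (a l)) -{1}e1 -e2 /rot.
  by apply: vec3P; rewrite !coordE; ring.
rewrite scaler_eq0 mulf_eq0 pnatr_eq0 (negPf s0) /= => /eqP c0.
have := dot_cross (a k) (a j); rewrite c0 dot0l !f1 f2 //; lra.
Qed.

(** If neither the frame nor its negative gives four facets, some [a i] and some [- a j] are
    vertices. Moving the latter to [- a i] gives an antipodal pair, and transitivity carries both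
    the antipode and the third turn to every vertex. *)
Lemma irreducible_dirs W : finite_set W -> full W ->
  (forall w, W w -> dot w w = 1) ->
  (forall v w, W v -> W w -> exists2 Q, symm W Q & v *m Q = w) ->
  irreducible_group (rotations W) ->
  tetra_dirs W \/
  (forall x, W x -> W (- x)) /\ (exists2 s, s ^+ 2 = 3 / 4 &
    forall v w, W v -> W w -> W (rot v (- 2^-1) s w)).
Proof.
move=> finW fW W1 tr irr; have hH := rotations_group finW fW.
have [s [u [w [ss hu hw uw]]]] := irreducible_tetrahedral hH irr.
have s0 : s != 0 by rewrite -sqrf_eq0 ss mulf_neq0 ?invr_neq0 // pnatr_eq0.
have [||a [fa ha _ _]] := @tetra_frame_pair (poles (rotations W) (- 2^-1) s) s u w
  ss hu.1 hw.1 uw _ _ hu hw.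
- by move=> x [].
- by move=> x y; apply: poles_rot.
have hp i : exists2 Q, symm W Q & is_rot Q (a i) (- 2^-1) s.
  exact: poles_symm (ha i).
have W0 := full_nonempty fW.
have vert u' Q s' : dot u' u' = 1 -> symm W Q -> is_rot Q u' (- 2^-1) s' ->
    s' != 0 -> (exists k, facet W u' k) \/ W u'.
  move=> uu sQ h s'0.
  case: (third_turn_face finW W0 uu sQ h s'0) => [|[k Wk hk]]; first by left.
  right; have := W1 _ Wk; rewrite dotZl dotZr uu mulr1 => /eqP.
  rewrite -expr2 -(expr1n _ 2) eqf_sqr => /orP[]/eqP k1.
    by move: Wk; rewrite k1 scale1r.
  (* A maximum of -1 is also the minimum by Cauchy-Schwarz, so [u'] would be constant on [W]. *)
  exfalso; have : u' != 0 by rewrite -dot_eq0 uu oner_eq0.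
  move/eqP; apply; apply: (fW u' (-1)) => x Wx.
  have := hk _ Wx; rewrite k1 => le; apply: le_anti; rewrite le /=.
  have := cauchy_schwarz u' x; rewrite uu W1 // mulr1 => cs.
  by nra.
have [hpos|nhpos] := pselect (forall i, exists k, facet W (a i) k).
  by left; have [k hk] := choice hpos; exists a, k.
have [hneg|nhneg] := pselect (forall i, exists k, facet W (- a i) k).
  left; have [k hk] := choice hneg; exists (fun i => - a i), k; split=> //.
  by split=> [i|i j ij]; rewrite dotNl dotNr opprK; [exact: fa.1|exact: fa.2].
have [i Wi] : exists i, W (a i).
  apply: contrapT => h; apply: nhpos => i.
  have [Q sQ hQ] := hp i.
  by case: (vert _ _ _ (fa.1 i) sQ hQ s0) => // Wi; exfalso; apply: h; exists i.
have [j Wj] : exists j, W (- a j).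
  apply: contrapT => h; apply: nhneg => j.
  have [Q sQ hQ] := hp j.
  have hQ' : is_rot Q (- a j) (- 2^-1) (- s) by move=> x; rewrite rotN.
  have nn : dot (- a j) (- a j) = 1 by rewrite dotNl dotNr opprK fa.1.
  case: (vert _ _ _ nn sQ hQ') => //; first by rewrite oppr_eq0.
  by move=> Wj; exfalso; apply: h; exists j.
right; split.
  have Wni : W (- a i).
    have [->//|ij] := eqVneq i j.
    have [Q [_ sQ] <-] := frame_swap finW ss fa hp ij.
    by rewrite -mulNmx; apply: sQ.
  move=> x Wx; have [Q [_ sQ] <-] := tr _ _ Wi Wx.
  by rewrite -mulNmx; apply: sQ.
exists s => // v x Wv Wx.
have [Q sQ <-] := tr _ _ Wi Wv; have [P sP hP] := hp i.
have [P' [_ sP'] hP'] := rot_conj_symm finW sQ sP ss (fa.1 i) hP.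
by rewrite -hP'; apply: sP'.
Qed.

End SymmetryGroup.

(** * Vertex sets closed under their own third turns: cube and dodecahedron *)

Section CubeDodecahedron.
Variable R : realType.
Local Notation point := 'rV[R]_3.
Local Notation similar := Defs.similar.
Implicit Types (u v w x y z p q r t : point) (c C s : R) (P W : set point).
Implicit Types (Q : 'M[R]_3) (a : 'I_4 -> point).

Lemma similar_conv A B : similar A B ->
  similar (conv_hull A : set point) (conv_hull B).
Proof.
move=> /similarP[c [Q [t [c0 hQ <-]]]]; apply/similarP; exists c, Q, t.
by rewrite conv_hull_aff // gt_eqF.
Qed.

Lemma cross_orth_sign Q : orthm Q -> exists2 e : R, e ^+ 2 = 1 &
  forall u v, cross (u *m Q) (v *m Q) = e *: (cross u v *m Q).
Proof.
move=> hQ; case: (det_orth hQ) => d.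
  by exists 1 => [|u v]; rewrite ?expr1n // scale1r cross_orth.
exists (-1) => [|u v]; first by rewrite sqrrN expr1n.
rewrite scaleN1r -mulmxN -cross_orth //; last exact: orthmN.
by rewrite !mulmxN; apply: vec3P; rewrite !coordE; ring.
Qed.

(** The value at 0 is 1, so that the signs of the coordinates always form a vertex of the cube. *)
Definition sgn1 (k : R) : R := if 0 <= k then 1 else -1.

Lemma sgn1_norm k : `|sgn1 k| = 1.
Proof. by rewrite /sgn1; case: ifP; rewrite ?normrN normr1. Qed.

Lemma sgn1_mul k : k * sgn1 k = `|k|.
Proof. by rewrite /sgn1; case: (ger0P k); rewrite ?mulr1 // mulrN1. Qed.

Lemma abs1P (k : R) : `|k| = 1 -> k = 1 \/ k = -1.
Proof. by move=> h; case: (ler0P k) h => _ h; [right; rewrite -h opprK|left]. Qed.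

Lemma cube_tetra v : cube_vertices v ->
  exists i, v = tetra_vertex R i \/ v = - tetra_vertex R i.
Proof.
move=> h; have h0 := abs1P (h 0); have h1 := abs1P (h 1).
have h2 := abs1P (h 2).
have go i : v 0 0 = tetra_vertex R i 0 0 -> v 0 1 = tetra_vertex R i 0 1 ->
    v 0 2 = tetra_vertex R i 0 2 ->
    exists i, v = tetra_vertex R i \/ v = - tetra_vertex R i.
  by move=> *; exists i; left; apply: vec3P.
have goN i : v 0 0 = - tetra_vertex R i 0 0 -> v 0 1 = - tetra_vertex R i 0 1 ->
    v 0 2 = - tetra_vertex R i 0 2 ->
    exists i, v = tetra_vertex R i \/ v = - tetra_vertex R i.
  by move=> *; exists i; right; apply: vec3P; rewrite oppE.
case: h0 => h0; case: h1 => h1; case: h2 => h2.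
- by apply: (go 0); rewrite /tetra_vertex /= !vec3E.
- by apply: (goN 3); rewrite /tetra_vertex /= !vec3E ?opprK.
- by apply: (goN 2); rewrite /tetra_vertex /= !vec3E ?opprK.
- by apply: (go 1); rewrite /tetra_vertex /= !vec3E.
- by apply: (goN 1); rewrite /tetra_vertex /= !vec3E ?opprK.
- by apply: (go 2); rewrite /tetra_vertex /= !vec3E.
- by apply: (go 3); rewrite /tetra_vertex /= !vec3E.
- by apply: (goN 0); rewrite /tetra_vertex /= !vec3E ?opprK.
Qed.

Lemma dot_self p : dot p p = `|p 0 0| ^+ 2 + `|p 0 1| ^+ 2 + `|p 0 2| ^+ 2.
Proof. by rewrite dotE !real_normK ?num_real // !expr2. Qed.

(* tc_turn is Rodrigues' formula for the third turns about v, of norm sqrt 3. *)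
Record third_turn_closed (D : set point) : Prop := ThirdTurnClosed {
  tc_norm : forall x, D x -> dot x x = 3;
  tc_opp : forall x, D x -> D (- x);
  tc_turn : forall v w (e : R), D v -> D w -> e ^+ 2 = 1 / 4 ->
    D ((- 2^-1) *: w + e *: cross v w + (2^-1 * dot v w) *: v) }.

(** The eight vertices leave no room: the product of [p] with the vertex of the same signs is the
    sum of its absolute coordinates, which exceeds 1. *)
Lemma cube_identified (D : set point) : third_turn_closed D ->
  (forall i, D (tetra_vertex R i)) ->
  (forall p q, D p -> D q -> p != q -> dot p q <= 1) ->
  D = @cube_vertices R.
Proof.
move=> [D3 Dn _] Dt Dm.
have cD : @cube_vertices R `<=` D.
  by move=> v /cube_tetra[i [->|->]]; rewrite //; exact: Dn.
apply/seteqP; split=> // p Dp.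
pose q : point := vec3 (sgn1 (p 0 0)) (sgn1 (p 0 1)) (sgn1 (p 0 2)).
have cq : cube_vertices q.
  by move=> i; case: (ord3P i) => ->; rewrite vec3E sgn1_norm.
have [->//|pq] := eqVneq p q.
have := Dm _ _ Dp (cD _ cq) pq; have := D3 _ Dp.
rewrite dot_self dotE !vec3E !sgn1_mul.
have := normr_ge0 (p 0 0); have := normr_ge0 (p 0 1).
have := normr_ge0 (p 0 2); nra.
Qed.

Lemma golden_gt32 : 3 / 2 < golden R.
Proof.
rewrite /golden ltr_pM2r ?invr_gt0 //.
suff : 2 < Num.sqrt 5 :> R by lra.
rewrite -[X in X < _]gtr0_norm // -sqrtr_sqr ltr_sqrt //.
by rewrite expr2 -natrM ltr_nat.
Qed.

Lemma golden_lt2 : golden R < 2.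
Proof. by have := sqr_golden R; have := golden_gt1 R; nra. Qed.

(** Every point of the sphere of squared radius 3 has a product above [2 * g - 1], the square root
    of 5, with some vertex of the dodecahedron; in one octant four vertices suffice. *)
Lemma dodecahedron_covering (X Y Z : R) (g := golden R) : 0 <= X -> 0 <= Y ->
  0 <= Z -> X ^+ 2 + Y ^+ 2 + Z ^+ 2 = 3 -> X + Y + Z <= 2 * g - 1 ->
  (g - 1) * Y + g * Z <= 2 * g - 1 -> (g - 1) * Z + g * X <= 2 * g - 1 ->
  (g - 1) * X + g * Y <= 2 * g - 1 -> False.
Proof.
have gg : g * g = g + 1 := sqr_golden R.
have g1 : 3 / 2 < g := golden_gt32; have g2 : g < 2 := golden_lt2.
clearbody g => X0 Y0 Z0 n3 hs h1 h2 h3.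
(* Weighted by the coordinates, the three bounds add up to an inequality in the sum [s] alone. *)
have e1 : Z * ((g - 1) * Y + g * Z) <= Z * (2 * g - 1) by rewrite ler_wpM2l.
have e2 : X * ((g - 1) * Z + g * X) <= X * (2 * g - 1) by rewrite ler_wpM2l.
have e3 : Y * ((g - 1) * X + g * Y) <= Y * (2 * g - 1) by rewrite ler_wpM2l.
set s := X + Y + Z in hs.
have s0 : 0 <= s by rewrite !addr_ge0.
have f : 3 * g + (g - 1) * (s ^+ 2 - 3) / 2 <= (2 * g - 1) * s.
  have -> : s ^+ 2 - 3 = 2 * (X * Y + Y * Z + Z * X).
    by rewrite /s -n3; ring.
  have : g * (X ^+ 2 + Y ^+ 2 + Z ^+ 2) = 3 * g by rewrite n3; ring.
  by rewrite /s; lra.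
clearbody s; pose r := 2 * g - 1.
have rr : r ^+ 2 = 5 by rewrite /r; lra.
(* The function [r * s - (g - 1) * s ^+ 2 / 2] increases up to [s = r], where the bound [f] would
   give [g <= 3 / 2]. *)
have : 0 <= (r - s) * (r - (g - 1) * (s + r) / 2).
  rewrite mulr_ge0 // ?subr_ge0 // /r; nra.
have -> : (r - s) * (r - (g - 1) * (s + r) / 2) =
  r ^+ 2 - r * s - (g - 1) * (r ^+ 2 - s ^+ 2) / 2 by ring.
rewrite rr /r; nra.
Qed.

Lemma dodecahedron_vertexP v : dodecahedron_vertices v <->
  cube_vertices v \/ exists i : 'I_3, [/\ v 0 i = 0,
    `|v 0 (i + 1)| = golden R - 1 & `|v 0 (i + 2)| = golden R].
Proof.
rewrite /dodecahedron_vertices golden_inv; by split=> -[]; [left|right|left|right].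
Qed.

Lemma norm_cases (k l : R) : 0 <= l -> `|k| = l -> k = l \/ k = - l.
Proof.
by move=> l0; case: (ger0P k) => _ <-; [left|right; rewrite opprK].
Qed.

(** Third turns about cube vertices permute the coordinates cyclically with signs; together with the
    antipodes they generate from one vertex off the cube the other eleven, and the covering property
    excludes further points. *)
Lemma dodecahedron_identified (D : set point) : third_turn_closed D ->
  (forall i, D (tetra_vertex R i)) ->
  (forall p q, D p -> D q -> p != q -> dot p q <= 2 * golden R - 1) ->
  D (vec3 0 (golden R - 1) (golden R)) -> D = @dodecahedron_vertices R.
Proof.
move=> [D3 Dn Dr] Dt Dm Dg.
have q4 : (2^-1) ^+ 2 = 1 / 4 :> R by field.
have q4N : (- 2^-1) ^+ 2 = 1 / 4 :> R by field.
have D_eq x y : D x -> x 0 0 = y 0 0 -> x 0 1 = y 0 1 -> x 0 2 = y 0 2 -> D y.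
  by move=> Dx h0 h1 h2; have <- : x = y by apply: vec3P.
have cyc x : D x -> D (vec3 (x 0 2) (x 0 0) (x 0 1)).
  move=> Dx; apply: (D_eq _ _ (Dr _ _ _ (Dt 0) Dx q4));
  by rewrite /tetra_vertex /= !coordE; field.
have flip0 x : D x -> D (vec3 (- x 0 2) (- x 0 0) (x 0 1)).
  move=> Dx; apply: (D_eq _ _ (Dr _ _ _ (Dt 1) Dx q4));
  by rewrite /tetra_vertex /= !coordE; field.
have flip1 x : D x -> D (vec3 (x 0 0) (- x 0 1) (x 0 2)).
  move=> Dx; apply: (D_eq _ _ (Dn _ (cyc _ (cyc _ (flip0 _ Dx)))));
  by rewrite !coordE ?opprK.
have flip2 x : D x -> D (vec3 (x 0 0) (x 0 1) (- x 0 2)).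
  move=> Dx; apply: (D_eq _ _ (cyc _ (flip1 _ (cyc _ (cyc _ Dx)))));
  by rewrite !vec3E.
have g1 := golden_gt1 R.
have Dg' (k l : R) : `|k| = golden R - 1 -> `|l| = golden R ->
    D (vec3 0 k l).
  move=> /norm_cases hk /norm_cases hl.
  have [||->] := hk; first by lra.
    move=> ->; have [||->] := hl; [lra|by move=> ->|].
    by apply: (D_eq _ _ (flip2 _ Dg)); rewrite !vec3E.
  have [||->] := hl; first by lra.
    by move=> ->; apply: (D_eq _ _ (flip1 _ Dg)); rewrite !vec3E.
  by apply: (D_eq _ _ (flip2 _ (flip1 _ Dg))); rewrite !vec3E.
have dD : @dodecahedron_vertices R `<=` D.
  move=> v /dodecahedron_vertexP[/cube_tetra[i [->|->]]|[i [h0 h1 h2]]].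
  - exact: Dt.
  - exact/Dn/Dt.
  move: h0 h1 h2; case: (ord3P i) => ->.
  - move=> h0 h1 h2; apply: (D_eq _ _ (Dg' _ _ h1 h2)); rewrite !vec3E //;
      congr (v _ _); exact: val_inj.
  - move=> h0 h1 h2; apply: (D_eq _ _ (cyc _ (Dg' _ _ h1 h2))); rewrite !vec3E //;
      congr (v _ _); exact: val_inj.
  - move=> h0 h1 h2; apply: (D_eq _ _ (cyc _ (cyc _ (Dg' _ _ h1 h2))));
      rewrite !vec3E //; congr (v _ _); exact: val_inj.
apply/seteqP; split=> // p Dp; apply: contrapT => np.
have bound q : dodecahedron_vertices q -> dot p q <= 2 * golden R - 1.
  by move=> dq; apply: Dm => //; [exact: dD|apply/eqP => e; apply: np; rewrite e].
have gn : `|golden R| = golden R by rewrite ger0_norm //; lra.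
have gn1 : `|golden R - 1| = golden R - 1 by rewrite ger0_norm //; lra.
have nsg (k l : R) : `|k * sgn1 l| = `|k| by rewrite normrM sgn1_norm mulr1.
have o (i j k : 'I_3) : val (i + j) = val k -> p 0 (i + j) = p 0 k.
  by move=> e; congr (p _ _); apply: val_inj.
have ov (q : point) (i j k : 'I_3) : val (i + j) = val k -> q 0 (i + j) = q 0 k.
  by move=> e; congr (q _ _); apply: val_inj.
apply: (@dodecahedron_covering `|p 0 0| `|p 0 1| `|p 0 2|) => //.
- by rewrite -dot_self D3.
- have := bound (vec3 (sgn1 (p 0 0)) (sgn1 (p 0 1)) (sgn1 (p 0 2))).
  rewrite dotE !vec3E !sgn1_mul; apply.
  apply/dodecahedron_vertexP; left=> i.
  by case: (ord3P i) => ->; rewrite vec3E sgn1_norm.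
- have := bound (vec3 0 ((golden R - 1) * sgn1 (p 0 1)) (golden R * sgn1 (p 0 2))).
  rewrite dotE !vec3E mulr0 add0r !(mulrCA (p _ _)) !sgn1_mul; apply.
  apply/dodecahedron_vertexP; right; exists 0.
  by rewrite (ov _ 0 1 1) // (ov _ 0 2 2) // !vec3E !nsg gn gn1.
- have := bound (vec3 (golden R * sgn1 (p 0 0)) 0 ((golden R - 1) * sgn1 (p 0 2))).
  rewrite dotE !vec3E mulr0 addr0 !(mulrCA (p _ _)) !sgn1_mul.
  rewrite (addrC (golden R * _)); apply.
  apply/dodecahedron_vertexP; right; exists 1.
  by rewrite (ov _ 1 1 2) // (ov _ 1 2 0) // !vec3E !nsg gn gn1.
- have := bound (vec3 ((golden R - 1) * sgn1 (p 0 0)) (golden R * sgn1 (p 0 1)) 0).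
  rewrite dotE !vec3E mulr0 addr0 !(mulrCA (p _ _)) !sgn1_mul; apply.
  apply/dodecahedron_vertexP; right; exists 2.
  by rewrite (ov _ 2 1 0) // (ov _ 2 2 1) // !vec3E !nsg gn gn1.
Qed.

(** An improper [Q] changes the sign of cross products, so the closure is first extended to both
    senses of turn; the backward turn is the forward one done twice. *)
Lemma rescale_closed W Q s : (forall x, W x -> dot x x = 1) ->
  (forall x, W x -> W (- x)) -> s ^+ 2 = 3 / 4 ->
  (forall v w, W v -> W w -> W (rot v (- 2^-1) s w)) -> orthm Q ->
  third_turn_closed (aff (Num.sqrt 3) Q 0 @` W).
Proof.
move=> W1 Wn ss Wr hQ; have s3 := sqr_sqrt3 R; have s30 := sqrt3_neq0 R.
have e3 x : aff (Num.sqrt 3) Q 0 x = Num.sqrt 3 *: (x *m Q).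
  by rewrite /aff addr0.
split.
- by move=> _ [x Wx <-]; rewrite e3 dotZl dotZr dot_orth // W1 // mulr1 s3.
- move=> _ [x Wx <-]; exists (- x); first exact: Wn.
  by rewrite !e3 mulNmx scalerN.
have Wr' v w : W v -> W w -> W (rot v (- 2^-1) (- s) w).
  move=> Wv Ww; have [e1 e2] := third_turn_eq ss.
  have := Wr _ _ Wv (Wr _ _ Wv Ww).
  by rewrite rot_comp ?W1 // e1 e2.
move=> _ _ e [v Wv <-] [w Ww <-] e2.
have [d d1 hd] := cross_orth_sign hQ.
have [s' Ws' es'] : exists2 s', forall v w, W v -> W w -> W (rot v (- 2^-1) s' w)
   & e * Num.sqrt 3 = s' * d.
  have : (e * Num.sqrt 3) ^+ 2 = (s * d) ^+ 2.
    by rewrite !exprMn d1 e2 ss expr2 s3; field.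
  move/eqP; rewrite eqf_sqr => /orP[]/eqP h; first by exists s.
  by exists (- s) => //; rewrite h mulNr.
exists (rot v (- 2^-1) (s' * d ^+ 2) w); first by rewrite d1 mulr1; exact: Ws'.
have -> : s' * d ^+ 2 = e * Num.sqrt 3 * d by rewrite es'; ring.
have -> : cross (aff (Num.sqrt 3) Q 0 v) (aff (Num.sqrt 3) Q 0 w) =
    (3 * d) *: (cross v w *m Q).
  rewrite !e3 -(scalerA 3) -hd.
  transitivity ((Num.sqrt 3 * Num.sqrt 3) *: cross (v *m Q) (w *m Q));
    last by rewrite s3.
  by apply: vec3P; rewrite !coordE; ring.
rewrite !e3 !dotZl !dotZr dot_orth // /rot !mulmxDl -!scalemxAl.
have -> (k : R) : 2^-1 * (Num.sqrt 3 * (Num.sqrt 3 * k)) = 3 / 2 * k.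
  by rewrite (mulrA (Num.sqrt 3)) s3; field.
rewrite !scalerDr !scalerA; congr (_ *: _ + _ *: _ + _ *: _).
- by rewrite mulrC.
- transitivity (Num.sqrt 3 * Num.sqrt 3 * e * d); first by ring.
  by rewrite s3; ring.
- by field.
Qed.

(** The closest-pair argument is applied to [W] itself, whose points serve as axes for one
    another. *)
Lemma third_turn_solids W s : finite_set W -> full W ->
  (forall x, W x -> dot x x = 1) -> (forall x, W x -> W (- x)) ->
  s ^+ 2 = 3 / 4 -> (forall v w, W v -> W w -> W (rot v (- 2^-1) s w)) ->
  similar W (@cube_vertices R) \/ similar W (@dodecahedron_vertices R).
Proof.
move=> finW fW W1 Wn ss Wr; have s3 := sqr_sqrt3 R; have s30 := sqrt3_neq0 R.
have s3p : 0 < Num.sqrt 3 :> R by rewrite sqrtr_gt0.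
have [x [y [z [Wx Wy Wz d0]]]] := full_basis fW.
have [||v0 [v1 [W0 W01 c0 c1 cmax]]] := closest_pair finW W1 Wx Wy.
- apply/eqP => e; move: d0; rewrite e crossvv dot0l; exact/negP/negPn.
- apply/eqP => e; move: d0; rewrite e.
  have -> : cross x (- x) = 0 by apply: vec3P; rewrite !coordE; ring.
  by rewrite dot0l eqxx.
(* The pair [v0], [- v1] obeys the same maximality, which excludes the cosine -1/3. *)
have cge0 : 0 <= dot v0 v1.
  have n0 : v0 != v1 by apply/eqP => e; move: c1; rewrite e W1 // ltxx.
  have n1 : v0 != - v1.
    by apply/eqP => e; move: c0; rewrite e dotNl W1 // ltxx.
  by have := cmax _ _ W0 (Wn _ W01) n1; rewrite dotNr; lra.
pose v2 := rot v1 (- 2^-1) s v0.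
have W2 : W v2 by apply: Wr.
have d12 : dot v1 v2 = dot v0 v1 by rewrite rot_dot_axis ?W1 // dotC.
have d02 : dot v0 v2 = - 2^-1 + (1 + 2^-1) * dot v0 v1 ^+ 2.
  by rewrite rot_self ?W1 // (dotC v1); field.
have setup u w : W u -> W w -> dot u w = - 3^-1 -> exists2 Q, orthm Q &
    [/\ similar W (aff (Num.sqrt 3) Q 0 @` W),
      third_turn_closed (aff (Num.sqrt 3) Q 0 @` W),
      forall i, (aff (Num.sqrt 3) Q 0 @` W) (tetra_vertex R i),
      aff (Num.sqrt 3) Q 0 u = tetra_vertex R 0 &
      aff (Num.sqrt 3) Q 0 w = tetra_vertex R 1].
  move=> Wu Ww uw.
  have [a [fa Wa a0 a1]] :=
    tetra_frame_pair ss (W1 _ Wu) (W1 _ Ww) uw W1 Wr Wu Ww.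
  have [Q hQ e] := tetra_frame_std fa.
  have eT i : aff (Num.sqrt 3) Q^T 0 (a i) = tetra_vertex R i.
    by rewrite /aff addr0 scalemxAl -e orthmK.
  exists Q^T; first exact: orthmT.
  split; rewrite -?a0 -?a1 //.
  - by apply/similarP; exists (Num.sqrt 3), Q^T, 0; split=> //; exact: orthmT.
  - by apply: rescale_closed Wr _ => //; exact: orthmT.
  - by move=> i; exists (a i).
have dotaff Q p q : orthm Q ->
    dot (aff (Num.sqrt 3) Q 0 p) (aff (Num.sqrt 3) Q 0 q) = 3 * dot p q.
  by move=> hQ; rewrite /aff !addr0 dotZl dotZr dot_orth // mulrA s3.
have maxaff Q : orthm Q -> forall p q, (aff (Num.sqrt 3) Q 0 @` W) p ->
    (aff (Num.sqrt 3) Q 0 @` W) q -> p != q -> dot p q <= 3 * dot v0 v1.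
  move=> hQ _ _ [p Wp <-] [q Wq <-] pq; rewrite dotaff // ler_pM2l // cmax //.
  by apply: contra pq => /eqP ->.
case: (pole_gap3 W1 Wr ss W0 W01 erefl c0 c1 cmax) => c.
- by exfalso; move: cge0; rewrite c; lra.
- left; have [|Q hQ [sim tc Dt _ _]] := setup v0 v2 W0 W2.
    by rewrite d02 c; field.
  rewrite -(cube_identified tc Dt) // => p q Dp Dq pq.
  by have := maxaff Q hQ p q Dp Dq pq; rewrite c; lra.
- right; have c9 : 9 * dot v0 v1 ^+ 2 = 5 by rewrite -(sqr_sqrt5 R) -c; ring.
  have [|Q hQ [sim tc Dt e0 e1]] := setup v0 (- v2) W0 (Wn _ W2).
    by rewrite dotNr d02; lra.
  have m5 p q : (aff (Num.sqrt 3) Q 0 @` W) p ->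
      (aff (Num.sqrt 3) Q 0 @` W) q -> p != q -> dot p q <= 2 * golden R - 1.
    by move=> Dp Dq /(maxaff _ hQ _ _ Dp Dq); rewrite c sqrt5_golden.
  set D := _ @` W in sim tc Dt m5.
  (* The products of [v] with two cube vertices leave [v = (0, y, z)] with [y + z = sqrt 5]; as the
     squared norm is 3, [y] is [golden R] or [golden R - 1]. *)
  pose v := aff (Num.sqrt 3) Q 0 v1.
  have Dv : D v by exists v1.
  have f0 : dot v (tetra_vertex R 0) = Num.sqrt 5 by rewrite -e0 dotaff // dotC.
  have f1 : dot v (tetra_vertex R 1) = - Num.sqrt 5.
    by rewrite -e1 dotaff // dotNr d12 mulrN c.
  have vv : dot v v = 3 by apply: (tc_norm tc).
  clearbody v.
  have s5 := sqr_sqrt5 R; have g5 := sqrt5_golden R.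
  move: f0 f1 vv; rewrite /tetra_vertex /= !coordE !(mulr1, mulrN1) => f0 f1 vv.
  have x0 : v 0 0 = 0 by lra.
  rewrite x0 !add0r mul0r add0r in f0 f1 vv.
  have e12 : (v 0 1 - golden R) * (v 0 1 - (golden R - 1)) = 0.
    have ez : v 0 2 = Num.sqrt 5 - v 0 1 by lra.
    rewrite ez in vv; have := sqr_golden R; rewrite g5 in s5 vv ez.
    nra.
  have tov p q : p 0 0 = q 0 0 -> p 0 1 = q 0 1 -> p 0 2 = q 0 2 ->
      D p -> D q.
    by move=> h0 h1 h2; have <- : p = q by apply: vec3P.
  move/eqP: e12; rewrite mulf_eq0 !subr_eq0 => /orP[]/eqP ey; last first.
    rewrite -(dodecahedron_identified tc Dt m5) //.
    by apply: tov Dv; rewrite !vec3E //; lra.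
  (* In this case [D] is the second dodecahedron around the same cube; exchanging two coordinates
     carries it to the standard one. *)
  pose S : 'M[R]_3 := mat3 (vec3 1 0 0) (vec3 0 0 1) (vec3 0 1 0).
  have hS : orthm S.
    by apply: orthm_mat3; split; split; rewrite !coordE; ring.
  have SE p : aff 1 S 0 p = vec3 (p 0 0) (p 0 2) (p 0 1).
    by rewrite /aff scale1r addr0 mat3E; apply: vec3P; rewrite !coordE; ring.
  have simS : similar D (aff 1 S 0 @` D) by apply/similarP; exists 1, S, 0.
  rewrite -(@dodecahedron_identified (aff 1 S 0 @` D)).
  + exact: similar_trans simS.
  + split.
    * move=> _ [w Dw <-]; rewrite -(tc_norm tc Dw) SE !coordE; ring.
    * move=> _ [w Dw <-]; exists (- w); first exact: (tc_opp tc).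
      by rewrite !SE; apply: vec3P; rewrite !coordE.
    * move=> _ _ e [w Dw <-] [w' Dw' <-] e4.
      exists ((- 2^-1) *: w' + (- e) *: cross w w' + (2^-1 * dot w w') *: w).
        by apply: (tc_turn tc) => //; rewrite sqrrN.
      by rewrite !SE; apply: vec3P; rewrite !coordE; ring.
  + move=> i; have [j ej] : exists j, tetra_vertex R i = aff 1 S 0 (tetra_vertex R j).
      case: (ord4P i) => ->; [exists 0|exists 1|exists 3|exists 2];
      by rewrite SE /tetra_vertex /=; apply: vec3P; rewrite !vec3E.
    by rewrite ej; apply: imageP.
  + move=> _ _ [p Dp <-] [q Dq <-] pq.
    have -> : dot (aff 1 S 0 p) (aff 1 S 0 q) = dot p q.
      by rewrite !SE !coordE; ring.
    by apply: m5 => //; apply: contra pq => /eqP ->.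
  + exists v => //; rewrite SE; apply: vec3P; rewrite !vec3E //; lra.
Qed.

End CubeDodecahedron.

(** * Angles on the circle and regular polygons *)

Section Angles.
Variable R : realType.
Implicit Types (x y t d : R) (K : set R).

Lemma int_quotient d x : 0 < d -> exists2 j : int,
  0 <= x - j%:~R * d & x - j%:~R * d < d.
Proof.
move=> d0; exists (Num.floor (x / d)).
  by rewrite subr_ge0 -ler_pdivlMr // floor_le_tmp.
have := floorD1_gt (x / d); rewrite ltr_pdivrMr // intrD mulrDl mul1r; lra.
Qed.

Lemma cos_period x (j : int) : cos (x + j%:~R * (2 * pi)) = cos x.
Proof.
have cn (n : nat) y : cos (y + n%:R * (2 * pi)) = cos y.
  have -> : n%:R * (2 * pi) = pi *+ 2 *+ n :> R.
    by rewrite -[RHS]mulr_natl -[pi *+ 2]mulr_natl.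
  exact: (periodicn (@cosD2pi R)).
case: j => n; first exact: cn.
rewrite NegzE mulrNz mulNr.
by rewrite -[X in _ = cos X](subrK (n.+1%:R * (2 * pi))) cn.
Qed.

Lemma sin_period x (j : int) : sin (x + j%:~R * (2 * pi)) = sin x.
Proof. by rewrite -!cosBpihalf -[RHS](cos_period _ j); congr cos; ring. Qed.

Lemma ler_cos x y : 0 <= x -> x <= y -> y <= pi -> cos y <= cos x.
Proof.
move=> x0 xy ypi.
have hx : x \in `[0, pi] by rewrite in_itv /= x0 (le_trans xy).
have hy : y \in `[0, pi] by rewrite in_itv /= (le_trans x0 xy).
by rewrite leNgt (ltr_cos hy hx) -leNgt.
Qed.

Lemma cos_inj0pi x y : 0 <= x -> x <= pi -> 0 <= y -> y <= pi ->
  cos x = cos y -> x = y.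
Proof. by move=> *; apply: cos_inj; rewrite ?in_itv //=; apply/andP. Qed.

Lemma cos_2piB x : cos (2 * pi - x) = cos x.
Proof. by rewrite -cosN -[RHS](cos_period x (-1)); congr cos; ring. Qed.

Lemma cos_eq_2pi x y : 0 <= x -> x <= 2 * pi -> 0 <= y -> y <= 2 * pi ->
  cos x = cos y -> x = y \/ x = 2 * pi - y.
Proof.
move=> x0 x2 y0 y2 e.
have [xp|xp] := lerP x pi; have [yp|yp] := lerP y pi.
- by left; apply: cos_inj0pi.
- by right; apply: cos_inj0pi; rewrite ?cos_2piB //; lra.
- right; have : 2 * pi - x = y by apply: cos_inj0pi; rewrite ?cos_2piB //; lra.
  lra.
- left; have : 2 * pi - x = 2 * pi - y.
    by apply: cos_inj0pi; rewrite ?cos_2piB //; lra.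
  lra.
Qed.

Lemma cos_arc a t : 0 <= a -> a <= pi -> a <= t -> t <= 2 * pi - a ->
  cos t <= cos a.
Proof.
move=> a0 ap h1 h2; have [tp|tp] := lerP t pi; first exact: ler_cos.
by rewrite -(cos_2piB t); apply: ler_cos; lra.
Qed.

Lemma cos_eq1 t : 0 <= t -> t < 2 * pi -> cos t = 1 -> t = 0.
Proof.
move=> t0 t2; have p0 := pi_gt0 R; rewrite -cos0 => /cos_eq_2pi.
by case=> //; lra.
Qed.

Lemma cos_sin_eq x y : cos x = cos y -> sin x = sin y ->
  exists j : int, y = x + j%:~R * (2 * pi).
Proof.
move=> ec es; have p0 := pi_gt0 R.
have [|j h1 h2] := @int_quotient (2 * pi) (y - x); first by rewrite mulr_gt0.
exists j; have /(cos_eq1 h1 h2) : cos (y - x - j%:~R * (2 * pi)) = 1.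
  rewrite -mulNr -mulrNz cos_period cosB ec es -!expr2.
  exact: cos2Dsin2.
lra.
Qed.

Lemma angle_exists x y : x ^+ 2 + y ^+ 2 = 1 -> exists t, x = cos t /\ y = sin t.
Proof.
move=> e; have x2 : x ^+ 2 <= 1 by rewrite -e lerDl sqr_ge0.
have h : -1 <= x <= 1.
  by rewrite -ler_norml -(@ler_pXn2r _ 2) ?nnegrE // real_normK ?num_real // expr1n.
have ca : cos (acos x) = x by apply: acosK; rewrite in_itv.
have sa : sin (acos x) ^+ 2 = y ^+ 2 by rewrite sin2cos2 ca -e; ring.
move/eqP: sa; rewrite eqf_sqr => /orP[]/eqP sa.
  by exists (acos x); rewrite ca sa.
by exists (- acos x); rewrite cosN sinN ca sa opprK.
Qed.

Definition is_gap K x t := [/\ 0 < t, K (x + t) &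
  forall u, 0 < u -> u < t -> ~ K (x + u)].

(** Along the direction of the middle of a gap, the points of [K] that reach furthest are the two
    ends of the gap: this makes a gap a side of the polygon. *)
Lemma gap_support K x g y : (forall x (j : int), K x -> K (x + j%:~R * (2 * pi))) ->
  K x -> is_gap K x g -> g <= 2 * pi -> K y ->
  cos (y - x - g / 2) <= cos (g / 2) /\
  (cos (y - x - g / 2) = cos (g / 2) -> exists j : int,
    y = x + j%:~R * (2 * pi) \/ y = x + g + j%:~R * (2 * pi)).
Proof.
move=> per Kx [g0 Kg gap] g2 Ky; have p0 := pi_gt0 R.
have [|j h1 h2] := @int_quotient (2 * pi) (y - x); first by rewrite mulr_gt0.
set t := y - x - _ in h1 h2.
have ey : y = x + t + j%:~R * (2 * pi) by rewrite /t; ring.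
have Kt : K (x + t).
  have -> : x + t = y + (- j)%:~R * (2 * pi) by rewrite mulrNz ey; ring.
  exact: per.
have ec : cos (y - x - g / 2) = cos (t - g / 2).
  by rewrite -(cos_period (t - g / 2) j) /t; congr cos; ring.
rewrite ec; have [t0|t0] := eqVneq t 0.
  rewrite t0 sub0r cosN; split=> // _; exists j; left.
  by rewrite ey t0 addr0.
have tp : 0 < t by rewrite lt_neqAle eq_sym t0.
have tg : g <= t by rewrite leNgt; apply/negP => /(gap _ tp).
split; first by apply: cos_arc; lra.
move=> /cos_eq_2pi []; [lra|lra|lra|lra| |].
  by move=> e; exists j; right; rewrite ey; lra.
by move=> e; exfalso; lra.
Qed.

(* All gaps have the same cosine and three consecutive ones fit in a full turn,
   so they are equal. *)
Lemma regular_angles K :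
  (forall x (j : int), K x -> K (x + j%:~R * (2 * pi))) ->
  (forall x, K x -> exists t, is_gap K x t) ->
  (forall x y s t, K x -> K y -> is_gap K x s -> is_gap K y t ->
    cos s = cos t) ->
  (forall x, K x -> exists s t, [/\ 0 < s, s < t, t < 2 * pi, K (x + s) &
    K (x + t)]) -> K !=set0 ->
  exists2 n : nat, (3 <= n)%N & forall x, K x ->
    is_gap K x (2 * pi / n%:R) /\
    forall y, K y <-> exists j : int, y = x + j%:~R * (2 * pi / n%:R).
Proof.
move=> per hgap hcos h3 [x0 K0]; have p0 := pi_gt0 R.
have ltpi x g : K x -> is_gap K x g -> g < pi.
  move=> Kx hg; have [g0 Kg gap] := hg.
  have [s [t [s0 st t2 Ks Kt]]] := h3 _ Kx.
  have gs : g <= s by rewrite leNgt; apply/negP => /(gap _ s0).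
  have [g' hg'] := hgap _ Kg; have [g'0 Kg' gap'] := hg'.
  have g't : g + g' <= t.
    rewrite leNgt; apply/negP => h; apply: (gap' (t - g)); [lra|lra|].
    by have -> : x + g + (t - g) = x + t by ring.
  have := hcos _ _ _ _ Kx Kg hg hg'.
  by move=> /cos_eq_2pi []; lra.
have [d hd0] := hgap _ K0; have [d0 _ _] := hd0.
have dpi := ltpi _ _ K0 hd0.
have gapd x : K x -> is_gap K x d.
  move=> Kx; have [g hg] := hgap _ Kx; have gpi := ltpi _ _ Kx hg.
  have [g0 _ _] := hg.
  suff -> : d = g by [].
  by apply: cos_inj0pi (hcos _ _ _ _ K0 Kx hd0 hg); apply: ltW.
have Kn x (m : nat) : K x -> K (x + m%:R * d).
  elim: m => [|m IH] Kx; first by rewrite mul0r addr0.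
  have [_ + _] := gapd _ (IH Kx).
  by rewrite -addrA -{2}(mul1r d) -mulrDl natr1.
(* A non-zero remainder of the full turn modulo [d] would place a point of [K] inside a gap. *)
have [j hj1 hj2] := int_quotient (2 * pi) d0.
have [n ej] : exists n : nat, j = n :> int.
  case: j hj1 hj2 => n hj1 hj2; first by exists n.
  have : 0 <= (n.+1)%:R * d by rewrite mulr_ge0 // ltW.
  rewrite NegzE mulrNz mulNr opprK -pmulrn in hj1 hj2; lra.
rewrite ej -pmulrn in hj1 hj2.
have nd : n%:R * d = 2 * pi.
  apply/eqP; rewrite eq_sym -subr_eq0; apply/negPn/negP => ne.
  have [_ _ gap] := gapd _ (Kn _ n K0).
  apply: (gap (2 * pi - n%:R * d)) => //.
    by rewrite lt_neqAle eq_sym ne.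
  have -> : x0 + n%:R * d + (2 * pi - n%:R * d) = x0 + 1%:~R * (2 * pi) by ring.
  exact: per.
have n3 : (3 <= n)%N.
  case: n ej hj1 hj2 nd => [|[|[|n]]] // _ _ _; rewrite ?mul0r ?mul1r; lra.
have n1 : (0 < n)%N by exact: leq_trans n3.
have n0 : n%:R != 0 :> R by rewrite pnatr_eq0 -lt0n.
have ed : d = 2 * pi / n%:R by rewrite -nd mulrC mulKf.
exists n => // x Kx; rewrite -ed; split; first exact: gapd.
have Kj (i : int) : K (x + i%:~R * d).
  case: i => m; first exact: Kn.
  (* Going back [m + 1] steps is going forward [(m + 1) * (n - 1)] steps, up to full turns. *)
  have -> : x + (Negz m)%:~R * d =
      x + (m.+1 * n.-1)%:R * d + (Negz m)%:~R * (2 * pi).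
    rewrite -nd NegzE mulrNz -!pmulrn natrM -subn1 natrB //.
    by ring.
  exact/per/Kn.
move=> y; split=> [Ky|[i ->]]; last exact: Kj.
have [i hi1 hi2] := int_quotient (y - x) d0.
exists i; have [_ _ gap] := gapd _ (Kj i).
apply/eqP; rewrite -subr_eq0; apply/negPn/negP => ne.
apply: (gap (y - (x + i%:~R * d))).
- rewrite lt_neqAle eq_sym ne /=; move: hi1; lra.
- move: hi2; lra.
- by rewrite addrC subrK.
Qed.

(** The sides are the shortest chords of a regular polygon. *)
Lemma cos_multiple (n : nat) (j : int) : (2 <= n)%N ->
  cos (j%:~R * (2 * pi / n%:R)) = 1 :> R \/
  cos (j%:~R * (2 * pi / n%:R)) <= cos (2 * pi / n%:R) :> R.
Proof.
move=> n2; have p0 := pi_gt0 R.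
have n0 : 0 < n%:R :> R by rewrite ltr0n; case: n n2.
have n0' : n%:R != 0 :> R by rewrite gt_eqF.
have nR : 2 <= n%:R :> R by rewrite ler_nat.
have n1 : (0 < n)%N by exact: leq_trans n2.
have nz : n%:Z != 0 by rewrite eqz_nat -lt0n.
set d := 2 * pi / n%:R; have d0 : 0 < d by rewrite divr_gt0 // mulr_gt0.
have nd : n%:R * d = 2 * pi by rewrite /d mulrC divfK.
have dp : d <= pi.
  have : 2 * d <= n%:R * d by rewrite ler_pM2r.
  lra.
have -> : cos (j%:~R * d) = cos ((j %% n)%Z%:~R * d).
  rewrite -[RHS](cos_period _ (j %/ n)%Z) -nd; congr cos.
  rewrite {1}(divz_eq j n) rmorphD rmorphM /= -pmulrn; ring.
have : (j %% n)%Z = `|(j %% n)%Z|%N.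
  by rewrite gez0_abs // modz_ge0.
have : (`|(j %% n)%Z| < n)%N.
  by rewrite -ltz_nat gez0_abs ?modz_ge0 // ltz_pmod.
move=> + ->; move: `|_|%N => m mn; rewrite -pmulrn.
case: m mn => [|m] mn; first by left; rewrite mul0r cos0.
right; apply: cos_arc; [lra|lra|..].
  by rewrite ler_peMl ?ler1n // ltW.
have : m.+2%:R * d <= n%:R * d by rewrite ler_pM2r // ler_nat.
rewrite nd -natr1 mulrDl mul1r; lra.
Qed.

End Angles.

(** * Vertex sets with an invariant line *)

Section Axial.
Variable R : realType.
Local Notation point := 'rV[R]_3.
Local Notation similar := Defs.similar.
Implicit Types (u v w x y z p q r t : point) (c k h : R) (W : set point).
Implicit Types (Q : 'M[R]_3).

Lemma dot_scale_orth c Q a x :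
  dot a (aff c Q 0 x) = dot (c *: (a *m Q^T)) x.
Proof.
rewrite /aff addr0 dotZr dotZl; congr (_ * _).
by rewrite !dot_mx trmx_mul mulmxA.
Qed.

Lemma facet_image c Q W a k : orthm Q -> 0 < c ->
  facet (aff c Q 0 @` W) a k -> facet W (c *: (a *m Q^T)) k.
Proof.
move=> hQ c0 [hW [_ [_ [_ [[[p Wp <-] pk] [[q Wq <-] qk] [[r Wr <-] rk] n0]]]]].
rewrite !dot_scale_orth in pk qk rk.
split; first by move=> x Wx; rewrite -dot_scale_orth; apply/hW/imageP.
exists p, q, r; split=> //; apply: contra n0 => /eqP e.
have [d _ hd] := cross_orth_sign hQ.
have e2 x y : aff c Q 0 x - aff c Q 0 y = c *: ((x - y) *m Q).
  by rewrite /aff; apply: vec3P; rewrite !coordE; ring.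
have e3 u v : cross (c *: u) (c *: v) = c ^+ 2 *: cross u v.
  by apply: vec3P; rewrite !coordE; ring.
by rewrite !e2 e3 hd e mul0mx !scaler0.
Qed.

Lemma vertex_set_image c Q W : orthm Q -> 0 < c -> vertex_set W ->
  vertex_set (aff c Q 0 @` W).
Proof.
move=> hQ c0 hW; have c1 : c != 0 by rewrite gt_eqF.
split.
- exact: finite_image (vs_finite hW).
- by apply: full_aff => //; exact: vs_full.
- move=> _ _ [v Wv <-] [w Ww <-].
  have [P [hP sP e]] := vs_trans hW Wv Ww.
  have eP x : aff c Q 0 x *m (Q^T *m P *m Q) = aff c Q 0 (x *m P).
    by rewrite /aff !addr0 -scalemxAl !mulmxA orthmK.
  exists (Q^T *m P *m Q); split; last by rewrite eP e.
    by do 2!apply: orthmM => //; exact: orthmT.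
  by move=> _ [x Wx <-]; rewrite eP; apply/imageP/sP.
- move=> a k p q p' q' a0 hf s1 s2.
  have side_back p1 q1 : side_of (aff c Q 0 @` W) a k p1 q1 -> exists p2 q2,
      [/\ p1 = aff c Q 0 p2, q1 = aff c Q 0 q2 &
        side_of W (c *: (a *m Q^T)) k p2 q2].
    move=> [pq [[p2 Wp2 ep] pk] [[q2 Wq2 eq] qk] [b [m hb]]]; subst p1 q1.
    rewrite dot_scale_orth in pk; rewrite dot_scale_orth in qk.
    exists p2, q2; split=> //; split=> //.
      by apply/eqP => e; move: pq; rewrite e eqxx.
    exists (c *: (b *m Q^T)), m => x Wx; rewrite -!dot_scale_orth => xk.
    have [h1 h2] := hb _ (imageP _ Wx) xk; split=> //; rewrite h2.
    have inj y : aff c Q 0 x = aff c Q 0 y <-> x = y.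
      by split=> [|->//]; apply: can_inj (affK 0 hQ c1) x y.
    by rewrite !inj.
  have [p2 [q2 [-> -> s1']]] := side_back _ _ s1.
  have [p2' [q2' [-> -> s2']]] := side_back _ _ s2.
  rewrite !dot_aff //; congr (_ * _).
  apply: (vs_side hW _ (facet_image hQ c0 hf) s1' s2').
  rewrite scaler_eq0 negb_or c1 /=; apply: contra a0 => /eqP e.
  by rewrite -(orthmKV a hQ) e mul0mx.
Qed.

(** Normal form when a line is preserved: the line becomes the third axis, the vertices lie on two
    circles of radius 1, and some symmetry exchanges the two levels. *)
Record axial W h : Prop := Axial {
  ax_height : 0 < h;
  ax_vertices : vertex_set W;
  ax_circle : forall v, W v -> v 0 0 ^+ 2 + v 0 1 ^+ 2 = 1;
  ax_level : forall v, W v -> v 0 2 = h \/ v 0 2 = - h;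
  ax_swap : exists2 Q, orthm Q & forall x, W x ->
    W (x *m Q) /\ (x *m Q) 0 2 = - x 0 2 }.

Lemma axis_exists W : ~ irreducible_group (rotations W) ->
  exists2 e : point, dot e e = 1 & forall Q, symm W Q ->
    e *m Q = e \/ e *m Q = - e.
Proof.
move=> hn.
have [u u0 hu] : exists2 u : point, u != 0 & forall Q, rotations W Q ->
    exists k, u *m Q = k *: u.
  apply: contrapT => h; apply: hn => u u0.
  apply: contrapT => h2; apply: h; exists u => // Q HQ.
  apply: contrapT => h3; apply: h2; exists Q => // k e.
  by apply: h3; exists k.
exists (unit_of u); first exact: unit_ofP.
move=> Q [hQ sQ]; have [k ek] : exists k, u *m Q = k *: u.
  case: (det_orth hQ) => dQ; first by apply: hu; split=> //; left.
  have [|k ek] := hu (- Q).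
    split=> //; [exact: orthmN|right].
    by split; rewrite opprK.
  exists (- k); rewrite scaleNr -ek mulmxN opprK //.
have : k ^+ 2 = 1 ^+ 2.
  have := dot_orth u u hQ; rewrite ek dotZl dotZr mulrA -expr2 expr1n.
  have u1 : dot u u != 0 by rewrite dot_eq0.
  by rewrite -[X in _ = X]mul1r => /(mulIf u1).
have -> : unit_of u *m Q = k *: unit_of u.
  by rewrite /unit_of -scalemxAl ek !scalerA mulrC.
move/eqP; rewrite eqf_sqr => /orP[]/eqP ->; first by left; rewrite scale1r.
by right; rewrite scaleN1r.
Qed.

Lemma vertex_set_sphere W x y : vertex_set W -> W x -> W y -> dot x x = dot y y.
Proof.
by move=> hW Wx Wy; have [Q [hQ _ <-]] := vs_trans hW Wx Wy; rewrite dot_orth.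
Qed.

(** Transitivity makes the height along the axis constant up to sign and the distance from it
    constant; neither vanishes, since [W] is full. A symmetry that joins the two levels must reverse
    the axis. *)
Lemma axial_exists W : vertex_set W -> ~ irreducible_group (rotations W) ->
  exists W' h, similar W W' /\ axial W' h.
Proof.
move=> hW /axis_exists [e ee inv]; have fW := vs_full hW.
have [v [w F0]] := exists_frame ee.
have [[_ vv ww] [ev ew vw]] := F0.
have F : orthonormal v w e by split; split; rewrite // dotC.
have hM := orthm_mat3 F; set M := mat3 v w e in hM.
have e0 : e != 0 by rewrite -dot_eq0 ee oner_eq0.
have v0 : v != 0 by rewrite -dot_eq0 vv oner_eq0.
have inv' Q x : symm W Q -> dot (x *m Q) e = dot x e \/
    dot (x *m Q) e = - dot x e.
  move=> sQ; have hQ := sQ.1.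
  by case: (inv Q sQ) => eQ; [left|right]; rewrite -[in RHS](dot_orth x e hQ) eQ
    ?dotNr ?opprK.
have [x0 Wx0] := full_nonempty fW.
pose z := dot x0 e.
have hz x : W x -> dot x e = z \/ dot x e = - z.
  by move=> Wx; have [Q [hQ sQ <-]] := vs_trans hW Wx0 Wx; apply: inv'.
have hz2 x : W x -> dot x e ^+ 2 = z ^+ 2.
  by move=> /hz [] ->; rewrite ?sqrrN.
have z0 : z != 0.
  apply/eqP => z0; move: e0; apply/negP; rewrite negbK; apply/eqP.
  apply: (fW _ 0) => x /hz; rewrite z0 oppr0 dotC => -[] //.
pose r2 := dot x0 x0 - z ^+ 2.
have hr x : W x -> dot x v ^+ 2 + dot x w ^+ 2 = r2.
  move=> Wx; rewrite /r2 -(vertex_set_sphere hW Wx Wx0) -(hz2 _ Wx).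
  rewrite -(dot_orth x x (orthmT hM)) mat3TE !coordE; ring.
have r0 : 0 < r2.
  rewrite lt_neqAle -(hr _ Wx0) addr_ge0 ?sqr_ge0 // andbT hr // eq_sym.
  apply/eqP => r0; move: v0; apply/negP; rewrite negbK; apply/eqP.
  apply: (fW _ 0) => x /hr; rewrite r0 dotC => h.
  apply/eqP; rewrite -sqrf_eq0; apply/eqP.
  have := sqr_ge0 (dot v x); have := sqr_ge0 (dot x w); lra.
pose c := (Num.sqrt r2)^-1.
have c0 : 0 < c by rewrite invr_gt0 sqrtr_gt0.
have cr : c ^+ 2 * r2 = 1.
  by rewrite exprVn sqr_sqrtr ?mulVf ?gt_eqF // ltW.
have affE x : aff c M^T 0 x = vec3 (c * dot x v) (c * dot x w) (c * dot x e).
  by rewrite /aff addr0 mat3TE; apply: vec3P; rewrite !coordE.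
exists (aff c M^T 0 @` W), (c * `|z|); split.
  by apply/similarP; exists c, M^T, 0; split=> //; exact: orthmT.
have zn : z = `|z| \/ z = - `|z|.
  by case: (ger0P z) => _; [left|right; rewrite opprK].
split.
- by rewrite mulr_gt0 // normr_gt0.
- by apply: vertex_set_image => //; exact: orthmT.
- move=> _ [x Wx <-]; rewrite affE !vec3E !exprMn -mulrDr hr //.
- move=> _ [x Wx <-]; rewrite affE !vec3E -mulrN.
  by case: (hz _ Wx) => ->; case: zn => zE; [left|right|right|left];
    congr (_ * _); move: zE; lra.
- have [x1 Wx1 zx1] : exists2 x, W x & dot x e = - z.
    apply: contrapT => h; move: e0; apply/negP; rewrite negbK; apply/eqP.
    apply: (fW _ z) => x Wx; rewrite dotC; case: (hz _ Wx) => // hx.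
    by exfalso; apply: h; exists x.
  have [Q [hQ sQ eQ]] := vs_trans hW Wx0 Wx1.
  have eQe : e *m Q = - e.
    case: (inv Q) => // e1; exfalso; have := dot_orth x0 e hQ.
    rewrite eQ e1 zx1 -/z => /eqP; rewrite -subr_eq0 -opprD oppr_eq0.
    by rewrite -mulr2n mulrn_eq0 (negPf z0).
  exists (M *m Q *m M^T).
    by apply: orthmM; [exact: orthmM|exact: orthmT].
  move=> _ [x Wx <-].
  have -> : aff c M^T 0 x *m (M *m Q *m M^T) = aff c M^T 0 (x *m Q).
    by rewrite /aff !addr0 -scalemxAl !mulmxA orthmKV.
  split; first exact/imageP/sQ.
  rewrite !affE !vec3E -mulrN -(dot_orth x e hQ) eQe dotNr opprK //.
Qed.

(** Seen from their centroid, the four points are proportional to a tetrahedral frame; [rho] is the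
    circumradius, whose square is 3/8 of the squared edge [L]. *)
Lemma equidistant_tetrahedron (f : 'I_4 -> point) (L : R) : 0 < L ->
  (forall i j, i != j -> dot (f i - f j) (f i - f j) = L) ->
  similar (@tetrahedron_vertices R) (range f).
Proof.
move=> L0 hf.
have hd (i j k : 'I_4) : i != j -> i != k -> j != k ->
    dot (f i - f j) (f i - f k) = L / 2.
  move=> ij ik jk; have := hf _ _ jk.
  have -> : f j - f k = (f i - f k) - (f i - f j).
    by apply: vec3P; rewrite !coordE; ring.
  move: (hf _ _ ij) (hf _ _ ik); move: (f i - f j) (f i - f k) => u v hu hv.
  by rewrite !dotDl !dotDr !dotNl !dotNr hu hv (dotC v u); lra.
have hd2 i j : dot (f i - f j) (f i - f j) = if i == j then 0 else L.
  case: eqP => [->|/eqP]; last exact: hf.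
  by rewrite subrr dot0l.
have hdd (i j k : 'I_4) : dot (f i - f j) (f i - f k) =
    if (i == j) || (i == k) then 0 else if j == k then L else L / 2.
  case: (eqVneq i j) => [->|ij] /=; first by rewrite subrr dot0l.
  case: (eqVneq i k) => [->|ik] /=; first by rewrite subrr dot0r.
  case: (eqVneq j k) => [->|jk]; first by rewrite hd2 (negPf ik).
  exact: hd.
pose g : point := 4^-1 *: (f 0 + f 1 + f 2 + f 3).
have eg i : f i - g = 4^-1 *: ((f i - f 0) + (f i - f 1) + (f i - f 2) + (f i - f 3)).
  by rewrite /g; apply: vec3P; rewrite !coordE; field.
have hn i : dot (f i - g) (f i - g) = 3 / 8 * L.
  have E (a b c d : point) : dot (a + b + c + d) (a + b + c + d) =
      dot a a + dot b b + dot c c + dot d d + 2 * (dot a b + dot a c + dot a d +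
      dot b c + dot b d + dot c d).
    rewrite !dotDl !dotDr (dotC b a) (dotC c a) (dotC d a) (dotC c b).
    by rewrite (dotC d b) (dotC d c); ring.
  rewrite eg dotZl dotZr E !hdd.
  by case: (ord4P i) => -> /=; field.
have hm i j : i != j -> dot (f i - g) (f j - g) = - (L / 8).
  move=> ij; have := hf _ _ ij.
  have -> : f i - f j = (f i - g) - (f j - g).
    by apply: vec3P; rewrite !coordE; ring.
  move: (hn i) (hn j); move: (f i - g) (f j - g) => u v hu hv.
  by rewrite !dotDl !dotDr !dotNl !dotNr hu hv (dotC v u); lra.
pose rho := Num.sqrt (3 / 8 * L).
have r8 : 0 < 3 / 8 * L by rewrite mulr_gt0 // divr_gt0.
have rho0 : 0 < rho by rewrite sqrtr_gt0.
have rr : rho ^+ 2 = 3 / 8 * L by rewrite sqr_sqrtr // ltW.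
have fa : tetra_frame (fun i => rho^-1 *: (f i - g)).
  split=> [i|i j ij]; rewrite dotZl dotZr mulrA -expr2 exprVn rr ?hn ?hm //.
    by rewrite mulVf // gt_eqF.
  by field; rewrite gt_eqF.
have [Q hQ e] := tetra_frame_std fa.
have s30 := sqrt3_neq0 R; have s3p : 0 < Num.sqrt 3 :> R by rewrite sqrtr_gt0.
apply/similarP; exists (rho / Num.sqrt 3), Q, g; split=> //.
  by rewrite divr_gt0.
have ei i : aff (rho / Num.sqrt 3) Q g (tetra_vertex R i) = f i.
  rewrite /aff e !scalerA -(mulrA rho) mulVf // mulr1 mulfV ?gt_eqF //.
  by rewrite scale1r subrK.
rewrite tetra_verticesE; apply/seteqP; split.
  by move=> _ [_ [i _ <-] <-]; exists i.
by move=> _ [i _ <-]; exists (tetra_vertex R i); [exists i|].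
Qed.

Lemma triangle_side p q r : noncollinear p q r -> exists b : point,
  dot b p = dot b q /\ dot b r < dot b p.
Proof.
move=> n0; pose u := q - p; pose v := r - p.
have c0 : 0 < dot u u * dot v v - dot u v ^+ 2.
  by rewrite -dot_cross; apply: dot_gt0.
(* In the plane of the triangle, orthogonal to the side [u] and pointing away from [r]. *)
exists (dot u v *: u - dot u u *: v).
have eq : q = p + u by rewrite addrC subrK.
have er : r = p + v by rewrite addrC subrK.
clearbody u v; rewrite eq er !dotDl !dotDr !dotNl !dotZl (dotC v u).
by split; lra.
Qed.

Lemma noncollinear_rot p q r : noncollinear p q r -> noncollinear q r p.
Proof.
rewrite /noncollinear; have -> // : cross (r - q) (p - q) = cross (q - p) (r - p).
by apply: vec3P; rewrite !coordE; ring.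
Qed.

Lemma noncollinear_neq p q r : noncollinear p q r -> p != q.
Proof.
apply: contra => /eqP ->; rewrite subrr.
by apply/eqP; apply: vec3P; rewrite !coordE; ring.
Qed.

Lemma triangular_facet_sides W a k p q r : vertex_set W -> a != 0 ->
  facet W a k -> noncollinear p q r -> W p -> W q -> W r ->
  (forall x, W x -> dot a x = k <-> [\/ x = p, x = q | x = r]) ->
  dot (p - q) (p - q) = dot (q - r) (q - r) /\
  dot (p - q) (p - q) = dot (r - p) (r - p).
Proof.
move=> hW a0 hf n0 Wp Wq Wr hx.
have side1 p1 q1 r1 : noncollinear p1 q1 r1 -> W p1 -> W q1 -> W r1 ->
    (forall x, W x -> dot a x = k <-> [\/ x = p1, x = q1 | x = r1]) ->
    side_of W a k p1 q1.
  move=> n1 W1 W2 W3 hx1; have [b [b1 b2]] := triangle_side n1.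
  split; first exact: noncollinear_neq n1.
  - by split=> //; apply/hx1 => //; constructor 1.
  - by split=> //; apply/hx1 => //; constructor 2.
  exists b, (dot b p1) => x Wx /(hx1 _ Wx) [] ->; split=> //.
  - by split=> // _; left.
  - by rewrite b1.
  - by split=> // _; right.
  - exact: ltW.
  - split=> [e|[->|->]] //; by move: b2; rewrite e ltxx.
have s1 := side1 _ _ _ n0 Wp Wq Wr hx.
have n1 := noncollinear_rot n0; have n2 := noncollinear_rot n1.
have s2 : side_of W a k q r.
  apply: side1 n1 _ _ _ _ => // x Wx; rewrite hx //.
  by split=> -[] ->; by [constructor 1|constructor 2|constructor 3].
have s3 : side_of W a k r p.
  apply: side1 n2 _ _ _ _ => // x Wx; rewrite hx //.
  by split=> -[] ->; by [constructor 1|constructor 2|constructor 3].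
by split; [exact: (vs_side hW a0 hf s1 s2)|exact: (vs_side hW a0 hf s1 s3)].
Qed.

(** The three points span a facet, because fullness puts the fourth strictly on one side of their
    plane. *)
Lemma four_points_sides W p q r t : vertex_set W ->
  (forall x, W x <-> [\/ x = p, x = q, x = r | x = t]) ->
  noncollinear p q r ->
  dot (p - q) (p - q) = dot (q - r) (q - r) /\
  dot (p - q) (p - q) = dot (r - p) (r - p).
Proof.
move=> hW hx n0.
have Wp : W p by apply/hx; constructor 1.
have Wq : W q by apply/hx; constructor 2.
have Wr : W r by apply/hx; constructor 3.
have Wt : W t by apply/hx; constructor 4.
have fW := vs_full hW.
have go (a : point) : a != 0 -> dot a q = dot a p -> dot a r = dot a p ->
    dot a t < dot a p -> dot (p - q) (p - q) = dot (q - r) (q - r) /\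
    dot (p - q) (p - q) = dot (r - p) (r - p).
  move=> a0 aq ar at0.
  have hle x : W x -> dot a x <= dot a p.
    by move=> /hx [] ->; rewrite ?aq ?ar // ltW.
  apply: (triangular_facet_sides (k := dot a p) hW a0 _ n0) => //.
    by split=> //; exists p, q, r.
  move=> x Wx; split; last by case=> ->; rewrite ?aq ?ar.
  move=> e; move: Wx => /hx [] ex; [by constructor 1|by constructor 2|
    by constructor 3|exfalso].
  by move: at0; rewrite -ex e ltxx.
pose a := cross (q - p) (r - p).
have aq : dot a q = dot a p.
  have -> : q = p + (q - p) by rewrite addrC subrK.
  by rewrite dotDr (dotC a (q - p)) cross_dotl addr0.
have ar : dot a r = dot a p.
  have -> : r = p + (r - p) by rewrite addrC subrK.
  by rewrite dotDr (dotC a (r - p)) cross_dotr addr0.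
have a0 : a != 0 by exact: n0.
case: (ltrgtP (dot a t) (dot a p)) => at0.
- exact: go at0.
- by apply: (go (- a)); rewrite ?oppr_eq0 // !dotNl ?aq ?ar // ltrN2.
- exfalso; move: a0; apply/negP; rewrite negbK; apply/eqP.
  by apply: (fW _ (dot a p)) => x /hx [] ->.
Qed.

Lemma axial_noncollinear h p q r : 0 < h -> p != q -> p 0 2 = q 0 2 ->
  r 0 2 != p 0 2 -> noncollinear p q r.
Proof.
move=> h0 pq e n; apply: contra pq => /eqP c.
have c0 := congr1 (fun x : point => x 0 0) c.
have c1 := congr1 (fun x : point => x 0 1) c.
move: c0 c1; rewrite !coordE -e.
have d0 : r 0 2 - p 0 2 != 0 by rewrite subr_eq0.
set d := r 0 2 - p 0 2 in d0 *.
rewrite subrr !mul0r subr0 sub0r => /eqP; rewrite mulf_eq0 (negPf d0) orbF.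
move=> /eqP h1 /eqP; rewrite oppr_eq0 mulf_eq0 (negPf d0) orbF => /eqP h2.
by apply/eqP; apply: vec3P; lra.
Qed.

(** With one vertex per level [W] would be flat; with two, the triangular facets have equal sides
    and all six distances agree. *)
Lemma axial_few_tetrahedron W h : axial W h ->
  ~ (exists p q r, [/\ W p, W q & W r] /\
       [/\ p 0 2 = h, q 0 2 = h & r 0 2 = h] /\
       [/\ p != q, p != r & q != r]) ->
  similar (@tetrahedron_vertices R) W.
Proof.
move=> [h0 hW hc hl [Q hQ sw]] few; have fW := vs_full hW.
have hN0 : - h != h by rewrite lt_eqF //; lra.
have e3 : vec3 0 0 1 != 0 :> point.
  by rewrite -dot_eq0 !coordE !(mulr0, mulr1, add0r) oner_eq0.
have e3z x : dot (vec3 0 0 1) x = x 0 2 by rewrite !coordE; ring.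
have [p Wp ph] : exists2 p, W p & p 0 2 = h.
  apply: contrapT => n; move: e3; apply/negP; rewrite negbK; apply/eqP.
  apply: (fW _ (- h)) => x Wx; rewrite e3z; case: (hl _ Wx) => // e.
  by exfalso; apply: n; exists x.
have injQ x y : x *m Q = y *m Q -> x = y.
  by move=> e; rewrite -(orthmK x hQ) e orthmK.
have top2 x y z : W x -> W y -> W z -> x 0 2 = h -> y 0 2 = h -> z 0 2 = h ->
    x != y -> z = x \/ z = y.
  move=> Wx Wy Wz xh yh zh xy.
  have [->|zx] := eqVneq z x; first by left.
  have [->|zy] := eqVneq z y; first by right.
  by exfalso; apply: few; exists x, y, z; do 2!split=> //; split; rewrite // eq_sym.
have [q [Wq qh pq]] : exists q, [/\ W q, q 0 2 = h & p != q].
  apply: contrapT => n.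
  have one x : W x -> x 0 2 = h -> x = p.
    move=> Wx xh; apply/eqP/negPn/negP => ne; apply: n; exists x.
    by split; rewrite // eq_sym.
  have pQ := sw _ Wp.
  have oneb x : W x -> x = p \/ x = p *m Q.
    move=> Wx; case: (hl _ Wx) => xh; first by left; apply: one.
    right; apply: (injQ); apply: etrans (esym _); last first.
      by apply: one; [exact: (sw _ pQ.1).1|rewrite (sw _ pQ.1).2 pQ.2 opprK].
    by apply: one; [exact: (sw _ Wx).1|rewrite (sw _ Wx).2 xh opprK].
  have pn0 : p - p *m Q != 0.
    rewrite subr_eq0; apply/eqP => e; move: hN0; rewrite -ph -pQ.2 -e.
    by rewrite eqxx.
  have [a a0 ha] := exists_orth pn0.
  move: a0; apply/negP; rewrite negbK; apply/eqP; apply: (fW _ (dot a p)) => x.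
  move=> /oneb [] -> //; move: ha; rewrite dotC dotDr dotNr; lra.
have [Wp' hp'] := sw _ Wp; have [Wq' hq'] := sw _ Wq.
have pq' : p *m Q != q *m Q by apply: contra pq => /eqP /injQ ->.
rewrite ph in hp'; rewrite qh in hq'.
have hx x : W x <-> [\/ x = p, x = q, x = p *m Q | x = q *m Q].
  split=> [Wx|[] -> //]; case: (hl _ Wx) => xh.
    case: (top2 p q x) => // ->; by [constructor 1|constructor 2].
  have [Wpp hpp] := sw _ Wp'; have [Wqq hqq] := sw _ Wq'.
  have [Wxx hxx] := sw _ Wx; rewrite xh opprK in hxx.
  rewrite hp' opprK in hpp; rewrite hq' opprK in hqq.
  case: (top2 (p *m Q *m Q) (q *m Q *m Q) (x *m Q)) => //.
  - by apply: contra pq' => /eqP /injQ ->.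
  - by move=> /injQ ->; constructor 3.
  - by move=> /injQ ->; constructor 4.
have n1 : noncollinear p q (p *m Q).
  by apply: (axial_noncollinear h0) => //; rewrite ?ph ?qh ?hp'.
have n2 : noncollinear p q (q *m Q).
  by apply: (axial_noncollinear h0) => //; rewrite ?ph ?qh ?hq'.
have [d1 d2] := four_points_sides hW hx n1.
have [|d3 d4] := @four_points_sides W p q (q *m Q) (p *m Q) hW _ n2.
  by move=> x; rewrite hx; split=> -[] ->; by [constructor 1|constructor 2|
    constructor 3|constructor 4].
have d5 : dot (p *m Q - q *m Q) (p *m Q - q *m Q) = dot (p - q) (p - q).
  by rewrite -mulmxBl dot_orth.
pose f (i : 'I_4) := [:: p; q; p *m Q; q *m Q]`_i.
have -> : W = range f.
  apply/seteqP; split=> [x /hx [] ->|_ [i _ <-]].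
  - by exists 0.
  - by exists 1.
  - by exists 2.
  - by exists 3.
  - by apply/hx; case: (ord4P i) => ->;
      by [constructor 1|constructor 2|constructor 3|constructor 4].
apply: (@equidistant_tetrahedron _ (dot (p - q) (p - q))).
  by apply: dot_gt0; rewrite subr_eq0.
have sym x y : dot (x - y) (x - y) = dot (y - x) (y - x).
  by rewrite -[x - y]opprB dotNl dotNr opprK.
move=> i j; rewrite /f; case: (ord4P i) => ->; case: (ord4P j) => -> //= _;
  by rewrite ?d1 ?d2 ?d3 ?d4 // sym ?d1 ?d2 ?d3 ?d4 // ?d5 // -?d1 -?d2 -?d3.
Qed.

End Axial.

(** * The two levels are congruent regular polygons *)

Section PrismsAntiprisms.
Variable R : realType.
Local Notation point := 'rV[R]_3.
Local Notation similar := Defs.similar.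
Implicit Types (u v w x y p q r : point) (s t z h g : R) (W : set point).

Definition cyl t z : point := vec3 (cos t) (sin t) z.

Definition level_angles W z : set R := [set t | W (cyl t z)].

Lemma cyl_period t z (j : int) : cyl (t + j%:~R * (2 * pi)) z = cyl t z.
Proof. by rewrite /cyl cos_period sin_period. Qed.

Lemma cyl_eq s t z z' : cyl s z = cyl t z' ->
  exists j : int, t = s + j%:~R * (2 * pi).
Proof.
move=> e; apply: cos_sin_eq.
  by have := congr1 (fun x : point => x 0 0) e; rewrite !vec3E.
by have := congr1 (fun x : point => x 0 1) e; rewrite !vec3E.
Qed.

Lemma level_period W z t (j : int) : level_angles W z t ->
  level_angles W z (t + j%:~R * (2 * pi)).
Proof. by rewrite /level_angles /= cyl_period. Qed.

Lemma axial_cyl W h v : axial W h -> W v -> exists t, v = cyl t (v 0 2).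
Proof.
move=> ax /(ax_circle ax) /angle_exists[t [e0 e1]]; exists t.
by apply: vec3P; rewrite !vec3E.
Qed.

Lemma relative_angle W h v t : axial W h -> W v ->
  exists s, [/\ 0 <= s, s < 2 * pi & v = cyl (t + s) (v 0 2)].
Proof.
move=> ax Wv; have [s es] := axial_cyl ax Wv.
have p0 : 0 < 2 * pi :> R by rewrite mulr_gt0 // pi_gt0.
have [j h1 h2] := int_quotient (s - t) p0.
exists (s - t - j%:~R * (2 * pi)); split=> //.
rewrite -(cyl_period _ _ j) {1}es; congr cyl; ring.
Qed.

Lemma gap_exists W h z t : axial W h -> level_angles W z t ->
  exists g, is_gap (level_angles W z) t g.
Proof.
move=> ax Kt; pose B := W `&` [set v | v 0 2 = z].
have p0 : 0 < 2 * pi :> R by rewrite mulr_gt0 // pi_gt0.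
have fB : finite_set B.
  by apply: sub_finite_set (vs_finite (ax_vertices ax)) => v [].
have B0 : B !=set0 by exists (cyl t z); split=> //=; rewrite vec3E.
have [f hf] : exists f : point -> R, forall v, B v ->
    [/\ 0 < f v, f v <= 2 * pi & v = cyl (t + f v) z].
  suff : forall v, exists s, B v -> [/\ 0 < s, s <= 2 * pi & v = cyl (t + s) z].
    by move=> /choice [f hf]; exists f.
  move=> v; have [[Wv /= vz]|nB] := pselect (B v); last by exists 0.
  have [s [s0 s2 e]] := relative_angle t ax Wv; rewrite vz in e.
  (* The starting vertex is met again after a full turn, so its own value is [2 * pi] and not 0. *)
  have [s00|sn] := eqVneq s 0.
    exists (2 * pi) => _; split=> //; rewrite e s00 addr0.
    by rewrite -(cyl_period t z 1) mul1r.
  by exists s => _; split=> //; [rewrite lt_neqAle eq_sym sn|exact: ltW].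
have [v Bv hv] := finite_argmax (fun v => - f v) fB B0.
have [f0 f2 ev] := hf _ Bv.
exists (f v); split=> //; first by rewrite /level_angles /= -ev; case: Bv.
move=> s s0 sv Ks.
have Bs : B (cyl (t + s) z) by split=> //=; rewrite vec3E.
have [g0 g2 es] := hf _ Bs; have := hv _ Bs; rewrite lerN2.
set g := f _ in g0 g2 es * => le.
have [j ej] := cyl_eq es.
have e2 : g - s = j%:~R * (2 * pi) by lra.
suff j0 : j = 0 by move: e2; rewrite j0 mul0r; lra.
have lt1 : j%:~R * (2 * pi) < 1 * (2 * pi) :> R by rewrite -e2; lra.
have gtN1 : -1 * (2 * pi) < j%:~R * (2 * pi) :> R by rewrite -e2; lra.
rewrite !ltr_pM2r // in lt1 gtN1.
have : j < 1 by rewrite -(@ltr_int R).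
have : -1 < j by rewrite -(@ltr_int R) mulrNz.
by case: j {ej e2 lt1 gtN1} => [[|n]|[|n]].
Qed.

Definition three_points W z := exists p q r, [/\ W p, W q & W r] /\
  [/\ p 0 2 = z, q 0 2 = z & r 0 2 = z] /\ [/\ p != q, p != r & q != r].

Lemma three_angles W h z t : axial W h -> three_points W z ->
  exists s s', [/\ 0 < s, s < s', s' < 2 * pi, level_angles W z (t + s) &
    level_angles W z (t + s')].
Proof.
move=> ax [p [q [r [[Wp Wq Wr] [[pz qz rz] [pq pr qr]]]]]].
have [a [a0 a2 ea]] := relative_angle t ax Wp.
have [b [b0 b2 eb]] := relative_angle t ax Wq.
have [c [c0 c2 ec]] := relative_angle t ax Wr.
rewrite pz in ea; rewrite qz in eb; rewrite rz in ec.
have ab : a != b by apply: contra pq => /eqP e; rewrite ea eb e.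
have ac : a != c by apply: contra pr => /eqP e; rewrite ea ec e.
have bc : b != c by apply: contra qr => /eqP e; rewrite eb ec e.
have Ka : level_angles W z (t + a) by rewrite /level_angles /= -ea.
have Kb : level_angles W z (t + b) by rewrite /level_angles /= -eb.
have Kc : level_angles W z (t + c) by rewrite /level_angles /= -ec.
have two (x y : R) : 0 < x -> 0 < y -> x != y -> x < 2 * pi -> y < 2 * pi ->
    level_angles W z (t + x) -> level_angles W z (t + y) ->
    exists s s', [/\ 0 < s, s < s', s' < 2 * pi, level_angles W z (t + s) &
    level_angles W z (t + s')].
  move=> x0 y0; rewrite neq_lt => /orP[] h1 x2 y2 Kx Ky; first by exists x, y.
  by exists y, x.
have [az|an] := eqVneq a 0.
  apply: (two b c) => //; rewrite lt_neqAle eq_sym ?b0 ?c0 andbT -az.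
    by rewrite eq_sym.
  by rewrite eq_sym.
have ap : 0 < a by rewrite lt_neqAle eq_sym an.
have [bz|bn] := eqVneq b 0.
  by apply: (two a c) => //; rewrite lt_neqAle c0 andbT -bz.
by apply: (two a b) => //; rewrite lt_neqAle b0 andbT eq_sym.
Qed.

Lemma dot_cylB s t z z' : dot (cyl s z - cyl t z') (cyl s z - cyl t z') =
  2 - 2 * cos (t - s) + (z - z') ^+ 2.
Proof.
have h1 := cos2Dsin2 s; have h2 := cos2Dsin2 t.
by rewrite cosB !coordE; lra.
Qed.

(** A line meets a sphere in at most two points. *)
Lemma sphere_noncollinear p q r (c : R) : dot p p = c -> dot q q = c ->
  dot r r = c -> p != q -> p != r -> q != r -> noncollinear p q r.
Proof.
move=> hp hq hr pq pr qr; apply/eqP => c0.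
have u0 : q - p != 0 by rewrite subr_eq0 eq_sym.
have := cross0P u0 c0; set k := _ / _ => e.
set u := q - p in u0 e.
have eq : q = p + u by rewrite addrC subrK.
have er : r = p + k *: u by rewrite -e addrC subrK.
clearbody k u.
have uu : dot u u != 0 by rewrite dot_eq0.
have h1 : 2 * dot p u + dot u u = 0.
  by move: hq; rewrite eq dotDl !dotDr (dotC u p) hp; lra.
have h2 : k * (2 * dot p u + k * dot u u) = 0.
  by move: hr; rewrite er dotDl !dotDr !dotZl !dotZr (dotC u p) hp; lra.
have /eqP : k * (k - 1) * dot u u = 0.
  have h3 : k * (2 * dot p u + dot u u) = 0 by rewrite h1 mulr0.
  by lra.
rewrite !mulf_eq0 (negPf uu) orbF subr_eq0 => /orP[]/eqP k0.
  by move: pr; rewrite er k0 scale0r addr0 eqxx.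
by move: qr; rewrite er k0 scale1r eq eqxx.
Qed.

(** A level with three vertices is a facet and neighbours on it form a side, so equal sides mean
    equal squared chords [2 - 2 * cos g]. *)
Lemma level_gap_cos W h z (s t g g' : R) : axial W h -> z = h \/ z = - h ->
  three_points W z ->
  level_angles W z s -> level_angles W z t -> is_gap (level_angles W z) s g ->
  is_gap (level_angles W z) t g' -> cos g = cos g'.
Proof.
move=> ax zh th Ks Kt hg hg'; have [h0 hW hc hl _] := ax.
(* The sign that makes [a] the outer normal of the level [z]. *)
pose e : R := if z == h then 1 else -1.
have ez : e * z = h.
  rewrite /e; case: eqP => [->|n]; first by rewrite mul1r.
  by case: zh => // ->; rewrite mulN1r opprK.
have en : e != 0 by rewrite /e; case: ifP; rewrite ?oppr_eq0 oner_eq0.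
pose a : point := vec3 0 0 e.
have az x : dot a x = e * x 0 2 by rewrite !coordE; ring.
have a0 : a != 0 by rewrite -dot_eq0 az vec3E mulf_eq0 negb_or en.
have level x : dot a x = h <-> x 0 2 = z.
  by rewrite az -ez; split=> [/(mulfI en)|->].
have hf : facet W a h.
  split=> [x /hl|].
    rewrite az /e; case: ifP => _ [] ->; rewrite ?mul1r ?mulN1r ?opprK //; lra.
  have [p [q [r [[Wp Wq Wr] [[pz qz rz] [pq pr qr]]]]]] := th.
  exists p, q, r; split; [by rewrite level|by rewrite level|by rewrite level|].
  have n1 x : W x -> x 0 2 = z -> dot x x = 1 + z ^+ 2.
    by move=> Wx xz; rewrite -(hc _ Wx) !coordE xz; ring.
  by apply: (@sphere_noncollinear p q r (1 + z ^+ 2)) => //; apply: n1.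
have side s' g1 : level_angles W z s' -> is_gap (level_angles W z) s' g1 ->
    side_of W a h (cyl s' z) (cyl (s' + g1) z).
  move=> Ks' hg1; have [g0 Kg gap] := hg1.
  have [b [b' [b0 bb b2 Kb Kb']]] := three_angles s' ax th.
  have gb : g1 <= b by rewrite leNgt; apply/negP => /(gap _ b0).
  have g2 : g1 < 2 * pi by lra.
  split.
  - apply/eqP => e1; have : cos g1 = 1.
      have := dot_cylB s' (s' + g1) z z; rewrite e1 subrr dot0l.
      have -> : s' + g1 - s' = g1 by ring.
      lra.
    by move=> /(cos_eq1 (ltW g0) g2) g10; move: g0; rewrite g10 ltxx.
  - by split=> //; apply/level; rewrite vec3E.
  - by split=> //; apply/level; rewrite vec3E.
  exists (vec3 (cos (s' + g1 / 2)) (sin (s' + g1 / 2)) 0), (cos (g1 / 2)).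
  move=> x Wx /level xz; have [u eu] := axial_cyl ax Wx; rewrite xz in eu.
  have -> : dot (vec3 (cos (s' + g1 / 2)) (sin (s' + g1 / 2)) 0) x =
      cos (u - s' - g1 / 2).
    have -> : u - s' - g1 / 2 = u - (s' + g1 / 2) by ring.
    by rewrite cosB eu !coordE; ring.
  have Ku : level_angles W z u by rewrite /level_angles /= -eu.
  have [h1 h2] := gap_support (@level_period W z) Ks' hg1 (ltW g2) Ku.
  split=> //; split.
    by move=> /h2 [j [ej|ej]]; [left|right]; rewrite eu ej cyl_period.
  rewrite eu; case=> /cyl_eq [j ej].
    have -> : u - s' - g1 / 2 = - (g1 / 2) + (- j)%:~R * (2 * pi).
      by rewrite ej mulrNz; ring.
    by rewrite cos_period cosN.
  have -> : u - s' - g1 / 2 = g1 / 2 + (- j)%:~R * (2 * pi).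
    have -> : u = s' + g1 - j%:~R * (2 * pi) by rewrite ej; ring.
    by rewrite mulrNz; field.
  by rewrite cos_period.
have := vs_side hW a0 hf (side _ _ Ks hg) (side _ _ Kt hg').
rewrite !dot_cylB.
have -> : s + g - s = g by ring.
have -> : t + g' - t = g' by ring.
lra.
Qed.

Lemma level_regular W h z : axial W h -> z = h \/ z = - h ->
  three_points W z ->
  exists2 n : nat, (3 <= n)%N & forall t, level_angles W z t ->
    is_gap (level_angles W z) t (2 * pi / n%:R) /\
    forall s, level_angles W z s <->
      exists j : int, s = t + j%:~R * (2 * pi / n%:R).
Proof.
move=> ax zh th; apply: regular_angles.
- exact: level_period.
- by move=> t; apply: gap_exists ax.
- by move=> s t g g' Ks Kt; exact: (level_gap_cos ax zh th).
- by move=> t _; exact: three_angles ax th.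
- have [s [s' [_ _ _ K _]]] := three_angles 0 ax th.
  by exists (0 + s).
Qed.

Lemma three_points_swap W h : axial W h -> three_points W h ->
  three_points W (- h).
Proof.
move=> [h0 hW hc hl [Q hQ sw]].
move=> [p [q [r [[Wp Wq Wr] [[pz qz rz] [pq pr qr]]]]]].
have injQ x y : x *m Q = y *m Q -> x = y.
  by move=> e; rewrite -(orthmK x hQ) e orthmK.
exists (p *m Q), (q *m Q), (r *m Q); split.
  by split; apply: (sw _ _).1.
split; first by split; rewrite (sw _ _).2 // ?pz ?qz ?rz.
by split; apply/eqP => /injQ e; [move: pq|move: pr|move: qr]; rewrite e eqxx.
Qed.

Definition regular_level W z (n : nat) := forall t, level_angles W z t ->
    is_gap (level_angles W z) t (2 * pi / n%:R) /\
    forall s, level_angles W z s <->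
      exists j : int, s = t + j%:~R * (2 * pi / n%:R).

Lemma regular_levels W h : axial W h -> three_points W h ->
  exists2 n : nat, (3 <= n)%N & regular_level W h n /\ regular_level W (- h) n.
Proof.
move=> ax th; have tb := three_points_swap ax th.
have [n n3 hn] := level_regular ax (or_introl erefl) th.
have [m m3 hm] := level_regular ax (or_intror erefl) tb.
have [h0 hW hc hl [Q hQ sw]] := ax; have p0 := pi_gt0 R.
have [s [_ [_ _ _ Ks _]]] := three_angles 0 ax th.
have [s' [_ [_ _ _ Ks' _]]] := three_angles 0 ax tb.
(* The swap preserves chords, and the shortest chord of a regular n-gon
   determines n. *)
have le z k l t : (3 <= k)%N -> (3 <= l)%N ->
    regular_level W z k -> regular_level W (- z) l -> level_angles W z t ->
    cos (2 * pi / k%:R) <= cos (2 * pi / l%:R) :> R.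
  move=> k3 l3 hk hl' Kt.
  have [_ hi] := hk _ Kt.
  have Kt1 : level_angles W z (t + 1%:~R * (2 * pi / k%:R)) by apply/hi; exists 1.
  have [W1 z1] := sw _ Kt; have [W2 z2] := sw _ Kt1.
  rewrite vec3E in z1; rewrite vec3E in z2.
  have [u1 e1] := axial_cyl ax W1; have [u2 e2] := axial_cyl ax W2.
  rewrite z1 in e1; rewrite z2 in e2.
  have K1 : level_angles W (- z) u1 by rewrite /level_angles /= -e1.
  have K2 : level_angles W (- z) u2 by rewrite /level_angles /= -e2.
  have [j ej] := ((hl' _ K1).2 _).1 K2.
  have := dot_orth (cyl t z - cyl (t + 1%:~R * (2 * pi / k%:R)) z)
    (cyl t z - cyl (t + 1%:~R * (2 * pi / k%:R)) z) hQ.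
  rewrite !mulmxBl e1 e2 !dot_cylB ej mul1r.
  have -> : u1 + j%:~R * (2 * pi / l%:R) - u1 = j%:~R * (2 * pi / l%:R) by ring.
  have -> : t + 2 * pi / k%:R - t = 2 * pi / k%:R by ring.
  move=> e; have {}e : cos (j%:~R * (2 * pi / l%:R)) = cos (2 * pi / k%:R) :> R by lra.
  rewrite -e; case: (@cos_multiple R l j) => //; first exact: leq_trans l3.
  rewrite e => c1; exfalso.
  have k0 : 3 <= k%:R :> R by rewrite ler_nat.
  have k1 : 0 < k%:R :> R by lra.
  have d0 : 0 < 2 * pi / k%:R :> R by rewrite divr_gt0 // mulr_gt0.
  have d2 : 2 * pi / k%:R < 2 * pi :> R.
    rewrite ltr_pdivrMr // ltr_pMr ?mulr_gt0 //; lra.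
  by have := cos_eq1 (ltW d0) d2 c1; lra.
have le1 := le _ _ _ _ n3 m3 hn hm Ks.
have hn' : regular_level W (- - h) n by rewrite opprK.
have le2 := le _ _ _ _ m3 n3 hm hn' Ks'.
have pos k : (3 <= k)%N -> 0 <= 2 * pi / k%:R :> R /\ 2 * pi / k%:R <= pi :> R.
  move=> k3; have k0 : 3 <= k%:R :> R by rewrite ler_nat.
  have k1 : 0 < k%:R :> R by lra.
  split; first by rewrite divr_ge0 // ?ltW // mulr_gt0.
  by rewrite ler_pdivrMr // mulrC ler_pM2l //; lra.
have [a1 a2] := pos _ n3; have [b1 b2] := pos _ m3.
have e : cos (2 * pi / n%:R) = cos (2 * pi / m%:R) :> R by apply/le_anti/andP.
have {}e := cos_inj0pi a1 a2 b1 b2 e.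
have nm : n = m.
  have pp : 2 * pi != 0 :> R by rewrite gt_eqF // mulr_gt0.
  by move/(mulfI pp)/invr_inj/eqP: e; rewrite eqr_nat => /eqP.
by exists n; rewrite // {2}nm.
Qed.

End PrismsAntiprisms.

(** * Lateral faces, and the classification of the axial case *)

Section LateralFaces.
Variable R : realType.
Local Notation point := 'rV[R]_3.
Local Notation similar := Defs.similar.
Implicit Types (u v w x y p q r : point) (s t z h g : R) (W : set point).

Lemma cos_half t : cos t = 2 * cos (t / 2) ^+ 2 - 1 :> R.
Proof.
have {1}-> : t = t / 2 + t / 2 by field.
by rewrite cosD -!expr2 sin2cos2; ring.
Qed.

Lemma half_turn_fraction (n : nat) : (3 <= n)%N ->
  [/\ 0 < 2 * pi / n%:R :> R, 2 * pi / n%:R < pi :> R,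
    2 * pi / n%:R / 2 = pi / n%:R :> R,
    0 < cos (pi / n%:R) :> R & 0 < sin (pi / n%:R) :> R].
Proof.
move=> n3; have p0 := pi_gt0 R.
have k0 : 3 <= n%:R :> R by rewrite ler_nat.
have k1 : 0 < n%:R :> R by lra.
have q0 : 0 < pi / n%:R :> R by rewrite divr_gt0.
have q1 : pi / n%:R < pi / 2 :> R by rewrite ltr_pM2l // ltf_pV2 ?posrE //; lra.
have e : 2 * pi / n%:R = 2 * (pi / n%:R) :> R by rewrite mulrA.
rewrite e; split; [by rewrite mulr_gt0|lra| |..].
- by rewrite mulrC mulKf.
- by apply: cos_gt0_pihalf; apply/andP; split; lra.
- by apply: sin_gt0_pi; apply/andP; split; lra.
Qed.

(** Neighbouring vertices are [2 * pi / n] apart, so every direction has a vertex within half of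
    that. *)
Lemma regular_level_covering W z (n : nat) s t : (3 <= n)%N ->
  regular_level W z n -> level_angles W z t ->
  exists2 u : R, level_angles W z u & cos (pi / n%:R) <= cos (u - s).
Proof.
move=> n3 hn Kt; have [d0 dpi dh _ _] := half_turn_fraction n3.
set d := 2 * pi / n%:R in d0 dpi dh.
have [j h1 h2] := int_quotient (s - t + d / 2) d0.
exists (t + j%:~R * d); first by apply/(hn _ Kt).2; exists j.
rewrite -dh -(cos_norm (t + _ - s)); apply: ler_cos => //; last by lra.
by rewrite ler_norml; apply/andP; split; lra.
Qed.

(* The lateral facet over a top side whose midpoint has direction m touches the
   bottom in the vertices that are maximal along m. *)
Definition along (m : R) x := cos m * x 0 0 + sin m * x 0 1.
Definition across (m : R) x := cos m * x 0 1 - sin m * x 0 0.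

Lemma along_cyl m t z : along m (cyl t z) = cos (t - m).
Proof. by rewrite /along !vec3E cosB; ring. Qed.

Lemma across_cyl m t z : across m (cyl t z) = sin (t - m).
Proof. by rewrite /across !vec3E sinB; ring. Qed.

Lemma along_across W h m x : axial W h -> W x ->
  along m x ^+ 2 + across m x ^+ 2 = 1.
Proof.
move=> ax Wx; rewrite -(ax_circle ax Wx) -[RHS]mul1r -(cos2Dsin2 m).
by rewrite /along /across; ring.
Qed.

Lemma dist_along_across m x y : dot (x - y) (x - y) =
  (along m x - along m y) ^+ 2 + (across m x - across m y) ^+ 2 +
  (x 0 2 - y 0 2) ^+ 2.
Proof.
have e : dot (x - y) (x - y) = 1 * ((x 0 0 - y 0 0) ^+ 2 + (x 0 1 - y 0 1) ^+ 2)
    + (x 0 2 - y 0 2) ^+ 2 by rewrite !coordE; ring.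
by rewrite e -(cos2Dsin2 m) /along /across; ring.
Qed.

Lemma along_across_eq m x y : along m x = along m y ->
  across m x = across m y -> x 0 2 = y 0 2 -> x = y.
Proof.
move=> e1 e2 e3; apply/eqP; rewrite -subr_eq0; apply/eqP; apply: dot_eq0P.
by rewrite (dist_along_across m) e1 e2 e3 !subrr expr0n !addr0.
Qed.

(** A plane through a top side is tilted until it meets the bottom. If it meets two bottom vertices,
    the facet is an isosceles trapezoid, and equal sides make it a square: the prism. If it meets
    one, the facet is an equilateral triangle whose apex lies in the direction of the middle of the
    side: the antiprism. *)
Lemma lateral_facet W h (n : nat) t (s := t + pi / n%:R) : axial W h ->
  (3 <= n)%N -> regular_level W h n -> regular_level W (- h) n ->
  level_angles W h t -> three_points W (- h) ->
  (W (cyl s (- h)) /\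
    4 * h ^+ 2 = 2 * cos (pi / n%:R) - 2 * cos (2 * pi / n%:R)) \/
  (W (cyl t (- h)) /\ 4 * h ^+ 2 = 4 * sin (pi / n%:R) ^+ 2).
Proof.
move=> ax n3 ht hb Kt th.
have [h0 hW hc hl _] := ax.
have [d0 dpi dh cpos spos] := half_turn_fraction n3.
set d := 2 * pi / n%:R in d0 dpi dh *.
set c := cos (pi / n%:R) in cpos *; set o := sin (pi / n%:R) in spos *.
have co : c ^+ 2 + o ^+ 2 = 1 by exact: cos2Dsin2.
have es : s = t + d / 2 by rewrite dh.
have cd : cos d = 2 * c ^+ 2 - 1 by rewrite cos_half dh.
have [hgap hall] := ht _ Kt.
pose p0 := cyl t h; pose p1 := cyl (t + d) h.
have Wp0 : W p0 by [].
have Wp1 : W p1 by have [] := hgap.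
have X0 : along s p0 = c.
  rewrite along_cyl es; have -> : t - (t + d / 2) = - (d / 2) by ring.
  by rewrite cosN dh.
have X1 : along s p1 = c.
  rewrite along_cyl es; have -> : t + d - (t + d / 2) = d / 2 by field.
  by rewrite dh.
have Y0 : across s p0 = - o.
  rewrite across_cyl es; have -> : t - (t + d / 2) = - (d / 2) by ring.
  by rewrite sinN dh.
have Y1 : across s p1 = o.
  rewrite across_cyl es; have -> : t + d - (t + d / 2) = d / 2 by field.
  by rewrite dh.
have top x : W x -> x 0 2 = h ->
    along s x <= c /\ (along s x = c -> x = p0 \/ x = p1).
  move=> Wx xh; have [u eu] := axial_cyl ax Wx; rewrite xh in eu.
  have Ku : level_angles W h u by rewrite /level_angles /= -eu.
  have [|le eq] := gap_support (@level_period R W h) Kt hgap _ Ku.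
    by have := pi_gt0 R; lra.
  have e : along s x = cos (u - t - d / 2).
    by rewrite eu along_cyl es; congr cos; ring.
  rewrite e -[c]/(cos _) -dh; split=> // /eq [j [] ej].
    by left; rewrite eu ej cyl_period.
  by right; rewrite eu ej cyl_period.
pose B := W `&` [set x | x 0 2 = - h].
have [b0 [_ [_ [[Wb0 _ _] [[b0h _ _] _]]]]] := th.
have fB : finite_set B by apply: sub_finite_set (vs_finite hW) => x [].
have [|w [Ww /= wh] hw] := finite_argmax (along s) fB; first by exists b0.
pose e := along s w.
(* Keeps [e] positive, which later excludes [e = - c] and [e = -1]. *)
have ce : c <= e.
  have [u eu] := axial_cyl ax Wb0; rewrite b0h in eu.
  have Ku : level_angles W (- h) u by rewrite /level_angles /= -eu.
  have [u' Ku' le] := regular_level_covering s n3 hb Ku.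
  have := hw (cyl u' (- h)); rewrite along_cyl => /(_ _)/(le_trans le); apply.
  by split=> //=; rewrite vec3E.
have hh0 : 2 * h != 0 by rewrite mulf_neq0 // gt_eqF.
(* The slope at which the top side and the bottom maximum reach the same level:
   [c + l * h = e - l * h]. *)
pose l := (e - c) / (2 * h).
have lh : l * h = (e - c) / 2 by rewrite /l; field; rewrite gt_eqF.
pose a : point := vec3 (cos s) (sin s) l.
have aE x : dot a x = along s x + l * x 0 2 by rewrite !coordE /along.
pose k := c + l * h.
have k' : k = e - l * h by rewrite /k lh; field.
have a0 : a != 0.
  apply/eqP => a0; have := aE p0; have := aE w.
  rewrite a0 !dot0l X0 vec3E wh -/e mulrN; lra.
have n01 : p0 != p1.
  by apply/eqP => e1; move: Y1; rewrite -e1 Y0; move: spos; lra.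
have nw : noncollinear p0 p1 w.
  by apply: (axial_noncollinear h0) => //; rewrite !vec3E // wh lt_eqF //; lra.
have on x : W x -> dot a x <= k /\
    (dot a x = k <-> (x = p0 \/ x = p1) \/ (x 0 2 = - h /\ along s x = e)).
  move=> Wx; rewrite aE; case: (hl _ Wx) => xh; rewrite xh.
    have [le eq] := top _ Wx xh; rewrite /k lerD2r; split=> //.
    split=> [/addIr /eq|[[->|->]|[e1 _]]]; [by left|by rewrite X0|by rewrite X1|].
    by exfalso; move: h0; lra.
  have le : along s x <= e by apply: hw.
  rewrite k' mulrN; split; first by rewrite lerD2r.
  split=> [/addIr e1|[[ex|ex]|[_ ->] //]]; first by right.
    by exfalso; move: xh; rewrite ex vec3E; move: h0; lra.
  by exfalso; move: xh; rewrite ex vec3E; move: h0; lra.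
have hf : facet W a k.
  split=> [x /on []//|]; exists p0, p1, w; split=> //; split=> //.
  - by apply/(on _ Wp0).2; left; left.
  - by apply/(on _ Wp1).2; left; right.
  - by apply/(on _ Ww).2; right.
have ww := along_across s ax Ww; rewrite -/e in ww.
set y := across s w in ww.
have p01 : dot (p0 - p1) (p0 - p1) = 4 * o ^+ 2.
  by rewrite (dist_along_across s) X0 X1 Y0 Y1 !vec3E; ring.
have [[w' [Ww' wh' Xw' Yw']]|none] := pselect (exists w',
    [/\ W w', w' 0 2 = - h, along s w' = e & across s w' != y]).
- right.
  have Yn : across s w' = - y.
    have := along_across s ax Ww'; rewrite Xw' -ww => /addrI /eqP.
    by rewrite eqf_sqr (negPf Yw') => /eqP.
  have bot x : W x -> x 0 2 = - h -> along s x = e -> x = w \/ x = w'.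
    move=> Wx xh Xx; have := along_across s ax Wx; rewrite Xx -ww => /addrI /eqP.
    rewrite eqf_sqr => /orP[]/eqP yx; [left|right];
      by apply: (@along_across_eq s); rewrite ?Xx ?Xw' ?Yn ?yx ?xh.
  have kw : dot a w = k by apply/(on _ Ww).2; right.
  have kw' : dot a w' = k by apply/(on _ Ww').2; right.
  have kp0 : dot a p0 = k by apply/(on _ Wp0).2; left; left.
  have kp1 : dot a p1 = k by apply/(on _ Wp1).2; left; right.
  have all x : W x -> dot a x = k -> [\/ x = p0, x = p1, x = w | x = w'].
    move=> Wx xk; have [h1 _] := (on _ Wx).2; case: (h1 xk) => [[->|->]|[xh Xx]].
    - by constructor 1.
    - by constructor 2.
    by case: (bot x) => // ->; [constructor 3|constructor 4].
  have e3 x : dot (vec3 0 0 1) x = x 0 2 by rewrite !coordE; ring.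
  have hne : - h != h by rewrite lt_eqF //; lra.
  have nww : w != w' by apply: contra Yw' => /eqP <-.
  (* Within the facet the vertical direction singles out the top side, and its opposite the bottom
     side. *)
  have s1 : side_of W a k p0 p1.
    split=> //; exists (vec3 0 0 1), h => x Wx xk; rewrite e3.
    split; first by case: (hl _ Wx) => ->; move: h0; clear; lra.
    split=> [xh|[->|->]]; rewrite ?vec3E //.
    case: (all x Wx xk) => ex; [by left|by right|exfalso|exfalso].
      by move: xh hne; rewrite ex wh => ->; rewrite eqxx.
    by move: xh hne; rewrite ex wh' => ->; rewrite eqxx.
  have s2 : side_of W a k w w'.
    split=> //; exists (- vec3 0 0 1), h => x Wx xk; rewrite dotNl e3.
    split; first by case: (hl _ Wx) => ->; move: h0; clear; lra.
    split=> [xh|[->|->]]; rewrite ?wh ?wh' ?opprK //.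
    have {}xh : x 0 2 = - h by move: xh; clear; lra.
    case: (all x Wx xk) => ex; [exfalso|exfalso|by left|by right].
      by move: hne; rewrite -xh ex vec3E eqxx.
    by move: hne; rewrite -xh ex vec3E eqxx.
  have := vs_side hW a0 hf s1 s2; rewrite p01 (dist_along_across s) Xw' Yn wh wh'.
  rewrite -/e -/y !subrr expr0n addr0 add0r => e4.
  have yo : y ^+ 2 = o ^+ 2 by move: e4; clear; lra.
  have ec : e = c.
    have /eqP : e ^+ 2 = c ^+ 2 by lra.
    by rewrite eqf_sqr => /orP[]/eqP //; lra.
  pose q0 := cyl t (- h).
  have Xq : along s q0 = c by rewrite -X0 !along_cyl.
  have Yq : across s q0 = - o by rewrite -Y0 !across_cyl.
  have qh : q0 0 2 = - h by rewrite vec3E.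
  have [Wq qq] : W q0 /\ (q0 = w \/ q0 = w').
    move/eqP: yo; rewrite eqf_sqr => /orP[]/eqP yo.
      have e5 : q0 = w'.
        by apply: (@along_across_eq s); rewrite ?Xq ?Xw' ?Yq ?Yn ?yo ?qh ?wh'.
      by rewrite e5; split=> //; right.
    have e5 : q0 = w.
      by apply: (@along_across_eq s); rewrite ?Xq ?Yq ?qh ?wh -/e -/y ?yo ?ec.
    by rewrite e5; split=> //; left.
  split=> //.
  (* The lateral side is singled out by the direction tangent to the circle, in which [- across s]
     is measured. *)
  have s3 : side_of W a k p0 q0.
    split.
    - apply/eqP => /(congr1 (fun x : point => x 0 2)); rewrite qh vec3E.
      by move: h0; clear; lra.
    - by [].
    - by split=> //; case: qq => ->.
    exists (vec3 (sin s) (- cos s) 0), o => x Wx xk.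
    have -> : dot (vec3 (sin s) (- cos s) 0) x = - across s x.
      by rewrite !coordE /across; ring.
    have yx : across s x = o \/ across s x = - o.
      have := along_across s ax Wx; have -> : along s x = c.
        by case: (all x Wx xk) => ->; rewrite ?X0 ?X1 ?Xw' // -ec.
      rewrite -co => /addrI /eqP; rewrite eqf_sqr => /orP[]/eqP ->; by [left|right].
    split; first by case: yx => ->; move: spos; clear; lra.
    split=> [e7|[->|->]]; [|by rewrite Y0 opprK|by rewrite Yq opprK].
    have yx' : across s x = - o by move: e7; clear; lra.
    case: (all x Wx xk) => ex.
    - by left.
    - by exfalso; move: yx' spos; rewrite ex Y1; clear; lra.
    - right; apply: (@along_across_eq s); rewrite ?Xq ?Yq ?qh ?yx' //.
        by rewrite ex -/e ec.
      by rewrite ex wh.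
    - right; apply: (@along_across_eq s); rewrite ?Xq ?Yq ?qh ?yx' //.
        by rewrite ex Xw' ec.
      by rewrite ex wh'.
  have := vs_side hW a0 hf s1 s3; rewrite p01 (dist_along_across s).
  by rewrite X0 Y0 Xq Yq qh vec3E; lra.
- left.
  have bot x : W x -> x 0 2 = - h -> along s x = e -> x = w.
    move=> Wx xh Xx; have [yx|yn] := eqVneq (across s x) y.
      by apply: (@along_across_eq s); rewrite ?Xx ?xh ?wh.
    by exfalso; apply: none; exists x.
  have all x : W x -> dot a x = k <-> [\/ x = p0, x = p1 | x = w].
    move=> Wx; rewrite (on _ Wx).2; split=> [[[->|->]|[xh Xx]]|[]->].
    - by constructor 1.
    - by constructor 2.
    - by constructor 3; apply: bot.
    - by left; left.
    - by left; right.
    - by right.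
  have [f1 f2] := triangular_facet_sides hW a0 hf nw Wp0 Wp1 Ww all.
  move: f1 f2; rewrite p01 !(dist_along_across s) X0 X1 Y0 Y1 !vec3E wh -/e -/y.
  move=> f1 f2.
  have y0 : y = 0.
    have /eqP : y * o = 0 by lra.
    by rewrite mulf_eq0 (gt_eqF spos) orbF => /eqP.
  have e1 : e = 1.
    have /eqP : e ^+ 2 = 1 ^+ 2 by move: ww; rewrite y0; lra.
    by rewrite eqf_sqr => /orP[]/eqP //; lra.
  split; last by rewrite cd; move: f2; rewrite e1 y0; lra.
  have <- : w = cyl s (- h) by
    apply: (@along_across_eq s); rewrite ?along_cyl ?across_cyl ?subrr ?cos0
      ?sin0 ?vec3E.
  by [].
Qed.

Definition turn_z (t : R) : 'M[R]_3 :=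
  mat3 (vec3 (cos t) (sin t) 0) (vec3 (- sin t) (cos t) 0) (vec3 0 0 1).

Lemma turn_z_orth t : orthm (turn_z t).
Proof.
have e := cos2Dsin2 t.
by apply: orthm_mat3; split; split; rewrite !coordE; lra.
Qed.

Lemma turn_z_cyl s t z : aff 1 (turn_z s) 0 (cyl t z) = cyl (t + s) z.
Proof.
rewrite /aff scale1r addr0 mat3E; apply: vec3P; rewrite !coordE ?cosD ?sinD; ring.
Qed.

Lemma int_ord (n : nat) (j : int) : (0 < n)%N -> exists (k : 'I_n) (i : int),
  j = k%:Z + i * n%:Z.
Proof.
move=> n0; have nz : n%:Z != 0 by rewrite eqz_nat -lt0n.
have lt : (`|(j %% n)%Z| < n)%N.
  by rewrite -ltz_nat gez0_abs ?modz_ge0 // ltz_pmod.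
exists (Ordinal lt), (j %/ n)%Z; rewrite /= gez0_abs ?modz_ge0 //.
by rewrite addrC -divz_eq.
Qed.

Lemma axial_prism W h (n : nat) t : axial W h -> (3 <= n)%N ->
  regular_level W h n -> regular_level W (- h) n -> level_angles W h t ->
  level_angles W (- h) t -> h = sin (pi / n%:R) ->
  similar (@prism_vertices R n) W.
Proof.
move=> ax n3 ht hb Kt Kb eh.
have n0 : (0 < n)%N by exact: leq_trans n3.
have nR : n%:R != 0 :> R by rewrite pnatr_eq0 -lt0n.
have h0 := ax_height ax.
apply/similarP; exists 1, (turn_z t), 0; split; rewrite ?ltr01 //.
  exact: turn_z_orth.
have lev z : z = h \/ z = - h -> level_angles W z t /\ regular_level W z n.
  by case=> ->.
apply/seteqP; split=> [_ [v [k [v0 v1 v2]] <-]|x Wx].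
  have vz : v 0 2 = h \/ v 0 2 = - h.
    by apply: norm_cases; [exact: ltW|rewrite v2 eh].
  have -> : v = cyl (k%:R * (2 * pi / n%:R)) (v 0 2).
    by apply: vec3P; rewrite !vec3E.
  rewrite turn_z_cyl; have [K1 hr] := lev _ vz.
  have [_ hi] := hr _ K1; apply/hi; exists k%:Z.
  by rewrite addrC -pmulrn.
have xz := ax_level ax Wx; have [K1 hr] := lev _ xz.
have [u eu] := axial_cyl ax Wx.
have Ku : level_angles W (x 0 2) u by rewrite /level_angles /= -eu.
have [j ej] := ((hr _ K1).2 _).1 Ku.
have [k [i ji]] := int_ord j n0.
exists (cyl (k%:R * (2 * pi / n%:R)) (x 0 2)).
  exists k; split; rewrite !vec3E // -eh.
  by case: xz => ->; rewrite ?normrN gtr0_norm.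
rewrite turn_z_cyl eu ej ji -(cyl_period _ _ i) vec3E; congr cyl.
by rewrite rmorphD rmorphM /= -!pmulrn; field.
Qed.

Lemma axial_antiprism W h (n : nat) t : axial W h -> (3 <= n)%N ->
  regular_level W h n -> regular_level W (- h) n -> level_angles W h t ->
  level_angles W (- h) (t + pi / n%:R) -> h = antiprism_height R n ->
  similar (@antiprism_vertices R n) W.
Proof.
move=> ax n3 ht hb Kt Kb eh.
have n0 : (0 < n)%N by exact: leq_trans n3.
have nR : n%:R != 0 :> R by rewrite pnatr_eq0 -lt0n.
apply/similarP; exists 1, (turn_z t), 0; split; rewrite ?ltr01 //.
  exact: turn_z_orth.
(* [b] is the parity of the index of a vertex: even on the top level, odd on the bottom level, which
   is turned by [pi / n]. *)
have lev (b : bool) : level_angles W ((-1) ^+ b * h) (t + b%:R * (pi / n%:R)) /\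
    regular_level W ((-1) ^+ b * h) n.
  by case: b; rewrite ?expr1 ?expr0 ?mulN1r ?mul1r ?mul0r ?addr0.
apply/seteqP; split=> [_ [v [k [v0 v1 v2]] <-]|x Wx].
  have -> : v = cyl (k%:R * (pi / n%:R)) (v 0 2).
    by apply: vec3P; rewrite !vec3E.
  rewrite turn_z_cyl v2 -signr_odd -eh; have [K1 hr] := lev (odd k).
  have [_ hi] := hr _ K1; apply/hi; exists (k./2)%:Z.
  have ek (m : nat) : m%:R = (odd m)%:R + (m./2)%:R * 2 :> R.
    by rewrite -{1}(odd_double_half m) natrD -muln2 natrM.
  by rewrite -pmulrn (ek k); field.
have [b xb] : exists b : bool, x 0 2 = (-1) ^+ b * h.
  case: (ax_level ax Wx) => ->; first by exists false; rewrite mul1r.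
  by exists true; rewrite expr1 mulN1r.
have [K1 hr] := lev b.
have [u eu] := axial_cyl ax Wx.
have Ku : level_angles W ((-1) ^+ b * h) u by rewrite /level_angles /= -xb -eu.
have [j ej] := ((hr _ K1).2 _).1 Ku.
have [k [i ji]] := int_ord j n0.
have lt : (b + k.*2 < n.*2)%N.
  have : (k.*2.+1 < n.*2)%N by rewrite -doubleS leq_double.
  by case: b {xb K1 hr Ku ej} => // /ltnW.
exists (cyl ((b + k.*2)%:R * (pi / n%:R)) (x 0 2)).
  exists (Ordinal lt); split; rewrite !vec3E //= xb eh.
  by rewrite -[in RHS]signr_odd oddD odd_double addbF oddb.
rewrite turn_z_cyl eu ej ji -(cyl_period _ _ i) vec3E; congr cyl.
by rewrite intrD intrM -!pmulrn natrD -muln2 natrM; field.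
Qed.

Lemma sqr_pos_inj (x y : R) : 0 < x -> 0 <= y -> x ^+ 2 = y ^+ 2 -> x = y.
Proof.
move=> x0 y0 /eqP; rewrite eqf_sqr => /orP[]/eqP //; lra.
Qed.

Lemma axial_classification W h : axial W h ->
  [\/ similar (@tetrahedron_vertices R) W,
    exists2 n, (3 <= n)%N & similar (@prism_vertices R n) W
  | exists2 n, (3 <= n)%N & similar (@antiprism_vertices R n) W].
Proof.
move=> ax; have [th|few] := pselect (three_points W h); last first.
  by constructor 1; apply: axial_few_tetrahedron ax few.
have [n n3 [ht hb]] := regular_levels ax th.
have tb := three_points_swap ax th.
have [s [_ [_ _ _ Kt _]]] := three_angles 0 ax th.
have h0 := ax_height ax.
have [d0 dpi dh cpos spos] := half_turn_fraction n3.
case: (lateral_facet ax n3 ht hb Kt tb) => -[Wb e].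
  constructor 3; exists n => //; apply: axial_antiprism ht hb Kt Wb _ => //.
  (* The double-angle formula turns the height found into the square of [antiprism_height]. *)
  have e2 : h ^+ 2 = sin (pi / n%:R) ^+ 2 - sin (pi / n%:R / 2) ^+ 2.
    move: e; rewrite (cos_half (2 * pi / _)) dh (cos_half (pi / _)).
    by rewrite !sin2cos2 (cos_half (pi / _)); lra.
  apply: sqr_pos_inj => //; first exact: sqrtr_ge0.
  by rewrite sqr_sqrtr -e2 // sqr_ge0.
constructor 2; exists n => //; apply: axial_prism ht hb Kt Wb _ => //.
by apply: sqr_pos_inj => //; [exact: ltW|lra].
Qed.

End LateralFaces.

(** * Facet directions of Archimedean solids, cubes, prisms and antiprisms *)

Section Directions.
Variable R : realType.
Local Notation point := 'rV[R]_3.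
Local Notation similar := Defs.similar.
Implicit Types (u v w x y p q r : point) (k h c : R) (P W S T : set point).
Implicit Types (a : 'I_4 -> point).

Lemma tetra_dirs_conv W : tetra_dirs (conv_hull W) <-> tetra_dirs W.
Proof.
by split=> -[a [k [fa h]]]; exists a, k; split=> // i; apply/facet_conv.
Qed.

Lemma archimedean_dirs S : archimedean S -> tetra_dirs S.
Proof.
move=> [uS npl npr nanti]; have [W0 hW0 sim0] := uniform_vertex_set uS.
have [x0 Wx0] := full_nonempty (vs_full hW0).
have n0 : 0 < dot x0 x0.
  apply: dot_gt0; apply/eqP => e.
  have [|x Wx] := full_dot (u := vec3 1 0 0) (vs_full hW0).
    by rewrite -dot_eq0 !coordE !(mulr0, addr0, mulr1) oner_eq0.
  suff -> : x = 0 by rewrite dot0r eqxx.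
  by apply: dot_eq0P; rewrite (vertex_set_sphere hW0 Wx Wx0) e dot0l.
(* The vertices are brought to the unit sphere, where they can be compared with axes. *)
pose c := (Num.sqrt (dot x0 x0))^-1.
have c0 : 0 < c by rewrite invr_gt0 sqrtr_gt0.
pose W := aff c 1%:M 0 @` W0.
have hW : vertex_set W by apply: vertex_set_image => //; exact: orthm1.
have simW : similar W0 W.
  by apply/similarP; exists c, 1%:M, 0; split=> //; exact: orthm1.
have sim : similar (conv_hull W) S.
  exact: similar_trans (similar_conv (similar_sym simW)) sim0.
have W1 x : W x -> dot x x = 1.
  move=> [y Wy <-]; rewrite /aff addr0 dotZl dotZr mulmx1.
  rewrite (vertex_set_sphere hW0 Wy Wx0) mulrA -expr2 exprVn.
  by rewrite sqr_sqrtr ?dot_ge0 // mulVf // gt_eqF.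
clearbody W; have simS V : similar V W -> similar (conv_hull V) S.
  by move=> hV; apply: similar_trans sim; exact: similar_conv.
have [irr|nirr] := pselect (irreducible_group (rotations W)); last first.
  have [W' [h [simW' ax]]] := axial_exists hW nirr.
  exfalso; case: (axial_classification ax) => [hs|[n n3 hs]|[n n3 hs]].
  - apply: npl; constructor 1; apply: simS.
    exact: similar_trans hs (similar_sym simW').
  - apply: npr; exists n => //; apply: simS.
    exact: similar_trans hs (similar_sym simW').
  - apply: nanti; exists n => //; apply: simS.
    exact: similar_trans hs (similar_sym simW').
have tr v w : W v -> W w -> exists2 Q, symm W Q & v *m Q = w.
  by move=> Wv Ww; have [Q [hQ sQ e]] := vs_trans hW Wv Ww; exists Q.
case: (irreducible_dirs (vs_finite hW) (vs_full hW) W1 tr irr).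
  by move=> /tetra_dirs_conv; apply: tetra_dirs_similar.
move=> [Wn [s ss Ws]]; exfalso; apply: npl.
case: (third_turn_solids (vs_finite hW) (vs_full hW) W1 Wn ss Ws) => hs.
  by constructor 2; apply/simS/similar_sym.
by constructor 4; left; apply/simS/similar_sym.
Qed.

(** A tetrahedral frame is a tight frame: in cube coordinates the mixed terms cancel among the four
    sign patterns. *)
Lemma tetra_frame_squares a x : tetra_frame a ->
  \sum_i dot (a i) x ^+ 2 = 4 / 3 * dot x x.
Proof.
move=> fa; have [Q hQ e] := tetra_frame_std fa.
have ea i : dot (a i) x ^+ 2 = 3^-1 * dot (tetra_vertex R i) (x *m Q^T) ^+ 2.
  by rewrite -dot_orthl // e dotZl exprMn sqr_sqrtr //; field.
rewrite (eq_bigr _ (fun i _ => ea i)) -(dot_orth x x (orthmT hQ)).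
move: (x *m Q^T) => y; rewrite big_ord4 /tetra_vertex /= !coordE.
by field.
Qed.

Lemma unit_coord_sum (v : point) : dot v v = v 0 0 ^+ 2 + v 0 1 ^+ 2 + v 0 2 ^+ 2.
Proof. by rewrite !coordE; ring. Qed.

(** The four squares would sum to an integer, not to 4/3. *)
Lemma no_dirs_01 W (e : point) : dot e e = 1 ->
  (forall v k, dot v v = 1 -> facet W v k ->
    dot v e ^+ 2 = 0 \/ dot v e ^+ 2 = 1) -> ~ tetra_dirs W.
Proof.
move=> ee h [a [k [fa hf]]]; have := tetra_frame_squares e fa.
rewrite ee big_ord4.
by case: (h _ _ (fa.1 0) (hf 0)) => ->; case: (h _ _ (fa.1 1) (hf 1)) => ->;
  case: (h _ _ (fa.1 2) (hf 2)) => ->; case: (h _ _ (fa.1 3) (hf 3)) => ->; lra.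
Qed.

Definition flip (i : 'I_3) v : point := \row_j (if j == i then - v 0 j else v 0 j).

Lemma flip_dot i v w : dot w (flip i v) = dot w v - 2 * (w 0 i * v 0 i).
Proof. by case: (ord3P i) => ->; rewrite !dotE !mxE /=; ring. Qed.

(* Flipping the sign of a coordinate of a vertex cannot increase a functional
   that is maximal there. *)
Lemma flip_max W i u v k : (forall w, W w -> W (flip i w)) ->
  (forall w, W w -> dot u w <= k) -> W v -> dot u v = k -> 0 <= u 0 i * v 0 i.
Proof. by move=> hW h Wv e; have := h _ (hW _ Wv); rewrite flip_dot e; lra. Qed.

Lemma same_sign (x y z : R) : 0 <= x * y -> 0 <= x * z -> x != 0 ->
  `|y| = `|z| -> y = z.
Proof.
move=> h1 h2 x0 e; case: (ltrgtP x 0) x0 => // x0 _.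
  have y0 : y <= 0 by rewrite -(nmulr_rge0 _ x0).
  have z0 : z <= 0 by rewrite -(nmulr_rge0 _ x0).
  by move: e; rewrite !ler0_norm //; lra.
have y0 : 0 <= y by rewrite -(pmulr_rge0 _ x0).
have z0 : 0 <= z by rewrite -(pmulr_rge0 _ x0).
by move: e; rewrite !ger0_norm.
Qed.

Lemma collinear_coords (i j : 'I_3) p q r : i != j -> p 0 i = q 0 i ->
  p 0 i = r 0 i -> p 0 j = q 0 j -> p 0 j = r 0 j -> ~ noncollinear p q r.
Proof.
move=> ij e1 e2 e3 e4 /eqP; apply.
by move: ij e1 e2 e3 e4; case: (ord3P i) => ->; case: (ord3P j) => -> // _;
  move=> e1 e2 e3 e4; apply: vec3P; rewrite !coordE -?e1 -?e2 -?e3 -?e4; ring.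
Qed.

Lemma flip_cube i v : cube_vertices v -> cube_vertices (flip i v).
Proof. by move=> h j; rewrite mxE; case: ifP; rewrite ?normrN h. Qed.

(** Two non-zero coordinates of the normal would fix the same two coordinates of all contact points
    and make them collinear, so the normal lies on an axis. *)
Lemma cube_no_dirs : ~ tetra_dirs (@cube_vertices R).
Proof.
have e1 : dot (vec3 1 0 0) (vec3 1 0 0) = 1 :> R by rewrite !coordE; ring.
apply: (no_dirs_01 e1) => v k vv [hv [p [q [r [[Cp pk] [Cq qk] [Cr rk] n0]]]]].
have ve : dot v (vec3 1 0 0) = v 0 0 by rewrite !coordE; ring.
rewrite ve; have [->|v0] := eqVneq (v 0 0) 0; first by left; rewrite expr0n.
have fm i := flip_max (fun w => @flip_cube i w) hv.
have same i : v 0 i != 0 -> p 0 i = q 0 i /\ p 0 i = r 0 i.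
  move=> vi; split; apply: (same_sign (x := v 0 i)) => //; try exact: fm.
    by rewrite Cp Cq.
  by rewrite Cp Cr.
have [a1 a2] := same _ v0.
have z i : i != 0 -> v 0 i = 0.
  move=> i0; apply/eqP/negPn/negP => vi; have [b1 b2] := same _ vi.
  by rewrite eq_sym in i0; exact: (collinear_coords i0 a1 a2 b1 b2 n0).
right; rewrite -vv unit_coord_sum (z 1) // (z 2) //.
by rewrite !expr0n !addr0.
Qed.

(** Three noncollinear points of one level span the horizontal directions. *)
Lemma horizontal_collinear u p q r : dot u p = dot u q -> dot u p = dot u r ->
  p 0 2 = q 0 2 -> p 0 2 = r 0 2 -> noncollinear p q r ->
  u 0 0 = 0 /\ u 0 1 = 0.
Proof.
move=> e1 e2 e3 e4 n0.
have c2 : cross (q - p) (r - p) 0 2 != 0.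
  apply: contra n0 => /eqP c2; apply/eqP; apply: vec3P; rewrite ?c2 !coordE //.
    by rewrite -e3 -e4; ring.
  by rewrite -e3 -e4; ring.
move: e1 e2 c2; rewrite !coordE -e3 -e4 => e1 e2 c2.
set d := (X in X != 0) in c2.
have h0 : u 0 0 * d = 0.
  transitivity ((u 0 0 * (q 0 0 - p 0 0) + u 0 1 * (q 0 1 - p 0 1)) * (r 0 1 - p 0 1)
   - (u 0 0 * (r 0 0 - p 0 0) + u 0 1 * (r 0 1 - p 0 1)) * (q 0 1 - p 0 1)).
    by rewrite /d; ring.
  have -> : u 0 0 * (q 0 0 - p 0 0) + u 0 1 * (q 0 1 - p 0 1) = 0 by lra.
  have -> : u 0 0 * (r 0 0 - p 0 0) + u 0 1 * (r 0 1 - p 0 1) = 0 by lra.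
  by rewrite !mul0r subrr.
have h1 : u 0 1 * d = 0.
  transitivity ((u 0 0 * (r 0 0 - p 0 0) + u 0 1 * (r 0 1 - p 0 1)) * (q 0 0 - p 0 0)
   - (u 0 0 * (q 0 0 - p 0 0) + u 0 1 * (q 0 1 - p 0 1)) * (r 0 0 - p 0 0)).
    by rewrite /d; ring.
  have -> : u 0 0 * (q 0 0 - p 0 0) + u 0 1 * (q 0 1 - p 0 1) = 0 by lra.
  have -> : u 0 0 * (r 0 0 - p 0 0) + u 0 1 * (r 0 1 - p 0 1) = 0 by lra.
  by rewrite !mul0r subrr.
by split; apply/eqP; [move/eqP: h0|move/eqP: h1]; rewrite mulf_eq0 (negPf c2) orbF.
Qed.

Lemma flip_prism n v : prism_vertices n v -> prism_vertices n (flip 2 v).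
Proof.
move=> [i [h0 h1 h2]]; exists i; rewrite !mxE /= h0 h1 normrN h2; split=> //.
Qed.

(** If the normal is not horizontal, comparison with the mirror images puts all contact points on
    one level, so the normal is vertical. *)
Lemma prism_no_dirs n : ~ tetra_dirs (@prism_vertices R n).
Proof.
have e1 : dot (vec3 0 0 1) (vec3 0 0 1) = 1 :> R by rewrite !coordE; ring.
apply: (no_dirs_01 e1) => v k vv [hv [p [q [r [[Cp pk] [Cq qk] [Cr rk] n0]]]]].
have ve : dot v (vec3 0 0 1) = v 0 2 by rewrite !coordE; ring.
rewrite ve; have [->|v0] := eqVneq (v 0 2) 0; first by left; rewrite expr0n.
have fm := flip_max (@flip_prism n) hv.
have nz x : prism_vertices n x -> `|x 0 2| = sin (pi / n%:R) by move=> [? []].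
have pq : p 0 2 = q 0 2.
  by apply: (same_sign (x := v 0 2)) => //; rewrite ?fm // !nz.
have pr : p 0 2 = r 0 2.
  by apply: (same_sign (x := v 0 2)) => //; rewrite ?fm // !nz.
have [||h0 h1] := @horizontal_collinear v p q r _ _ pq pr n0; rewrite ?pk ?qk ?rk //.
by right; rewrite -vv unit_coord_sum h0 h1 expr0n !add0r.
Qed.

(** Indexed by all integers, so that shifts of the index involve no reduction modulo [n]; [b]
    selects the base. *)
Definition antiprism_point (n : nat) (b : bool) (j : int) : point :=
  cyl ((2 * j + b)%:~R * (pi / n%:R)) ((-1) ^+ b * antiprism_height R n).

Lemma antiprism_pointP n v : (0 < n)%N ->
  antiprism_vertices n v <-> exists b j, v = antiprism_point n b j.
Proof.
move=> n0; have nR : n%:R != 0 :> R by rewrite pnatr_eq0 -lt0n.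
split=> [[k [v0 v1 v2]]|[b [j ->]]].
  have ek (m : nat) : (2 * (m./2)%:Z + odd m)%:~R = m%:R :> R.
    rewrite intrD intrM -!pmulrn -[X in _ = X%:R](odd_double_half m).
    by rewrite natrD -muln2 natrM; ring.
  exists (odd k), (k./2)%:Z; apply: vec3P; rewrite !vec3E ?ek //.
  by rewrite v2 signr_odd.
have [k [i ji]] := int_ord j n0.
have lt : (b + k.*2 < n.*2)%N.
  have : (k.*2.+1 < n.*2)%N by rewrite -doubleS leq_double.
  by case: b => // /ltnW.
have e : (2 * j + b)%:~R * (pi / n%:R) =
    (b + k.*2)%:R * (pi / n%:R) + i%:~R * (2 * pi) :> R.
  rewrite ji !(intrD, intrM) -!pmulrn natrD -muln2 natrM; field.
  exact: nR.
exists (Ordinal lt); rewrite /antiprism_point e cyl_period !vec3E /=; split=> //.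
by rewrite -[in RHS]signr_odd oddD odd_double addbF oddb.
Qed.

Lemma parity_int (m : int) : exists (b : bool) (j : int), m = 2 * j + b.
Proof.
exists (odd `|(m %% 2)%Z|), (m %/ 2)%Z.
have h1 : (0 <= (m %% 2)%Z) by apply: modz_ge0.
have h2 : (m %% 2)%Z < 2 by apply: ltz_pmod.
rewrite {1}(divz_eq m 2) mulrC; congr (_ + _).
by move: h1 h2; case: (m %% 2)%Z => [[|[|k]]|].
Qed.

(** A lateral facet has two vertices on one base and one on the other. Comparison with neighbouring
    vertices bounds the squared vertical part of the normal by [(1 - C) / (3 * (1 + C))] for
    [C = cos (pi / n)], and [C > 1 / 2] for [4 <= n]. *)
Lemma antiprism_facet n v k : (4 <= n)%N -> dot v v = 1 ->
  facet (@antiprism_vertices R n) v k -> v 0 2 ^+ 2 = 1 \/ v 0 2 ^+ 2 < 1 / 9.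
Proof.
move=> n4 vv [hv [p [q [r [[Ap pk] [Aq qk] [Ar rk] n0]]]]].
have n3 : (3 <= n)%N by exact: leq_trans n4.
have np : (0 < n)%N by exact: leq_trans n4.
have nR : n%:R != 0 :> R by rewrite pnatr_eq0 -lt0n.
have p0 := pi_gt0 R.
have [d0 dpi dh cpos spos] := half_turn_fraction R n3.
pose rho2 := v 0 0 ^+ 2 + v 0 1 ^+ 2.
have vv' : rho2 + v 0 2 ^+ 2 = 1 by rewrite -vv unit_coord_sum.
have [z|nz] := eqVneq rho2 0; first by left; rewrite -vv' z add0r.
right; have r0 : 0 < rho2 by rewrite lt_neqAle eq_sym nz addr_ge0 // sqr_ge0.
pose rho := Num.sqrt rho2.
have rho0 : 0 < rho by rewrite sqrtr_gt0.
have rr : rho ^+ 2 = rho2 by rewrite sqr_sqrtr // ltW.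
have [|m [em0 em1]] := @angle_exists R (v 0 0 / rho) (v 0 1 / rho).
  by rewrite !exprMn -mulrDl exprVn rr mulfV.
have vm0 : v 0 0 = rho * cos m by rewrite -em0 mulrC divfK // gt_eqF.
have vm1 : v 0 1 = rho * sin m by rewrite -em1 mulrC divfK // gt_eqF.
have val t z : dot v (cyl t z) = rho * cos (t - m) + v 0 2 * z.
  by rewrite cosB !coordE vm0 vm1; ring.
pose H := antiprism_height R n; pose al := pi / n%:R : R.
have le (b : bool) (j : int) : rho * cos ((2 * j + b)%:~R * al - m) + v 0 2 * ((-1) ^+ b * H) <= k.
  by rewrite -val; apply: hv; apply/antiprism_pointP => //; exists b, j.
(* Two distinct contact points on one level force the horizontal part of the
   normal to point midway between them, along a multiple of pi / n. *)
have key (b : bool) (j1 j2 j3 : int) : antiprism_point n b j1 <> antiprism_point n b j2 ->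
    dot v (antiprism_point n b j1) = k -> dot v (antiprism_point n b j2) = k ->
    dot v (antiprism_point n (~~ b) j3) = k -> v 0 2 ^+ 2 < 1 / 9.
  rewrite !val -/al -/H => n12 k1 k2 k3.
  set t1 := _ * al in k1; set t2 := _ * al in k2.
  have c12 : cos (t1 - m) = cos (t2 - m).
    have : rho * cos (t1 - m) = rho * cos (t2 - m) by lra.
    by apply: mulfI; rewrite gt_eqF.
  have nt : ~ exists i : int, t2 = t1 + i%:~R * (2 * pi).
    move=> [i e]; apply: n12; rewrite /antiprism_point -/al -/t1 -/t2 e.
    by rewrite cyl_period.
  have [i ei] : exists i : int, t2 - m = - (t1 - m) + i%:~R * (2 * pi).
    have : sin (t1 - m) ^+ 2 = sin (t2 - m) ^+ 2 by rewrite !sin2cos2 c12.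
    move/eqP; rewrite eqf_sqr => /orP[]/eqP s12.
      exfalso; have [i ei] := cos_sin_eq c12 s12; apply: nt; exists i; lra.
    by apply: cos_sin_eq; rewrite ?cosN ?sinN // s12 opprK.
  (* The direction [m] bisects the two contact points modulo half turns, so it is an integer
     multiple of [pi / n]. *)
  pose M : int := j1 + j2 + b - i * n%:Z.
  have em : m = M%:~R * al.
    have {}ei : m = (t1 + t2) / 2 - i%:~R * pi by lra.
    rewrite ei /t1 /t2 /M /al !(intrD, intrM, mulrNz) -!pmulrn; field.
    exact: nR.
  have [b' [j' eM]] := parity_int M.
  have hm : cos ((2 * j' + b')%:~R * al - m) = 1 by rewrite em eM subrr cos0.
  have cn1 : cos (t1 - m) <> 1.
    move=> c1; apply: nt.
    have c2 : cos (t2 - m) = 1 by rewrite -c12.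
    have s1 : sin (t1 - m) = 0 by apply: cos1sin0; rewrite c1 normr1.
    have s2 : sin (t2 - m) = 0 by apply: cos1sin0; rewrite c2 normr1.
    have [j ej] := cos_sin_eq c12 (etrans s1 (esym s2)); exists j; lra.
  (* On the base [b] a vertex in the direction [m] would rise above the two contact points, so [M]
     has the parity of the other base. *)
  have nbb : b' <> b.
    move=> bb; have := le b' j'; rewrite hm bb => h; apply: cn1.
    by apply: le_anti; rewrite cos_le1 /= -(ler_pM2l rho0); lra.
  have bb : b' = ~~ b by move: nbb; case: (b'); case: (b).
  (* The other base has a vertex exactly in the direction [m], where the functional is largest on
     that base. *)
  have hk : k = rho - v 0 2 * ((-1) ^+ b * H).
    have := le b' j'; rewrite hm bb => h.
    have hs : (-1) ^+ (~~ b) * H = - ((-1) ^+ b * H).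
      by case: (b); rewrite /= ?expr1 ?expr0; ring.
    rewrite hs in h k3.
    have := cos_le1 ((2 * j3 + ~~ b)%:~R * al - m).
    rewrite -(ler_pM2l rho0); lra.
  (* The base [b] has a vertex at the angle [pi / n] from [m], so the contact points are at most
     that far from [m]: [C <= w]. *)
  have nb : exists j'' : int, (2 * j'' + b)%:~R * al - m = al.
    exists (j' + (~~ b : nat)%:Z); rewrite em eM bb.
    by case: (b); rewrite /= !(intrD, intrM, mulrNz); ring.
  have [j'' ej''] := nb; have := le b j''; rewrite ej'' => hC.
  set C := cos al in cpos hC; set w := cos (t1 - m) in k1 cn1.
  set Z := v 0 2 * ((-1) ^+ b * H) in k1 hk hC.
  have e2 : 2 * Z = rho * (1 - w) by lra.
  have w1 : w <= 1 by apply: cos_le1.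
  have Cw : rho * C <= rho * w by lra.
  rewrite ler_pM2l // in Cw.
  have Z2 : Z ^+ 2 = v 0 2 ^+ 2 * H ^+ 2.
    rewrite /Z; case: (b); rewrite ?expr1 ?expr0; ring.
  clear -n4 nR p0 d0 dh dpi cpos spos rho0 e2 w1 Cw Z2 rr vv'.
  have al0 : 0 < al by rewrite /al; move: d0 dh; lra.
  have alpi : al < pi / 2 by rewrite /al; move: dpi dh; lra.
  have ca : cos al <= cos (al / 2) by apply: ler_cos; lra.
  have HH : H ^+ 2 = sin al ^+ 2 - sin (al / 2) ^+ 2.
    by rewrite sqr_sqrtr // subr_ge0 !sin2cos2; rewrite -/C in ca *; nra.
  have HH' : 4 * H ^+ 2 = 2 * (1 - C) * (1 + 2 * C).
    rewrite HH !sin2cos2 -/C; have := cos_half al; rewrite -/C; lra.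
  have C12 : 1 / 2 < C.
    have k4 : 4 <= n%:R :> R by rewrite ler_nat.
    have al4 : 2 * al <= pi / 2.
      have qn : al * n%:R = pi by rewrite /al divfK.
      have : al * 4 <= al * n%:R by rewrite ler_pM2l.
      lra.
    have : 0 <= cos (2 * al).
      apply: cos_ge0_pihalf; apply/andP; split; rewrite /al in al4 *; move: d0 dh; lra.
    rewrite (cos_half (2 * al)); have -> : 2 * al / 2 = al by field.
    rewrite -/C; nra.
  have C1 : C < 1.
    rewrite lt_neqAle cos_le1 andbT; apply/eqP => c1; move: spos.
    by rewrite (cos1sin0 (x := pi / n%:R)) ?ltxx // -/al -/C c1 normr1.
  clear -rho0 e2 w1 Cw C12 C1 HH' Z2 rr vv'.
  (* Combines [2 * Z = rho * (1 - w)] with [C <= w]; the height [H] enters next. *)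
  have q1 : 4 * Z ^+ 2 <= rho ^+ 2 * (1 - C) ^+ 2.
    have -> : 4 * Z ^+ 2 = (rho * (1 - w)) ^+ 2 by rewrite -e2; ring.
    by rewrite exprMn ler_pM2l ?exprn_gt0 //; nra.
  have q2 : v 0 2 ^+ 2 * (2 * (1 - C) * (1 + 2 * C)) <= (1 - v 0 2 ^+ 2) * (1 - C) ^+ 2.
    rewrite -HH'; have <- : rho ^+ 2 = 1 - v 0 2 ^+ 2 by rewrite rr; lra.
    by move: q1; rewrite Z2; lra.
  set V := v 0 2 ^+ 2 in q2 *.
  have q3 : V * (2 * (1 + 2 * C)) <= (1 - V) * (1 - C).
    have C1' : 0 < 1 - C by rewrite subr_gt0.
    by rewrite -(ler_pM2r C1'); lra.
  nra.
have [bp [jp ep]] := (antiprism_pointP _ np).1 Ap.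
have [bq [jq eq]] := (antiprism_pointP _ np).1 Aq.
have [br [jr er]] := (antiprism_pointP _ np).1 Ar.
have pq : p <> q by move/eqP: (noncollinear_neq n0).
have qr : q <> r by move/eqP: (noncollinear_neq (noncollinear_rot n0)).
have rp : r <> p.
  by move/eqP: (noncollinear_neq (noncollinear_rot (noncollinear_rot n0))).
have lev (b : bool) (j : int) : antiprism_point n b j 0 2 = (-1) ^+ b * H by rewrite vec3E.
rewrite ep in pk pq rp n0; rewrite eq in qk pq qr n0; rewrite er in rk qr rp n0.
have flat : bp = bq -> bp = br -> False.
  move=> e1 e2.
  have [||||h0 h1] := @horizontal_collinear v _ _ _ _ _ _ _ n0.
  - by rewrite pk qk.
  - by rewrite pk rk.
  - by rewrite !lev e1.
  - by rewrite !lev e2.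
  by move: nz; rewrite /rho2 h0 h1 expr0n addr0 eqxx.
have [e1|e1] := eqVneq bp bq.
  have e2 : br = ~~ bp.
    by case: (eqVneq bp br) => [/(flat e1) //|]; case: (bp) (br) => -[].
  by subst bq br; apply: (key bp jp jq jr).
have [e2|e2] := eqVneq bp br.
  have e3 : bq = ~~ bp by case: (bp) (bq) e1 => -[].
  by subst br bq; apply: (key bp jp jr jq) => // e; apply: rp.
have e3 : bp = ~~ bq by case: (bp) (bq) e1 => -[].
have e4 : br = bq by case: (bp) (bq) (br) e1 e2 => -[] -[].
by subst bp br; apply: (key bq jq jr jp).
Qed.

(** A vertical normal would leave the others a squared vertical part of exactly 1/9, which
    [antiprism_facet] excludes; otherwise four squares below 1/9 cannot sum to 4/3. *)
Lemma antiprism_no_dirs n : (4 <= n)%N -> ~ tetra_dirs (@antiprism_vertices R n).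
Proof.
move=> n4 [a [k [fa hf]]].
have dich i := antiprism_facet n4 (fa.1 i) (hf i).
have e3 (v : point) : dot v (vec3 0 0 1) = v 0 2 by rewrite !coordE; ring.
have tot := tetra_frame_squares (vec3 0 0 1) fa; rewrite !e3 vec3E in tot.
have none i : a i 0 2 ^+ 2 != 1.
  apply/eqP => hi.
  have h0 : a i 0 0 ^+ 2 + a i 0 1 ^+ 2 = 0.
    by have := fa.1 i; rewrite unit_coord_sum; lra.
  have [z0 z1] : a i 0 0 = 0 /\ a i 0 1 = 0.
    have := sqr_ge0 (a i 0 0); have := sqr_ge0 (a i 0 1).
    by split; apply/eqP; rewrite -sqrf_eq0; apply/eqP; lra.
  have [j ij] : exists j : 'I_4, i != j.
    by case: (eqVneq i 0) => [->|ni]; [exists 1|exists 0].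
  have : (a i 0 2 * a j 0 2) ^+ 2 = 1 / 9.
    have := fa.2 _ _ ij; rewrite dotE z0 z1 !mul0r !add0r => ->.
    by field.
  by rewrite exprMn hi => h; case: (dich j); lra.
have lt i : a i 0 2 ^+ 2 < 1 / 9.
  by case: (dich i) => // h; move: (none i); rewrite h eqxx.
move: tot; rewrite big_ord4 !e3.
by have := lt 0; have := lt 1; have := lt 2; have := lt 3; lra.
Qed.

End Directions.

(** * Facets of the dodecahedron *)

Section NamedSolids.
Variable R : realType.
Local Notation point := 'rV[R]_3.
Local Notation similar := Defs.similar.
Local Notation g := (golden R).
Implicit Types (u v w x y p q r : point) (k c : R) (W S T : set point).
Implicit Types (a : 'I_4 -> point).

(** Absolute coordinates of the vertices: type 0 is the cube, the others are ordered by the position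
    of their zero. Sign changes reduce every facet to this octant. *)
Definition dodeca_type (t : 'I_4) : point :=
  [:: vec3 1 1 1; vec3 0 (g - 1) g; vec3 g 0 (g - 1); vec3 (g - 1) g 0]`_t.

Definition has_type t v := forall i, `|v 0 i| = dodeca_type t 0 i.

Lemma has_typeP t v : `|v 0 0| = dodeca_type t 0 0 ->
  `|v 0 1| = dodeca_type t 0 1 -> `|v 0 2| = dodeca_type t 0 2 -> has_type t v.
Proof. by move=> h0 h1 h2 i; case: (ord3P i) => ->. Qed.

Lemma dodeca_typeP v : dodecahedron_vertices v <-> exists t, has_type t v.
Proof.
have o v' (i j k : 'I_3) : val (i + j) = val k -> v' 0 (i + j) = v' 0 k :> R.
  by move=> e; congr (v' _ _); apply: val_inj.
split=> [/dodecahedron_vertexP[h|[i [h0 h1 h2]]]|[t h]].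
- by exists 0; apply: has_typeP; rewrite h /dodeca_type /= vec3E.
- move: h0 h1 h2; case: (ord3P i) => -> h0.
  + rewrite (o _ 0 1 1) // (o _ 0 2 2) // => h1 h2; exists 1.
    by apply: has_typeP; rewrite ?h0 ?h1 ?h2 ?normr0 /dodeca_type /= vec3E.
  + rewrite (o _ 1 1 2) // (o _ 1 2 0) // => h1 h2; exists 2.
    by apply: has_typeP; rewrite ?h0 ?h1 ?h2 ?normr0 /dodeca_type /= vec3E.
  + rewrite (o _ 2 1 0) // (o _ 2 2 1) // => h1 h2; exists 3.
    by apply: has_typeP; rewrite ?h0 ?h1 ?h2 ?normr0 /dodeca_type /= vec3E.
apply/dodecahedron_vertexP.
have h0 := h 0; have h1 := h 1; have h2 := h 2; move: h h0 h1 h2.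
case: (ord4P t) => ->; rewrite /dodeca_type /= !vec3E => h h0 h1 h2.
- by left=> i; case: (ord3P i) => ->.
- right; exists 0; rewrite (o _ 0 1 1) // (o _ 0 2 2) //; split=> //.
  exact: normr0_eq0.
- right; exists 1; rewrite (o _ 1 1 2) // (o _ 1 2 0) //; split=> //.
  exact: normr0_eq0.
- right; exists 2; rewrite (o _ 2 1 0) // (o _ 2 2 1) //; split=> //.
  exact: normr0_eq0.
Qed.

Lemma dodeca_type_ge0 t i : 0 <= dodeca_type t 0 i.
Proof.
have := golden_gt1 R; case: (ord4P t) => ->; case: (ord3P i) => ->;
  rewrite /dodeca_type /= vec3E; lra.
Qed.

Lemma flip_dodeca i v : dodecahedron_vertices v -> dodecahedron_vertices (flip i v).
Proof.
move=> /dodeca_typeP[t h]; apply/dodeca_typeP; exists t => j.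
by rewrite mxE; case: ifP => _; rewrite ?normrN h.
Qed.

(** Multiplication by [g - 1] and the equation of the golden ratio eliminate [x], [z] and [k]. *)
Lemma dodeca_three_types (x y z k : R) : x + y + z = k ->
  (g - 1) * y + g * z = k -> (g - 1) * z + g * x = k -> y = 0.
Proof.
have gg := sqr_golden R; have g1 := golden_gt1 R; move: gg g1.
set G := golden R => gg g1 h0 h1 h2; have /eqP : (2 * G - 2) * y = 0.
  have e1 : (G - 1) * (x + y + z) = (G - 1) * k by rewrite h0.
  have e2 : (G - 1) * ((G - 1) * y + G * z) = (G - 1) * k by rewrite h1.
  have gy : G * G * y = (G + 1) * y by rewrite gg.
  have gz : G * G * z = (G + 1) * z by rewrite gg.
  lra.
by rewrite mulf_eq0 => /orP[]/eqP //; lra.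
Qed.

(** Each pair of types in contact either contradicts a bound or gives the golden ratio. *)
Lemma dodeca_two_types (x z k : R) (s t : 'I_4) : 0 < x -> 0 < z ->
  (forall t, dot (vec3 x 0 z) (dodeca_type t) <= k) -> s != t ->
  dot (vec3 x 0 z) (dodeca_type s) = k ->
  dot (vec3 x 0 z) (dodeca_type t) = k -> z = g * x.
Proof.
move=> x0 z0 le st hs ht; have := le 0; have gg := sqr_golden R.
have g1 := golden_gt1 R; have g2 := golden_lt2 R.
have gx : g * (g * x) = (g + 1) * x by rewrite mulrA gg.
have gz : g * (g * z) = (g + 1) * z by rewrite mulrA gg.
have gx2 : (g - 1) * x < 1 * x by rewrite ltr_pM2r //; lra.
have hs' : g * dot (vec3 x 0 z) (dodeca_type s) = g * k by rewrite hs.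
have ht' : g * dot (vec3 x 0 z) (dodeca_type t) = g * k by rewrite ht.
move: st hs ht hs' ht'; case: (ord4P s) => ->; case: (ord4P t) => -> // _;
  rewrite /dodeca_type /= !dotE !vec3E; lra.
Qed.

(** The pentagons are normal to the cyclic shifts of [(1, 0, g)] up to signs and scale, of squared
    norm [1 + g * g = g + 2]. The cases go by the zero coordinates of [v]. *)
Lemma dodeca_facet v k : dot v v = 1 -> facet (@dodecahedron_vertices R) v k ->
  [\/ v 0 0 ^+ 2 = 0, v 0 0 ^+ 2 * (g + 2) = 1 |
    (1 - v 0 0 ^+ 2) * (g + 2) = 1].
Proof.
move=> vv [hv [p [q [r [[Dp pk] [Dq qk] [Dr rk] n0]]]]].
have [->|v0] := eqVneq (v 0 0) 0; first by constructor 1; rewrite expr0n.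
have gg := sqr_golden R; have g1 := golden_gt1 R; have g2 := golden_lt2 R.
pose A : point := vec3 `|v 0 0| `|v 0 1| `|v 0 2|.
have fm i := flip_max (fun w => @flip_dodeca i w) hv.
have val t x : has_type t x -> dodecahedron_vertices x -> dot v x = k ->
    dot A (dodeca_type t) = k.
  move=> ht Dx xk; have e i : `|v 0 i| * dodeca_type t 0 i = v 0 i * x 0 i.
    by rewrite -ht -normrM ger0_norm //; exact: fm Dx xk.
  by rewrite -xk !dotE !vec3E !e.
have bound t : dot A (dodeca_type t) <= k.
  pose x := vec3 (sgn1 (v 0 0) * dodeca_type t 0 0)
    (sgn1 (v 0 1) * dodeca_type t 0 1) (sgn1 (v 0 2) * dodeca_type t 0 2).
  have <- : dot v x = dot A (dodeca_type t).
    by rewrite !dotE !vec3E !mulrA !sgn1_mul.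
  apply: hv; apply/dodeca_typeP; exists t.
  by apply: has_typeP; rewrite vec3E normrM sgn1_norm mul1r ger0_norm //;
    exact: dodeca_type_ge0.
have [tp hp] := (dodeca_typeP _).1 Dp; have [tq hq] := (dodeca_typeP _).1 Dq.
have [tr hr] := (dodeca_typeP _).1 Dr.
have kp := val _ _ hp Dp pk; have kq := val _ _ hq Dq qk.
have kr := val _ _ hr Dr rk.
have same i t x y : has_type t x -> has_type t y -> dodecahedron_vertices x ->
    dodecahedron_vertices y -> dot v x = k -> dot v y = k -> v 0 i != 0 ->
    x 0 i = y 0 i.
  move=> hx hy Dx Dy xk yk vi; apply: (same_sign (x := v 0 i)) => //.
  - exact: fm Dx xk.
  - exact: fm Dy yk.
  - by rewrite hx hy.
have pos (z : R) : z != 0 -> 0 < `|z| by rewrite normr_gt0.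
have n1 := noncollinear_rot n0; have n2 := noncollinear_rot n1.
have neqT x y z t s : has_type t x -> has_type s y ->
    dodecahedron_vertices x -> dodecahedron_vertices y -> dot v x = k ->
    dot v y = k -> noncollinear x y z -> v 0 1 != 0 -> v 0 2 != 0 -> t != s.
  move=> hx hy Dx Dy xk yk n v1 v2; apply/eqP => ts; rewrite -ts in hy.
  have /eqP := noncollinear_neq n; apply.
  by apply: vec3P; apply: same hx hy Dx Dy xk yk _.
(* Where two coordinates of [v] are non-zero, contact points of one type agree in both, so
   noncollinearity brings in a second type. *)
have two (i : 'I_3) : i != 0 -> v 0 i != 0 -> exists s t, [/\ s != t,
    dot A (dodeca_type s) = k & dot A (dodeca_type t) = k].
  move=> i0 vi; have [e1|ne] := eqVneq tp tq; last by exists tp, tq.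
  have [e2|ne] := eqVneq tp tr; last by exists tp, tr.
  exfalso; rewrite -e1 in hq; rewrite -e2 in hr.
  rewrite eq_sym in i0; apply: (collinear_coords i0 _ _ _ _ n0).
  - exact: same hp hq Dp Dq pk qk v0.
  - exact: same hp hr Dp Dr pk rk v0.
  - exact: same hp hq Dp Dq pk qk vi.
  - exact: same hp hr Dp Dr pk rk vi.
have sq (z : R) : `|z| ^+ 2 = z ^+ 2 by rewrite real_normK ?num_real.
have vv3 := vv; rewrite unit_coord_sum in vv3.
have a0 := pos _ v0.
have [v1|v1] := eqVneq (v 0 1) 0; have [v2|v2] := eqVneq (v 0 2) 0.
(* A normal along the first axis touches only the type with the largest first coordinate, whose
   contact points lie on a line. *)
- exfalso; have aE : A = vec3 `|v 0 0| 0 0 by rewrite /A v1 v2 normr0.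
  have only t : dot A (dodeca_type t) = k -> t = 2.
    have := bound 2; rewrite aE; case: (ord4P t) => -> //;
      rewrite /dodeca_type /= !dotE !vec3E => h e; exfalso; move: h; rewrite -e; nra.
  have ep := only _ kp; have eq := only _ kq; have er := only _ kr.
  have z1 t x : t = 2 -> has_type t x -> x 0 1 = 0.
    by move=> -> /(_ 1); rewrite /dodeca_type /= vec3E => /normr0_eq0.
  have i01 : (0 : 'I_3) != 1 by [].
  rewrite ep in hp; rewrite eq in hq; rewrite er in hr.
  apply: (collinear_coords i01 _ _ _ _ n0).
  + exact: same hp hq Dp Dq pk qk v0.
  + exact: same hp hr Dp Dr pk rk v0.
  + by rewrite (z1 _ _ erefl hp) (z1 _ _ erefl hq).
  + by rewrite (z1 _ _ erefl hp) (z1 _ _ erefl hr).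
- have [s [t [st ks kt]]] := two 2 isT v2.
  have aE : A = vec3 `|v 0 0| 0 `|v 0 2| by rewrite /A v1 normr0.
  rewrite aE in ks kt bound.
  have e := dodeca_two_types a0 (pos _ v2) bound st ks kt.
  constructor 2; have : `|v 0 2| ^+ 2 = (g * g) * `|v 0 0| ^+ 2 by rewrite e; ring.
  rewrite !sq gg; move: vv3; rewrite v1; lra.
- have [s [t [st ks kt]]] := two 1 isT v1.
  have a1 := pos _ v1.
  (* The cyclic symmetry moves the zero coordinate to the middle. *)
  pose cyc (t : 'I_4) : 'I_4 := [:: 0; 3; 1; 2]`_t.
  have cycE t' : dot (vec3 `|v 0 1| 0 `|v 0 0|) (dodeca_type (cyc t')) =
      dot A (dodeca_type t').
    rewrite /A v2 normr0; case: (ord4P t') => ->;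
      rewrite /cyc /dodeca_type /= !dotE !vec3E; ring.
  have cyci : injective cyc.
    by move=> i j; case: (ord4P i) => ->; case: (ord4P j) => ->.
  have cycs t' : exists t'', t' = cyc t''.
    by case: (ord4P t') => ->; [exists 0|exists 2|exists 3|exists 1].
  have e : `|v 0 0| = g * `|v 0 1|.
    apply: (@dodeca_two_types _ _ k (cyc s) (cyc t)) => //.
    + by move=> t'; have [t'' ->] := cycs t'; rewrite cycE.
    + by rewrite (inj_eq cyci).
    + by rewrite cycE.
    + by rewrite cycE.
  constructor 3; have : `|v 0 0| ^+ 2 = (g * g) * `|v 0 1| ^+ 2 by rewrite e; ring.
  rewrite !sq gg; move: vv3; rewrite v2 expr0n addr0 => vv3 e3.
  by have -> : 1 - v 0 0 ^+ 2 = v 0 1 ^+ 2; lra.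
(* Without zero coordinates each type has at most one contact point, so three types occur; every
   triple of types is impossible. *)
- exfalso; have a1 := pos _ v1; have a2 := pos _ v2.
  have pq := neqT _ _ _ _ _ hp hq Dp Dq pk qk n0 v1 v2.
  have qr := neqT _ _ _ _ _ hq hr Dq Dr qk rk n1 v1 v2.
  have rp := neqT _ _ _ _ _ hr hp Dr Dp rk pk n2 v1 v2.
  have E0 : dot A (dodeca_type 0) = `|v 0 0| + `|v 0 1| + `|v 0 2|.
    by rewrite /dodeca_type /= !dotE !vec3E; ring.
  have E1 : dot A (dodeca_type 1) = (g - 1) * `|v 0 1| + g * `|v 0 2|.
    by rewrite /dodeca_type /= !dotE !vec3E; ring.
  have E2 : dot A (dodeca_type 2) = (g - 1) * `|v 0 2| + g * `|v 0 0|.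
    by rewrite /dodeca_type /= !dotE !vec3E; ring.
  have E3 : dot A (dodeca_type 3) = (g - 1) * `|v 0 0| + g * `|v 0 1|.
    by rewrite /dodeca_type /= !dotE !vec3E; ring.
  have b0 := bound 0; rewrite E0 in b0.
  have f012 : dot A (dodeca_type 0) = k -> dot A (dodeca_type 1) = k ->
      dot A (dodeca_type 2) = k -> False.
    rewrite E0 E1 E2 => h0 h1 h2; move: a1.
    by rewrite (dodeca_three_types h0 h1 h2) ltxx.
  have f023 : dot A (dodeca_type 0) = k -> dot A (dodeca_type 2) = k ->
      dot A (dodeca_type 3) = k -> False.
    rewrite E0 E2 E3 => h0 h1 h2.
    have h0' : `|v 0 1| + `|v 0 2| + `|v 0 0| = k.
      by rewrite -h0 -[RHS]addrA [RHS]addrC.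
    by move: a2; rewrite (dodeca_three_types h0' h1 h2) ltxx.
  have f031 : dot A (dodeca_type 0) = k -> dot A (dodeca_type 3) = k ->
      dot A (dodeca_type 1) = k -> False.
    rewrite E0 E3 E1 => h0 h1 h2.
    have h0' : `|v 0 2| + `|v 0 0| + `|v 0 1| = k.
      by rewrite -h0 [RHS]addrC addrA.
    by move: a0; rewrite (dodeca_three_types h0' h1 h2) ltxx.
  (* The three equations sum to [(2 * g - 1) * s = 3 * k], while type 0 gives [s <= k]; hence
     [2 * g - 1 >= 3], against [g < 2]. *)
  have f123 : dot A (dodeca_type 1) = k -> dot A (dodeca_type 2) = k ->
      dot A (dodeca_type 3) = k -> False.
    rewrite E1 E2 E3 => h1 h2 h3; move: b0; clear -h1 h2 h3 a0 a1 a2 g1 g2.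
    set s := _ + `|v 0 2| => b0; have s0 : 0 < s by rewrite !addr_gt0.
    have : (2 * g - 1) * s = 3 * k by rewrite /s; lra.
    have : g * s < 2 * s by rewrite ltr_pM2r.
    lra.
  move: kp kq kr pq qr rp; clear -f012 f023 f031 f123.
  by case: (ord4P tp) => ->; case: (ord4P tq) => ->; case: (ord4P tr) => -> // *;
    (exact: f012 || exact: f023 || exact: f031 || exact: f123).
Qed.

(** The squares take the values 0, [al] and [1 - al]. The values of [al] nearest to the interval
    from 1/4 to 2/7 for which four of them sum to 4/3 are 1/6 and 1/3. *)
Lemma dodecahedron_no_dirs : ~ tetra_dirs (@dodecahedron_vertices R).
Proof.
move=> [a [k [fa hf]]].
have e1 (v : point) : dot v (vec3 1 0 0) = v 0 0 by rewrite !coordE; ring.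
have tot := tetra_frame_squares (vec3 1 0 0) fa; rewrite !e1 vec3E in tot.
have g1 := golden_gt32 R; have g2 := golden_lt2 R.
have g20 : 0 < g + 2 by lra.
pose al := (g + 2)^-1.
have al1 : al < 2 / 7 by rewrite /al invf_plt ?posrE //; lra.
have al2 : 1 / 4 < al by rewrite /al; rewrite -[X in X < _]invrK ltf_pV2 ?posrE //; lra.
have dich i : [\/ a i 0 0 ^+ 2 = 0, a i 0 0 ^+ 2 = al | a i 0 0 ^+ 2 = 1 - al].
  have gn : g + 2 != 0 by rewrite gt_eqF.
  have inv (z : R) : z * (g + 2) = 1 -> z = al.
    by move=> e; rewrite -[z](mulfK gn) e mul1r.
  case: (dodeca_facet (fa.1 i) (hf i)) => h; first by constructor 1.
    by constructor 2; apply: inv.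
  by constructor 3; have := inv _ h; lra.
move: tot; rewrite big_ord4 !e1.
by case: (dich 0) => ->; case: (dich 1) => ->; case: (dich 2) => ->;
  case: (dich 3) => ->; lra.
Qed.

End NamedSolids.

(** * The octahedron as the 3-antiprism *)

Section OctahedronIcosahedron.
Variable R : realType.
Local Notation point := 'rV[R]_3.
Local Notation similar := Defs.similar.
Local Notation g := (golden R).
Implicit Types (u v w x y p q r : point) (c : R) (W S T : set point).

Lemma octahedron_vertexP v : octahedron_vertices v <->
  exists s : R, `|s| = 1 /\
    [\/ v = vec3 s 0 0, v = vec3 0 s 0 | v = vec3 0 0 s].
Proof.
have o v' (i j k : 'I_3) : val (i + j) = val k -> v' 0 (i + j) = v' 0 k :> R.
  by move=> e; congr (v' _ _); apply: val_inj.
split=> [[i [h0 h1 h2]]|[s [s1 e]]].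
- exists (v 0 i); split=> //; move: h0 h1 h2; case: (ord3P i) => -> h0.
  + rewrite (o _ 0 1 1) // (o _ 0 2 2) // => h1 h2.
    by constructor 1; apply: vec3P; rewrite vec3E.
  + rewrite (o _ 1 1 2) // (o _ 1 2 0) // => h1 h2.
    by constructor 2; apply: vec3P; rewrite vec3E.
  + rewrite (o _ 2 1 0) // (o _ 2 2 1) // => h1 h2.
    by constructor 3; apply: vec3P; rewrite vec3E.
case: e => ->; [exists 0|exists 1|exists 2].
- by rewrite (o _ 0 1 1) // (o _ 0 2 2) // !vec3E.
- by rewrite (o _ 1 1 2) // (o _ 1 2 0) // !vec3E.
- by rewrite (o _ 2 1 0) // (o _ 2 2 1) // !vec3E.
Qed.

Lemma cos_sin_third : cos (pi / 3) = 1 / 2 :> R /\ sin (pi / 3) ^+ 2 = 3 / 4 :> R.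
Proof.
have [d0 dpi dh cpos spos] := half_turn_fraction R (isT : (3 <= 3)%N).
have cs : cos (pi / 3) ^+ 2 + sin (pi / 3) ^+ 2 = 1 :> R by exact: cos2Dsin2.
have e2 : cos (2 * pi / 3) = 2 * cos (pi / 3) ^+ 2 - 1 :> R by rewrite cos_half dh.
suff c3E : cos (pi / 3) = 1 / 2 :> R by rewrite c3E in cs; split=> //; lra.
have e1 : cos (2 * pi / 3) = - cos (pi / 3) :> R.
  have -> : 2 * pi / 3 = - (pi / 3) + pi :> R by field.
  by rewrite cosDpi cosN.
have : (2 * cos (pi / 3) - 1) * (cos (pi / 3) + 1) = 0 :> R by lra.
by move/eqP; rewrite mulf_eq0 => /orP[]/eqP; lra.
Qed.

(** The six vertices are plus and minus three orthogonal vectors [w0], [w1], [w2] of squared length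
    3/2: the axes of an octahedron. *)
Lemma antiprism3_octahedron :
  similar (@octahedron_vertices R) (@antiprism_vertices R 3).
Proof.
have [cE sE] := cos_sin_third; set h := antiprism_height R 3.
have hh : h ^+ 2 = 1 / 2.
  have e6 : sin (pi / 3 / 2) ^+ 2 = 1 / 4 :> R.
    by rewrite sin2cos2; have := cos_half (pi / 3 : R); rewrite cE; lra.
  by rewrite /h /antiprism_height sqr_sqrtr sE e6; lra.
pose C (k : nat) : R := cos (k%:R * (pi / 3)).
pose D (k : nat) : R := sin (k%:R * (pi / 3)).
set s : R := sin (pi / 3) in sE.
have C0 : C 0%N = 1 by rewrite /C mul0r cos0.
have D0 : D 0%N = 0 by rewrite /D mul0r sin0.
(* The addition formulas for the angle [pi / 3] give the six vertices one after the other. *)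
have CS k : C k.+1 = C k / 2 - D k * s.
  by rewrite /C /D /s -natr1 mulrDl mul1r cosD cE; ring.
have DS k : D k.+1 = D k / 2 + C k * s.
  by rewrite /C /D /s -natr1 mulrDl mul1r sinD cE; ring.
have [C1 D1] : C 1%N = 1 / 2 /\ D 1%N = s by rewrite (CS 0%N) (DS 0%N) C0 D0; split; ring.
have [C2 D2] : C 2%N = - (1 / 2) /\ D 2%N = s by rewrite (CS 1%N) (DS 1%N) C1 D1; lra.
have [C3 D3] : C 3%N = -1 /\ D 3%N = 0 by rewrite (CS 2%N) (DS 2%N) C2 D2; lra.
have [C4 D4] : C 4%N = - (1 / 2) /\ D 4%N = - s by rewrite (CS 3%N) (DS 3%N) C3 D3; lra.
have [C5 D5] : C 5%N = 1 / 2 /\ D 5%N = - s by rewrite (CS 4%N) (DS 4%N) C4 D4; lra.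
pose w0 : point := vec3 1 0 h; pose w1 : point := vec3 (- (1 / 2)) s h.
pose w2 : point := vec3 (- (1 / 2)) (- s) h.
have wP v : antiprism_vertices 3 v <->
    exists e : R, `|e| = 1 /\ [\/ v = e *: w0, v = e *: w1 | v = e *: w2].
  split=> [[k [v0 v1 v2]]|[e [/abs1P e1 ev]]].
    have : v = vec3 (C k) (D k) ((-1) ^+ k * h) by apply: vec3P; rewrite vec3E.
    case: k {v0 v1 v2} => [[|[|[|[|[|[|k]]]]]] //= _] ->.
    - exists 1; rewrite normr1; split=> //; constructor 1.
      by rewrite C0 D0; apply: vec3P; rewrite !coordE; ring.
    - exists (-1); rewrite normrN1; split=> //; constructor 3.
      by rewrite C1 D1; apply: vec3P; rewrite !coordE; ring.
    - exists 1; rewrite normr1; split=> //; constructor 2.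
      by rewrite C2 D2; apply: vec3P; rewrite !coordE; ring.
    - exists (-1); rewrite normrN1; split=> //; constructor 1.
      by rewrite C3 D3; apply: vec3P; rewrite !coordE; ring.
    - exists 1; rewrite normr1; split=> //; constructor 3.
      by rewrite C4 D4; apply: vec3P; rewrite !coordE; ring.
    - exists (-1); rewrite normrN1; split=> //; constructor 2.
      by rewrite C5 D5; apply: vec3P; rewrite !coordE; ring.
  have mk x (k : nat) (lt : (k < 6)%N) : x = vec3 (C k) (D k) ((-1) ^+ k * h) ->
      antiprism_vertices 3 x.
    by move=> ->; exists (Ordinal lt); rewrite !vec3E.
  case: ev => ->; case: e1 => ->.
  - by apply: (mk _ 0%N) => //; rewrite C0 D0; apply: vec3P; rewrite !coordE; ring.
  - by apply: (mk _ 3%N) => //; rewrite C3 D3; apply: vec3P; rewrite !coordE; ring.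
  - by apply: (mk _ 2%N) => //; rewrite C2 D2; apply: vec3P; rewrite !coordE; ring.
  - by apply: (mk _ 5%N) => //; rewrite C5 D5; apply: vec3P; rewrite !coordE; ring.
  - by apply: (mk _ 4%N) => //; rewrite C4 D4; apply: vec3P; rewrite !coordE; ring.
  - by apply: (mk _ 1%N) => //; rewrite C1 D1; apply: vec3P; rewrite !coordE; ring.
pose c : R := Num.sqrt (3 / 2).
have c0 : 0 < c by rewrite sqrtr_gt0.
have cc : c ^+ 2 = 3 / 2 by rewrite sqr_sqrtr //; lra.
have ci : c^-1 * c^-1 = 2 / 3 by rewrite -expr2 exprVn cc; field.
have cn : c != 0 by rewrite gt_eqF.
have oQ : orthm (mat3 (c^-1 *: w0) (c^-1 *: w1) (c^-1 *: w2)).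
  have d x y e : dot x y = e -> dot (c^-1 *: x) (c^-1 *: y) = 2 / 3 * e.
    by move=> <-; rewrite dotZl dotZr mulrA ci.
  apply: orthm_mat3; split; split.
  - by rewrite (d _ _ (3 / 2)) ?coordE; [field|lra].
  - by rewrite (d _ _ (3 / 2)) ?coordE; [field|lra].
  - by rewrite (d _ _ (3 / 2)) ?coordE; [field|lra].
  - by rewrite (d _ _ 0) ?mulr0 // !coordE; lra.
  - by rewrite (d _ _ 0) ?mulr0 // !coordE; lra.
  - by rewrite (d _ _ 0) ?mulr0 // !coordE; lra.
apply/similarP; exists c, (mat3 (c^-1 *: w0) (c^-1 *: w1) (c^-1 *: w2)), 0.
split=> //.
have cK (z : R) : c * z / c = z by rewrite mulrAC mulfV // mul1r.
have im (x0 x1 x2 : R) : aff c (mat3 (c^-1 *: w0) (c^-1 *: w1) (c^-1 *: w2)) 0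
    (vec3 x0 x1 x2) = x0 *: w0 + x1 *: w1 + x2 *: w2.
  rewrite /aff addr0 mat3E !vec3E !scalerDr !scalerA.
  by rewrite !cK.
apply/seteqP; split=> [_ [x /octahedron_vertexP[e [e1 h']] <-]|v /wP[e [e1 h']]].
  apply/wP; exists e; split=> //; case: h' => ->; rewrite im !scale0r ?addr0 ?add0r.
  - by constructor 1.
  - by constructor 2.
  - by constructor 3.
case: h' => ->; [exists (vec3 e 0 0)|exists (vec3 0 e 0)|exists (vec3 0 0 e)];
  rewrite ?im ?scale0r ?addr0 ?add0r //; apply/octahedron_vertexP; exists e;
  split=> //; by [constructor 1|constructor 2|constructor 3].
Qed.

End OctahedronIcosahedron.

(** * Directions of the octahedron and the icosahedron, and the final equivalence *)

Section InscribedSolids.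
Variable R : realType.
Local Notation point := 'rV[R]_3.
Local Notation similar := Defs.similar.
Local Notation g := (golden R).
Local Notation t := (tetra_vertex R).
Implicit Types (u v w x y p q r : point) (c m : R) (W S T : set point).
Implicit Types (a : 'I_4 -> point).

(** Four alternate diagonals of a cube are the negatives of the standard normals up to scale, so
    they form a frame as well. *)
Lemma diagonal_dirs W m : (forall i, facet W (t i) m) -> tetra_dirs W.
Proof.
move=> h; exists (fun i => (Num.sqrt 3)^-1 *: t i), (fun=> (Num.sqrt 3)^-1 * m).
split; last by move=> i; apply: facetZ => //; rewrite invr_gt0 sqrtr_gt0.
have [f1 f2] := std_normal_frame R.
have e i : (Num.sqrt 3)^-1 *: t i = - std_normal R i by rewrite /std_normal scaleNr opprK.
by split=> [i|i j ij]; rewrite !e dotNl dotNr opprK ?f1 // f2.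
Qed.

Lemma dot_tetra_vertex i x : dot (t i) x <= `|x 0 0| + `|x 0 1| + `|x 0 2|.
Proof.
have h (z : R) : z <= `|z| /\ - z <= `|z|.
  by split; [exact: ler_norm|rewrite -normrN; exact: ler_norm].
have [a0 b0] := h (x 0 0); have [a1 b1] := h (x 0 1); have [a2 b2] := h (x 0 2).
by case: (ord4P i) => ->; rewrite /tetra_vertex /= !coordE; lra.
Qed.

Lemma tetra_vertex_norm i j : `|t i 0 j| = 1.
Proof.
by case: (ord4P i) => ->; case: (ord3P j) => ->;
  rewrite /tetra_vertex /= vec3E ?normrN1 ?normr1.
Qed.

Lemma octahedron_dirs : tetra_dirs (@octahedron_vertices R).
Proof.
apply: (@diagonal_dirs _ 1) => i; split=> [x Ox|].
  apply: le_trans (dot_tetra_vertex i x) _.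
  by case/octahedron_vertexP: Ox => s [s1 []] ->; rewrite !vec3E s1 normr0; lra.
have n j := tetra_vertex_norm i j.
exists (vec3 (t i 0 0) 0 0), (vec3 0 (t i 0 1) 0), (vec3 0 0 (t i 0 2)).
split; first split.
- apply/octahedron_vertexP; exists (t i 0 0); split; first exact: n.
  by constructor 1.
- by case: (ord4P i) => ->; rewrite /tetra_vertex /= !coordE; ring.
- split; last by case: (ord4P i) => ->; rewrite /tetra_vertex /= !coordE; ring.
  apply/octahedron_vertexP; exists (t i 0 1); split; first exact: n.
  by constructor 2.
- split; last by case: (ord4P i) => ->; rewrite /tetra_vertex /= !coordE; ring.
  apply/octahedron_vertexP; exists (t i 0 2); split; first exact: n.
  by constructor 3.
apply/eqP => /(congr1 (fun x : point => x 0 0)).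
by case: (ord4P i) => ->; rewrite /tetra_vertex /= !coordE; lra.
Qed.

(** Eight of the twenty facets of the icosahedron are normal to the diagonals of the cube; four
    alternate ones form the frame. *)
Lemma icosahedron_dirs : tetra_dirs (@icosahedron_vertices R).
Proof.
have g1 := golden_gt1 R; have gg := sqr_golden R.
have o v' (i j k : 'I_3) : val (i + j) = val k -> v' 0 (i + j) = v' 0 k :> R.
  by move=> e; congr (v' _ _); apply: val_inj.
apply: (@diagonal_dirs _ (1 + g)) => i; split=> [x [j [x0 x1 x2]]|].
  apply: le_trans (dot_tetra_vertex i x) _; move: x0 x1 x2.
  case: (ord3P j) => -> x0.
  - by rewrite (o _ 0 1 1) // (o _ 0 2 2) // => -> ->; rewrite x0 normr0; lra.
  - by rewrite (o _ 1 1 2) // (o _ 1 2 0) // => -> ->; rewrite x0 normr0; lra.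
  - by rewrite (o _ 2 1 0) // (o _ 2 2 1) // => -> ->; rewrite x0 normr0; lra.
have n j := tetra_vertex_norm i j.
have ng j : `|g * t i 0 j| = g by rewrite normrM n mulr1 ger0_norm //; lra.
exists (vec3 0 (t i 0 1) (g * t i 0 2)), (vec3 (g * t i 0 0) 0 (t i 0 2)),
  (vec3 (t i 0 0) (g * t i 0 1) 0); split; first split.
- by exists 0; rewrite (o _ 0 1 1) // (o _ 0 2 2) // !vec3E.
- by case: (ord4P i) => ->; rewrite /tetra_vertex /= !coordE; ring.
- split; first by exists 1; rewrite (o _ 1 1 2) // (o _ 1 2 0) // !vec3E.
  by case: (ord4P i) => ->; rewrite /tetra_vertex /= !coordE; ring.
- split; first by exists 2; rewrite (o _ 2 1 0) // (o _ 2 2 1) // !vec3E.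
  by case: (ord4P i) => ->; rewrite /tetra_vertex /= !coordE; ring.
apply/eqP => /(congr1 (fun x : point => x 0 0)).
by case: (ord4P i) => ->; rewrite /tetra_vertex /= !coordE; lra.
Qed.

(** Facet normals would come in opposite pairs, while two members of a tetrahedral frame have
    product 1 or -1/3. *)
Lemma centrally_symmetric_not_tetrahedron W S :
  (forall x, W x -> W (- x)) -> tetra_dirs W -> similar (conv_hull W) S ->
  ~ regular_tetrahedron S.
Proof.
move=> hW [b [l [[b1 _] hf]]] hs rS.
have rW : regular_tetrahedron (conv_hull W : set point).
  exact: similar_trans rS (similar_sym hs).
have [a [k [[f1 f2] fT eT]]] := regular_tetraP rW.
have hN : facet W (- b 0) (l 0).
  have [h [p [q [r [[Wp pk] [Wq qk] [Wr rk] n0]]]]] := hf 0.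
  split=> [x Wx|]; first by rewrite dotNl -dotNr; exact: h (hW _ Wx).
  exists (- p), (- q), (- r); rewrite !dotNl !dotNr !opprK; split=> //.
  - by split=> //; exact: hW.
  - by split=> //; exact: hW.
  - by split=> //; exact: hW.
  apply: contra n0 => /eqP e; apply/eqP; rewrite -{}e.
  by apply: vec3P; rewrite !coordE; ring.
rewrite eT in fT; have facetS v c : facet W v c -> facet (simplex a k) v c.
  by rewrite -eT => /facet_conv.
have [i ei _] := simplex_facetP (conj f1 f2) fT (b1 0) (facetS _ _ (hf 0)).
have Nb1 : dot (- b 0) (- b 0) = 1 by rewrite dotNl dotNr opprK b1.
have [j ej _] := simplex_facetP (conj f1 f2) fT Nb1 (facetS _ _ hN).
have : dot (a i) (a j) = -1 by rewrite -ei -ej dotNr b1.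
by have [->|/f2 ->] := eqVneq i j; rewrite ?f1; lra.
Qed.

Lemma octahedron_vertices_opp x :
  octahedron_vertices x -> octahedron_vertices (- x).
Proof. by move=> [i [e0 e1 e2]]; exists i; rewrite !mxE normrN e1 e2 oppr0. Qed.

Lemma icosahedron_vertices_opp x :
  icosahedron_vertices x -> icosahedron_vertices (- x).
Proof. by move=> [i [e0 e1 e2]]; exists i; rewrite !mxE !normrN e0 oppr0. Qed.

End InscribedSolids.

Theorem mainTheorem1 (R : realType) (T S : set 'rV[R]_3)
    (hT : regular_tetrahedron T) (hS : uniform S) :
  admits_face_embedding 4 S T <->
  [\/ regular_icosahedron S, regular_octahedron S | archimedean S].
Proof.
have fS := uniform_full hS; split=> [em|].
  have [dS nT] := embeds_tetra_dirs hT fS (uniform_convex hS) em.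
  have dirs (W : set 'rV[R]_3) : Defs.similar (conv_hull W) S -> tetra_dirs W.
    by move=> /similar_sym hs; apply/tetra_dirs_conv; exact: tetra_dirs_similar hs dS.
  have [aS|na] := pselect (archimedean S); first by constructor 3.
  have [octS|nocta] := pselect (regular_octahedron S); first by constructor 2.
  have [ico|nico] := pselect (regular_icosahedron S); first by constructor 1.
  (* The tetrahedron is excluded by [nT], the icosahedron and the octahedron are already set aside,
     and the other families have no tetrahedral directions. *)
  exfalso; apply: na; split=> // [[//|/dirs|//|[/dirs|//]]|[n _ /dirs]|[n n3 hs]].
  - exact: cube_no_dirs.
  - exact: dodecahedron_no_dirs.
  - exact: prism_no_dirs.
  (* The remaining case [n = 3] is the octahedron. *)
  have [n4|] := leqP 4 n; first exact: antiprism_no_dirs n4 (dirs _ hs).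
  rewrite ltnS => n3'; have n3E : n = 3%N by apply/eqP; rewrite eqn_leq n3' n3.
  rewrite n3E in hs; apply: nocta.
  exact: similar_trans (similar_conv (@antiprism3_octahedron R)) hs.
suff h : [\/ regular_icosahedron S, regular_octahedron S | archimedean S] ->
    tetra_dirs S /\ ~ regular_tetrahedron S.
  by move=> /h[dS nT]; exact: tetra_dirs_embeds.
case=> [hs|hs|aS].
- split; first exact/(tetra_dirs_similar hs)/tetra_dirs_conv/icosahedron_dirs.
  exact: centrally_symmetric_not_tetrahedron (@icosahedron_vertices_opp R)
    (icosahedron_dirs R) hs.
- split; first exact/(tetra_dirs_similar hs)/tetra_dirs_conv/octahedron_dirs.
  exact: centrally_symmetric_not_tetrahedron (@octahedron_vertices_opp R)
    (octahedron_dirs R) hs.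
- split; first exact: archimedean_dirs.
  by move=> hs; case: aS => _ + _ _; apply; constructor 1.
Qed.
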